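(* Let $E$ be a DTMIB of class $*-\dagger$ on $\mathbb{R}^d$, with $E=F'$ where $F$ is a TMIB of class $*-\dagger$. Then $$\|g\ast f\|_E\le\|g\|_{L^1_{\omega_E}}\|f\|_E,\quad\forall g\in L^1_{\omega_E},\ \forall f\in E,$$ and $$\|h\cdot f\|_E\le\|h\|_{A_{\nu_E}}\|f\|_E,\quad\forall h\in A_{\nu_E},\ \forall f\in E.$$ Furthermore, for $f\in E$, $g\in L^1_{\omega_E}$ and $h\in A_{\nu_E}$, the representations $$g\ast f=\int_{\mathbb{R}^d}g(y)\,T_yf\,dy\quad\text{and}\quad h\cdot f=\int_{\mathbb{R}^d}(\mathcal{F}^{-1}h)(\xi)\,M_{-\xi}f\,d\xi$$ are valid if interpreted as $E$-valued Pettis integrals (taken in the weak* topology of $E$ with respect to the duality $E=F'$).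
   Context: **Weight sequences.** $M_p$, $A_p$ ($p\in\mathbb{N}$) are sequences of positive numbers with $M_0=M_1=A_0=A_1=1$, both satisfying (written for $M_p$): (M.1) $M_p^2\le M_{p-1}M_{p+1}$, $p\ge1$; (M.2) $M_p\le c_0H^p\min_{0\le q\le p}M_{p-q}M_q$ for some $c_0,H\ge1$; (M.6) $p!\le c_0L_0^pM_p$ for some $c_0,L_0\ge1$. Associated functions: $M(\rho)=\sup_{p\in\mathbb{N}}\ln_+(\rho^p/M_p)$, $\rho\ge0$, and $A(\rho)$ likewise from $A_p$; $M_h(\rho)=M(h\rho)$, $A_h(\rho)=A(h\rho)$ for $h>0$. Write $M_\alpha=M_{|\alpha|}$ for $\alpha\in\mathbb{N}^d$. **Gelfand–Shilov spaces.** $\mathcal{S}^{M_p,h}_{A_p,h}$ is the Banach space of $\varphi\in C^\infty(\mathbb{R}^d)$ with $\sup_\alpha h^{|\alpha|}\|e^{A_h(|\cdot|)}D^\alpha\varphi\|_{L^\infty}/M_\alpha<\infty$; $\mathcal{S}^{(M_p)}_{(A_p)}(\mathbb{R}^d)=\varprojlim_{h\to\infty}\mathcal{S}^{M_p,h}_{A_p,h}$ and $\mathcal{S}^{\{M_p\}}_{\{A_p\}}(\mathbb{R}^d)=\varinjlim_{h\to0^+}\mathcal{S}^{M_p,h}_{A_p,h}$. $\mathcal{S}^{\emptyset}_{(A_p)}(\mathbb{R}^d)$ is the projective limit over $k\to\infty$ of the spaces of $\varphi\in C^k$ with $\sup_{|\alpha|\le k}\|e^{A_k(|\cdot|)}D^\alpha\varphi\|_{L^\infty}<\infty$;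 $\mathcal{S}^{(M_p)}_{\emptyset}(\mathbb{R}^d)$ is the projective limit over $k\to\infty$ of the spaces of $\varphi\in C^\infty$ with $\sup_\alpha k^{|\alpha|}\|(1+|\cdot|)^kD^\alpha\varphi\|_{L^\infty}/M_\alpha<\infty$; $\mathcal{S}^\emptyset_\emptyset(\mathbb{R}^d)=\mathcal{S}(\mathbb{R}^d)$ is the Schwartz space. $\mathcal{S}^*_\dagger(\mathbb{R}^d)$ denotes any one of these five spaces (the ''Roumieu case'' is $\{M_p\}-\{A_p\}$, the four others are ''Beurling cases''), and $\mathcal{S}'^*_\dagger(\mathbb{R}^d)$ its strong dual. If $*=\emptyset$ one sets $M_h(\rho)=h\ln(1+|\rho|)$; if $\dagger=\emptyset$ one sets $A_h(\rho)=h\ln(1+|\rho|)$. **Operators.** $T_xf=f(\cdot-x)$, $M_\xi f=e^{2\pi i\xi\cdot(\,\cdot\,)}f$, extended to $\mathcal{S}'^*_\dagger(\mathbb{R}^d)$ by duality. $\mathcal{F}f(\xi)=\int e^{-2\pi ix\cdot\xi}f(x)\,dx$, an isomorphism $\mathcal{S}^*_\dagger\to\mathcal{S}^\dagger_*$ and, by duality, $\mathcal{S}'^*_\dagger\to\mathcal{S}'^\dagger_*$. $\check u(x)=u(-x)$. **TMIB.** A Banach space $F$ is a translation-modulation invariant Banach space of ultradistributions (TMIB) of class $*-\dagger$ if: (a) $\mathcal{S}^*_\dagger(\mathbb{R}^d)\subseteq F\subseteq\mathcal{S}'^*_\dagger(\mathbb{R}^d)$ with continuous and dense inclusions; (b)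 $T_x(F)\subseteq F$ and $M_\xi(F)\subseteq F$ for all $x,\xi\in\mathbb{R}^d$; (c) there exist $\tau,C>0$ (in the Roumieu case: for every $\tau>0$ there exists $C=C_\tau>0$) such that $\omega_F(x):=\|T_x\|_{\mathcal{L}(F)}\le Ce^{A_\tau(|x|)}$ and $\nu_F(\xi):=\|M_{-\xi}\|_{\mathcal{L}(F)}\le Ce^{M_\tau(|\xi|)}$. **DTMIB.** A Banach space $E$ is a DTMIB of class $*-\dagger$ if it is the strong dual $E=F'$ of a TMIB $F$ of class $*-\dagger$; it is regarded as a subspace of $\mathcal{S}'^*_\dagger(\mathbb{R}^d)$. Its weight functions are again $\omega_E(x)=\|T_x\|_{\mathcal{L}(E)}$ and $\nu_E(\xi)=\|M_{-\xi}\|_{\mathcal{L}(E)}$; one has $\omega_E=\check\omega_F$, $\nu_E=\nu_F$. **Algebras and module operations.** $L^1_\eta$ has norm $\|g\|_{L^1_\eta}=\|\eta g\|_{L^1}$; $A_\eta=\mathcal{F}L^1_\eta$ with norm $\|\hat u\|_{A_\eta}=\|u\|_{L^1_\eta}$. On the TMIB $F$, the convolution and multiplication of $\mathcal{S}^*_\dagger(\mathbb{R}^d)$ extend uniquely to continuous bilinear mappings $\ast:L^1_{\omega_F}\times F\to F$ and $\cdot:A_{\nu_F}\times F\to F$. For $f\in E=F'$ one defines, by duality, $\langle h\cdot f,\varphi\rangle=\langle f,h\cdot\varphi\rangle$ for $h\in A_{\nu_E}$ and $\langle g\ast f,\varphi\rangle=\langle f,\check g\ast\varphi\rangle$ for $g\in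 L^1_{\omega_E}$, where $\varphi\in F$. *)

(* Defs.v *)
From HB Require Import structures.
From mathcomp Require Import all_boot all_order all_algebra.
From mathcomp Require Import complex.
From mathcomp Require Import all_classical all_reals all_analysis.

Set Implicit Arguments.
Unset Strict Implicit.
Unset Printing Implicit Defensive.

Import Order.TTheory GRing.Theory Num.Theory.
Import numFieldNormedType.Exports.

Local Open Scope classical_set_scope.
Local Open Scope ring_scope.

(* Measure theory takes place on d.-tuple R, which carries the product Borel
   sigma-algebra; calculus takes place on 'rV[R]_d, which carries the normed
   topology.  [vec_of_tuple] identifies the two. *)
Notation Rtuple R d := (d.-tuple (measurableTypeR R)).

Definition cons_tuple (R : realType) (n : nat)
    (p : measurableTypeR R * Rtuple R n) : Rtuple R n.+1 :=
  [tuple of p.1 :: p.2].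

Definition uncons_tuple (R : realType) (n : nat) (t : Rtuple R n.+1) :
    measurableTypeR R * Rtuple R n :=
  (thead t, [tuple of behead t]).

Lemma measurable_cons_tuple (R : realType) (n : nat) :
  measurable_fun setT (@cons_tuple R n).
Proof. exact: measurable_cons. Qed.

Lemma measurable_uncons_tuple (R : realType) (n : nat) :
  measurable_fun setT (@uncons_tuple R n).
Proof.
apply/measurable_fun_pair; first exact: measurable_tnth.
exact: measurable_behead.
Qed.

Lemma uncons_tupleK (R : realType) (n : nat) :
  cancel (@uncons_tuple R n) (@cons_tuple R n).
Proof. by move=> t; rewrite [RHS]tuple_eta; apply: val_inj. Qed.

Lemma cons_tupleK (R : realType) (n : nat) :
  cancel (@cons_tuple R n) (@uncons_tuple R n).
Proof.
by move=> [x t]; rewrite /uncons_tuple/= theadE; congr pair; exact: val_inj.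
Qed.

Definition lebesgue_cons (R : realType) (n : nat)
    (m : {sigma_finite_measure set (Rtuple R n) -> \bar R}) :
    set (Rtuple R n.+1) -> \bar R :=
  pushforward (lebesgue_measure \x m)%E (@cons_tuple R n).

Section lebesgue_cons_measure.
Context (R : realType) (n : nat).
Context (m : {sigma_finite_measure set (Rtuple R n) -> \bar R}).

Let lc0 : lebesgue_cons m set0 = 0%E.
Proof. by rewrite /lebesgue_cons /pushforward preimage_set0 measure0. Qed.

Let lc_ge0 A : (0 <= lebesgue_cons m A)%E.
Proof. exact: (measure_ge0 (lebesgue_measure \x m)%E). Qed.

Let lc_sigma_additive : semi_sigma_additive (lebesgue_cons m).
Proof.
move=> F mF tF mUF; rewrite /lebesgue_cons /pushforward preimage_bigcup.
have mc A : measurable A -> measurable (@cons_tuple R n @^-1` A).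
  by move=> mA; rewrite -[X in measurable X]setTI; exact: measurable_cons_tuple.
apply: measure_semi_sigma_additive; first by move=> i; exact: mc.
- apply/trivIsetP => /= i j _ _ ij; rewrite -preimage_setI.
  by move/trivIsetP : tF => /(_ _ _ _ _ ij) ->//; rewrite preimage_set0.
- by rewrite -preimage_bigcup; exact: mc.
Qed.

HB.instance Definition _ := isMeasure.Build _ _ _ (lebesgue_cons m)
  lc0 lc_ge0 lc_sigma_additive.

Let lc_sigma_finite : sigma_finite setT (lebesgue_cons m).
Proof.
have /sigma_finiteP[F [TF ndF Foo]] :=
  sigma_finiteT (@lebesgue_measure R : {sigma_finite_measure set _ -> \bar R}).
have /sigma_finiteP[G [TG ndG Goo]] := sigma_finiteT m.
exists (fun k => @uncons_tuple R n @^-1` (F k `*` G k)).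
  rewrite -preimage_bigcup predeqE => t; split=> // _.
  have : setT (uncons_tuple t).1 by [].
  have : setT (uncons_tuple t).2 by [].
  rewrite [X in X _.2]TG [X in X _.1]TF => -[i _ Gi] [j _ Fj].
  exists (maxn i j) => //; split.
  - by apply: subsetPset Fj; apply: ndF; exact: leq_maxr.
  - by apply: subsetPset Gi; apply: ndG; exact: leq_maxl.
move=> k; have [mF Fk] := Foo k; have [mG Gk] := Goo k; split.
  rewrite -[X in measurable X]setTI; apply: measurable_uncons_tuple => //.
  exact: measurableX.
rewrite /lebesgue_cons /pushforward -comp_preimage.
rewrite (_ : _ \o _ = id); last first.
  by apply/funext => p /=; rewrite cons_tupleK.
rewrite preimage_id product_measure1E//.
by rewrite lte_mul_pinfty// ge0_fin_numE.
Qed.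

HB.instance Definition _ :=
  @Measure_isSigmaFinite.Build _ _ _ (lebesgue_cons m) lc_sigma_finite.

End lebesgue_cons_measure.

Fixpoint lebesgue (R : realType) (n : nat) :
    {sigma_finite_measure set (Rtuple R n) -> \bar R} :=
  match n with
  | 0 => dirac ([tuple] : Rtuple R 0)
  | n'.+1 => lebesgue_cons (lebesgue R n')
  end.

Definition vec_of_tuple (R : realType) (d : nat) (t : Rtuple R d) : 'rV[R]_d :=
  \row_i tnth t i.

Notation Cfun R d := ('rV[R]_d -> R[i]).

(* Real-valued norm: in the library the norm of a normed R[i]-module takes its
   values in R[i]. *)
Definition nrm (R : realType) (V : normedZmodType R[i]) (v : V) : R :=
  complex.Re `|v|.

Definition cis (R : realType) (a : R) : R[i] := (cos a +i* sin a)%C.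

Definition dotv (R : realType) (d : nat) (x y : 'rV[R]_d) : R :=
  \sum_(i < d) x 0 i * y 0 i.

(* The Euclidean norm (the library norm on 'rV[R]_d is the sup norm). *)
Definition enorm (R : realType) (d : nat) (x : 'rV[R]_d) : R :=
  Num.sqrt (dotv x x).

Definition cmeasurable (R : realType) (d : nat) (f : Cfun R d) : Prop :=
  measurable_fun setT (fun t : Rtuple R d => complex.Re (f (vec_of_tuple t))) /\
  measurable_fun setT (fun t : Rtuple R d => complex.Im (f (vec_of_tuple t))).

Definition cintegrable (R : realType) (d : nat) (f : Cfun R d) : Prop :=
  (lebesgue R d).-integrable setT
    (fun t => (complex.Re (f (vec_of_tuple t)))%:E) /\
  (lebesgue R d).-integrable setT
    (fun t => (complex.Im (f (vec_of_tuple t)))%:E).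

Definition cintegral (R : realType) (d : nat) (A : set (Rtuple R d))
    (f : Cfun R d) : R[i] :=
  (Rintegral (lebesgue R d) A (fun t => complex.Re (f (vec_of_tuple t))) +i*
   Rintegral (lebesgue R d) A (fun t => complex.Im (f (vec_of_tuple t))))%C.

Definition translate (R : realType) (d : nat) (x : 'rV[R]_d) (f : Cfun R d) :
    Cfun R d :=
  fun y => f (y - x).

Definition modulate (R : realType) (d : nat) (xi : 'rV[R]_d) (f : Cfun R d) :
    Cfun R d :=
  fun y => cis (2 * pi * dotv xi y) * f y.

Definition reflect_fun (R : realType) (d : nat) (f : Cfun R d) : Cfun R d :=
  fun y => f (- y).

Definition mulf (R : realType) (d : nat) (f g : Cfun R d) : Cfun R d :=
  fun x => f x * g x.

Definition convolution (R : realType) (d : nat) (f g : Cfun R d) : Cfun R d :=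
  fun x => cintegral setT (fun y => f (x - y) * g y).

Definition fourier (R : realType) (d : nat) (f : Cfun R d) : Cfun R d :=
  fun xi => cintegral setT (fun x => cis (- (2 * pi * dotv x xi)) * f x).

Fixpoint is_Ck (R : realType) (d k : nat) (f : 'rV[R]_d -> R) : Prop :=
  match k with
  | 0 => continuous f
  | k'.+1 => continuous f /\
      forall i : 'I_d, (forall x, derivable f x 'e_i) /\
                       is_Ck k' (fun x => 'D_('e_i) f x)
  end.

Definition smooth (R : realType) (d : nat) (f : Cfun R d) : Prop :=
  forall k, is_Ck k (fun x => complex.Re (f x)) /\
            is_Ck k (fun x => complex.Im (f x)).

Definition rderiv (R : realType) (d : nat) (a : 'I_d -> nat)
    (f : 'rV[R]_d -> R) : 'rV[R]_d -> R :=
  foldr (fun i h => iter (a i) (fun g x => 'D_('e_i) g x) h) f (enum 'I_d).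

(* The partial derivative of multi-index [a]; the normalising factor of D^a in
   front of it has modulus one, hence plays no role in the norms below. *)
Definition cderiv (R : realType) (d : nat) (a : 'I_d -> nat) (f : Cfun R d) :
    Cfun R d :=
  fun x => (rderiv a (fun y => complex.Re (f y)) x +i*
            rderiv a (fun y => complex.Im (f y)) x)%C.

Definition mlength (d : nat) (a : 'I_d -> nat) : nat := (\sum_(i < d) a i)%N.

Record weight_sequence (R : realType) (M : nat -> R) : Prop := WeightSequence {
  ws_gt0 : forall p, 0 < M p ;
  ws_0 : M 0%N = 1 ;
  ws_1 : M 1%N = 1 ;
  ws_M1 : forall p, (1 <= p)%N -> M p ^+ 2 <= M p.-1 * M p.+1 ;
  ws_M2 : exists c0 H : R, [/\ 1 <= c0, 1 <= H &
    forall p q, (q <= p)%N -> M p <= c0 * H ^+ p * (M (p - q)%N * M q)] ;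
  ws_M6 : exists c0 L0 : R, [/\ 1 <= c0, 1 <= L0 &
    forall p, (p`!)%:R <= c0 * L0 ^+ p * M p] }.

(* Recall that ln x = 0 for x <= 0, so that this is ln_+ on nonnegative reals. *)
Definition ln_plus (R : realType) (x : R) : R := Num.max 0 (ln x).

(* The supremum is over a bounded set as soon as p! <= c0 L0^p M_p. *)
Definition assoc_fun (R : realType) (M : nat -> R) (rho : R) : R :=
  sup [set ln_plus (rho ^+ p / M p) | p in @setT nat].

(* The class *-dagger: (M)-(A), {M}-{A}, 0-(A), (M)-0 and 0-0 respectively,
   where 0 is the empty set. *)
Inductive gs_class (R : realType) : Type :=
| GSBeurling of nat -> R & nat -> R
| GSRoumieu of nat -> R & nat -> R
| GSSmoothBeurling of nat -> R
| GSBeurlingTempered of nat -> R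
| GSSchwartz.

Arguments GSSchwartz {R}.

Definition gs_admissible (R : realType) (c : gs_class R) : Prop :=
  match c with
  | GSBeurling M A => weight_sequence M /\ weight_sequence A
  | GSRoumieu M A => weight_sequence M /\ weight_sequence A
  | GSSmoothBeurling A => weight_sequence A
  | GSBeurlingTempered M => weight_sequence M
  | GSSchwartz => True
  end.

Definition is_roumieu (R : realType) (c : gs_class R) : bool :=
  if c is GSRoumieu _ _ then true else false.

Definition log_weight (R : realType) (h rho : R) : R := h * ln (1 + `|rho|).

(* M_h and A_h. *)
Definition Mweight (R : realType) (c : gs_class R) (h rho : R) : R :=
  match c with
  | GSBeurling M _ | GSRoumieu M _ | GSBeurlingTempered M =>
      assoc_fun M (h * rho)
  | GSSmoothBeurling _ | GSSchwartz => log_weight h rho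
  end.

Definition Aweight (R : realType) (c : gs_class R) (h rho : R) : R :=
  match c with
  | GSBeurling _ A | GSRoumieu _ A | GSSmoothBeurling A =>
      assoc_fun A (h * rho)
  | GSBeurlingTempered _ | GSSchwartz => log_weight h rho
  end.

(* Sup norm of w D^a f; it is the L^infty norm since w and D^a f are
   continuous whenever it is used. *)
Definition weighted_sup (R : realType) (d : nat) (w : 'rV[R]_d -> R)
    (a : 'I_d -> nat) (f : Cfun R d) : \bar R :=
  ereal_sup [set (w x * nrm (cderiv a f x))%:E | x in @setT 'rV[R]_d].

Definition ultra_norm (R : realType) (d : nat) (M : nat -> R) (h : R)
    (w : 'rV[R]_d -> R) (f : Cfun R d) : \bar R :=
  ereal_sup [set ((h ^+ mlength a / M (mlength a))%:E * weighted_sup w a f)%E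
            | a in @setT ('I_d -> nat)].

Definition finite_order_norm (R : realType) (d k : nat)
    (w : 'rV[R]_d -> R) (f : Cfun R d) : \bar R :=
  ereal_sup [set weighted_sup w a f | a in [set a | (mlength a <= k)%N]].

(* The norms of the Banach spaces of which the Gelfand-Shilov space is the
   projective (resp. inductive) limit; a norm takes the value +oo outside of
   its space. *)
Definition step_norms (R : realType) (d : nat) (c : gs_class R) :
    set (Cfun R d -> \bar R) :=
  match c with
  | GSBeurling M A | GSRoumieu M A =>
      [set ultra_norm M h (fun x => expR (assoc_fun A (h * enorm x)))
      | h in [set h : R | 0 < h]]
  | GSSmoothBeurling A =>
      [set finite_order_norm k (fun x => expR (assoc_fun A (k%:R * enorm x)))
      | k in [set k : nat | (0 < k)%N]]
  | GSBeurlingTempered M =>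
      [set ultra_norm M k%:R (fun x => (1 + enorm x) ^+ k)
      | k in [set k : nat | (0 < k)%N]]
  | GSSchwartz =>
      [set finite_order_norm k (fun x => (1 + enorm x) ^+ k)
      | k in [set k : nat | (0 < k)%N]]
  end.

(* In the two cases where * is empty the step spaces consist of C^k functions;
   a function which is C^k for all k is smooth. *)
Definition gs_space (R : realType) (d : nat) (c : gs_class R) :
    set (Cfun R d) :=
  [set f | smooth f /\
    if is_roumieu c then exists2 N, step_norms c N & (N f < +oo)%E
    else forall N, step_norms c N -> (N f < +oo)%E].

Definition seminorm_on (R : realType) (d : nat) (S : set (Cfun R d))
    (p : Cfun R d -> R) : Prop :=
  (forall f, S f -> 0 <= p f) /\
  (forall (a : R[i]) f, S f -> p (fun x => a * f x) = nrm a * p f) /\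
  (forall f g, S f -> S g -> p (fun x => f x + g x) <= p f + p g).

(* The topology of the space is given by its continuous seminorms.  For the
   projective limit these are the seminorms dominated by a step norm (the step
   norms increase with the index).  For the inductive limit, which carries the
   finest locally convex topology for which the inclusions of the steps are
   continuous, these are the seminorms continuous on every step. *)
Definition gs_continuous_seminorm (R : realType) (d : nat) (c : gs_class R)
    (p : Cfun R d -> R) : Prop :=
  seminorm_on (gs_space c) p /\
  let dominated (N : Cfun R d -> \bar R) := exists K : R,
    forall f, gs_space c f -> (N f < +oo)%E ->
      ((p f)%:E <= K%:E * N f)%E in
  if is_roumieu c then forall N, step_norms c N -> dominated N
  else exists2 N, step_norms c N & dominated N.

Definition gs_bounded (R : realType) (d : nat) (c : gs_class R)
    (B : set (Cfun R d)) : Prop :=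
  B `<=` gs_space c /\
  forall p, gs_continuous_seminorm c p ->
    exists K : R, forall f, B f -> p f <= K.

(* Elements of the dual space are represented by functions on Cfun R d of which
   only the values on the Gelfand-Shilov space are meaningful. *)
Definition gs_dual (R : realType) (d : nat) (c : gs_class R) :
    set (Cfun R d -> R[i]) :=
  [set u | (forall (a : R[i]) f g, gs_space c f -> gs_space c g ->
              u (fun x => a * f x + g x) = a * u f + u g) /\
           gs_continuous_seminorm c (fun f => nrm (u f))].

Definition gs_eq (R : realType) (d : nat) (c : gs_class R)
    (u v : Cfun R d -> R[i]) : Prop :=
  forall f, gs_space c f -> u f = v f.

Definition dist_of_fun (R : realType) (d : nat) (f : Cfun R d) :
    Cfun R d -> R[i] :=
  fun phi => cintegral setT (mulf f phi).

Definition dist_translate (R : realType) (d : nat) (x : 'rV[R]_d)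
    (u : Cfun R d -> R[i]) : Cfun R d -> R[i] :=
  fun phi => u (translate (- x) phi).

Definition dist_modulate (R : realType) (d : nat) (xi : 'rV[R]_d)
    (u : Cfun R d -> R[i]) : Cfun R d -> R[i] :=
  fun phi => u (modulate xi phi).

(* A subspace F of the dual of the Gelfand-Shilov space is given by a Banach
   space F together with its inclusion map [j]. *)
Section TMIB.
Context (R : realType) (d : nat) (c : gs_class R).
Context (F : completeNormedModType R[i]) (j : F -> Cfun R d -> R[i]).

Definition tmib_embed (phi : Cfun R d) : F :=
  xget 0 [set v | gs_eq c (j v) (dist_of_fun phi)].

Definition tmib_translate (x : 'rV[R]_d) (v : F) : F :=
  xget 0 [set w | gs_eq c (j w) (dist_translate x (j v))].

Definition tmib_modulate (xi : 'rV[R]_d) (v : F) : F :=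
  xget 0 [set w | gs_eq c (j w) (dist_modulate xi (j v))].

Definition opnorm (T : F -> F) : \bar R :=
  ereal_sup [set (nrm (T v))%:E | v in [set v : F | nrm v <= 1]].

Definition omega_F (x : 'rV[R]_d) : \bar R := opnorm (tmib_translate x).

Definition nu_F (xi : 'rV[R]_d) : \bar R := opnorm (tmib_modulate (- xi)).

Definition growth_bound (tau C : R) : Prop :=
  (forall x, (omega_F x <= (C * expR (Aweight c tau (enorm x)))%:E)%E) /\
  (forall xi, (nu_F xi <= (C * expR (Mweight c tau (enorm xi)))%:E)%E).

Record is_TMIB : Prop := IsTMIB {
  tmib_dual : forall v, gs_dual c (j v) ;
  tmib_linear : forall (a : R[i]) u v,
    gs_eq c (j (a *: u + v)) (fun phi => a * j u phi + j v phi) ;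
  tmib_inj : forall u v, gs_eq c (j u) (j v) -> u = v ;
  tmib_sub : forall phi, gs_space c phi ->
    exists v, gs_eq c (j v) (dist_of_fun phi) ;
  tmib_sub_continuous :
    gs_continuous_seminorm c (fun phi => nrm (tmib_embed phi)) ;
  tmib_sub_dense : dense (tmib_embed @` gs_space c) ;
  tmib_incl_continuous : forall B, gs_bounded c B ->
    exists K : R, forall v phi, B phi -> nrm (j v phi) <= K * nrm v ;
  tmib_incl_dense : forall u, gs_dual c u -> forall B, gs_bounded c B ->
    forall e : R, 0 < e ->
    exists v, forall phi, B phi -> nrm (u phi - j v phi) <= e ;
  tmib_translate_stable : forall x v,
    exists w, gs_eq c (j w) (dist_translate x (j v)) ;
  tmib_modulate_stable : forall xi v,
    exists w, gs_eq c (j w) (dist_modulate xi (j v)) ;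
  tmib_growth :
    if is_roumieu c
    then forall tau : R, 0 < tau -> exists2 C : R, 0 < C & growth_bound tau C
    else exists tau C : R, [/\ 0 < tau, 0 < C & growth_bound tau C] }.

(* The DTMIB E = F'. *)
Definition dual_space : set (F -> R[i]^o) :=
  [set f : F -> R[i]^o | linear f /\ continuous f].

Definition dual_norm (f : F -> R[i]^o) : \bar R :=
  ereal_sup [set (nrm (f v))%:E | v in [set v : F | nrm v <= 1]].

(* Translation and modulation on E, regarded as a subspace of the dual of the
   Gelfand-Shilov space. *)
Definition dual_translate (x : 'rV[R]_d) (f : F -> R[i]^o) : F -> R[i]^o :=
  fun v => f (tmib_translate (- x) v).

Definition dual_modulate (xi : 'rV[R]_d) (f : F -> R[i]^o) : F -> R[i]^o :=
  fun v => f (tmib_modulate xi v).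

Definition dual_opnorm (T : (F -> R[i]^o) -> (F -> R[i]^o)) : \bar R :=
  ereal_sup [set dual_norm (T f)
            | f in [set f | dual_space f /\ (dual_norm f <= 1)%E]].

Definition omega_E (x : 'rV[R]_d) : \bar R := dual_opnorm (dual_translate x).

Definition nu_E (xi : 'rV[R]_d) : \bar R := dual_opnorm (dual_modulate (- xi)).

(* Pettis integrability and integral of an E-valued function, for the weak*
   topology of E, whose dual is F. *)
Definition weakstar_pettis_integral (Phi : 'rV[R]_d -> (F -> R[i]^o))
    (I : F -> R[i]^o) : Prop :=
  [/\ forall v, cintegrable (fun y => Phi y v),
      forall A : set (Rtuple R d), measurable A ->
        exists2 J, dual_space J &
          forall v, J v = cintegral A (fun y => Phi y v),
      dual_space I &
      forall v, I v = cintegral setT (fun y => Phi y v)].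

End TMIB.

(* Elements of L^1_eta are represented by Borel functions; all notions below
   only depend on their classes modulo equality almost everywhere. *)
Definition L1norm (R : realType) (d : nat) (eta : 'rV[R]_d -> \bar R)
    (g : Cfun R d) : \bar R :=
  (\int[lebesgue R d]_t
     ((nrm (g (vec_of_tuple t)))%:E * eta (vec_of_tuple t)))%E.

Definition L1space (R : realType) (d : nat) (eta : 'rV[R]_d -> \bar R) :
    set (Cfun R d) :=
  [set g | cmeasurable g /\ (L1norm eta g < +oo)%E].

(* h is the Fourier transform of u in the sense of duality, that is,
   u represents the inverse Fourier transform of h. *)
Definition is_fourier_of (R : realType) (d : nat) (c : gs_class R)
    (h : Cfun R d -> R[i]) (u : Cfun R d) : Prop :=
  gs_eq c h (fun phi => dist_of_fun u (fourier phi)).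

(* If 1 / eta is unbounded, elements of A_eta need not be functions. *)
Definition Aspace (R : realType) (d : nat) (c : gs_class R)
    (eta : 'rV[R]_d -> \bar R) : set (Cfun R d -> R[i]) :=
  [set h | exists2 u, L1space eta u & is_fourier_of c h u].

(* The infimum is over a singleton, u being determined almost everywhere by
   its Fourier transform. *)
Definition Anorm (R : realType) (d : nat) (c : gs_class R)
    (eta : 'rV[R]_d -> \bar R) (h : Cfun R d -> R[i]) : \bar R :=
  ereal_inf [set L1norm eta u
            | u in [set u | L1space eta u /\ is_fourier_of c h u]].

Section module_operations.
Context (R : realType) (d : nat) (c : gs_class R).
Context (F : completeNormedModType R[i]) (j : F -> Cfun R d -> R[i]).

(* The (unique) continuous bilinear extensions to L^1_(omega_F) x F and
   A_(nu_F) x F of convolution and multiplication on the Gelfand-Shilov space. *)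
Record is_convolution_on (conv : Cfun R d -> F -> F) : Prop := IsConvolutionOn {
  conv_linearl : forall (a : R[i]) g1 g2 v,
    L1space (omega_F c j) g1 -> L1space (omega_F c j) g2 ->
    conv (fun x => a * g1 x + g2 x) v = a *: conv g1 v + conv g2 v ;
  conv_linearr : forall g, L1space (omega_F c j) g -> linear (conv g) ;
  conv_continuous : exists K : R, forall g v, L1space (omega_F c j) g ->
    ((nrm (conv g v))%:E <= K%:E * L1norm (omega_F c j) g * (nrm v)%:E)%E ;
  conv_extends : forall phi psi, gs_space c phi -> gs_space c psi ->
    conv phi (tmib_embed c j psi) = tmib_embed c j (convolution phi psi) }.

Record is_multiplication_on (mult : (Cfun R d -> R[i]) -> F -> F) : Prop :=
  IsMultiplicationOn {
  mult_linearl : forall (a : R[i]) h1 h2 v,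
    Aspace c (nu_F c j) h1 -> Aspace c (nu_F c j) h2 ->
    mult (fun phi => a * h1 phi + h2 phi) v = a *: mult h1 v + mult h2 v ;
  mult_linearr : forall h, Aspace c (nu_F c j) h -> linear (mult h) ;
  mult_continuous : exists K : R, forall h v, Aspace c (nu_F c j) h ->
    ((nrm (mult h v))%:E <= K%:E * Anorm c (nu_F c j) h * (nrm v)%:E)%E ;
  mult_extends : forall phi psi, gs_space c phi -> gs_space c psi ->
    mult (dist_of_fun phi) (tmib_embed c j psi) = tmib_embed c j (mulf phi psi) }.

Definition dual_convolution (conv : Cfun R d -> F -> F) (g : Cfun R d)
    (f : F -> R[i]^o) : F -> R[i]^o :=
  fun v => f (conv (reflect_fun g) v).

Definition dual_multiplication (mult : (Cfun R d -> R[i]) -> F -> F)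
    (h : Cfun R d -> R[i]) (f : F -> R[i]^o) : F -> R[i]^o :=
  fun v => f (mult h v).

End module_operations.

(* Main.v *)
(* Write U_y for T_(-y), respectively M_(-y), on F, and eta(y) for its operator
   norm. The point is the formula f(g . v) = int g(y) f(U_y v) dy for v in F,
   f in F' and g in L^1_eta, where g . v is the convolution of v with the
   reflection of g, respectively the product of v with the Fourier transform
   of g. The norm estimates and the Pettis integrals follow from it at once.
   Both sides are continuous in v and in g, so v may be taken in the dense
   Gelfand-Shilov space, where y |-> U_y v is norm continuous. When g is a
   translated Gaussian, both operands lie in the Gelfand-Shilov space; a Bochner
   type integral of g(y) U_y v exists in F, and it equals g . v as an
   ultradistribution by Fubini. The general g is reached because a continuous
   functional on L^1_eta which vanishes on the Gaussians is zero: the bounded h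
   such that it vanishes on every h e^q (q a negative definite quadratic
   polynomial) are stable under multiplication by one-dimensional Gaussians and
   under bounded limits, hence under multiplication by indicators of Borel
   sets, since (1 - e^n)^(n 2^n) tends to the indicator of {e < 1/2}. *)
Require Import Defs.
From HB Require Import structures.
From mathcomp Require Import all_boot all_order all_algebra.
From mathcomp Require Import complex.
From mathcomp Require Import all_classical all_reals all_analysis.
From mathcomp Require Import measurable_realfun ring lra.

Set Implicit Arguments.
Unset Strict Implicit.
Unset Printing Implicit Defensive.

Import Order.TTheory GRing.Theory Num.Theory.
Import numFieldNormedType.Exports.

Local Open Scope classical_set_scope.
Local Open Scope ring_scope.

(** * Complex norms and the Hahn-Banach theorem *)

Section norms.
Context (R : realType).
Implicit Types (a z : R[i]) (x : R).

(** Gaussians belong to all five classes because their derivatives of order n are bounded by C n!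
    e^n for every e > 0, even against exponential weights, while the step factors times n! e^n stay
    bounded for some e and the spatial weights are at most exponential. The module operations are
    known only as continuous extensions with an unspecified constant; the constant 1 of the
    estimates comes from the integral formula alone. The norm eta is merely a supremum of continuous
    functions, measurable by lower semicontinuity. Integrals of F-valued functions are weak: the
    Hahn-Banach theorem makes the integrals of simple approximants a Cauchy sequence. On the
    multiplication side h is a distribution, and linearity in its inverse transform u requires the
    pairing of u with the Fourier transform of a test function to converge absolutely; it does,
    because that transform decays at the rate by which the weight nu can at worst decrease. *)

Lemma nrmE (V : normedZmodType R[i]) (v : V) : `|v| = ((nrm v)%:C)%C.
Proof. by rewrite /nrm RRe_real// normr_real. Qed.

Lemma nrm_ge0 (V : normedZmodType R[i]) (v : V) : 0 <= nrm v.
Proof. by rewrite -lecR -nrmE normr_ge0. Qed.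

Lemma nrm0 (V : normedZmodType R[i]) : nrm (0 : V) = 0.
Proof. by rewrite /nrm normr0. Qed.

Lemma nrmN (V : normedZmodType R[i]) (v : V) : nrm (- v) = nrm v.
Proof. by rewrite /nrm normrN. Qed.

Lemma nrm_triangle (V : normedZmodType R[i]) (u v : V) :
  nrm (u + v) <= nrm u + nrm v.
Proof. by rewrite -lecR rmorphD/= -!nrmE ler_normD. Qed.

Lemma nrm_distC (V : normedZmodType R[i]) (u v : V) : nrm (u - v) = nrm (v - u).
Proof. by rewrite -nrmN opprB. Qed.

Lemma nrm_dist_triangle (V : normedZmodType R[i]) (w u v : V) :
  nrm (u - v) <= nrm (u - w) + nrm (w - v).
Proof. by rewrite (le_trans _ (nrm_triangle _ _))// addrA subrK. Qed.

Lemma nrm_le_dist (V : normedZmodType R[i]) (u v : V) :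
  nrm u <= nrm v + nrm (u - v).
Proof. by rewrite (le_trans _ (nrm_triangle _ _))// addrC subrK. Qed.

Lemma nrm0_eq0 (V : normedZmodType R[i]) (v : V) : nrm v = 0 -> v = 0.
Proof. by move=> v0; apply/normr0_eq0; rewrite nrmE v0. Qed.

Lemma nrmZ (V : normedModType R[i]) a (v : V) : nrm (a *: v) = nrm a * nrm v.
Proof.
by apply/(@complexI R); rewrite rmorphM/= -!nrmE normrZ.
Qed.

Lemma nrmM a z : nrm (a * z) = nrm a * nrm z.
Proof.
by apply/(@complexI R); rewrite rmorphM/= -!nrmE normrM.
Qed.

Lemma nrmC_def z : nrm z = Num.sqrt (complex.Re z ^+ 2 + complex.Im z ^+ 2).
Proof. by apply/(@complexI R); rewrite -nrmE normc_def. Qed.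

Lemma sqr_nrmC z : nrm z ^+ 2 = complex.Re z ^+ 2 + complex.Im z ^+ 2.
Proof. by rewrite nrmC_def sqr_sqrtr// addr_ge0// sqr_ge0. Qed.

Lemma normr_Re_le z : `|complex.Re z| <= nrm z.
Proof.
rewrite -(ler_pXn2r (_ : (0 < 2)%N)) ?nnegrE ?nrm_ge0//.
by rewrite sqr_nrmC real_normK ?num_real// lerDl sqr_ge0.
Qed.

Lemma normr_Im_le z : `|complex.Im z| <= nrm z.
Proof.
rewrite -(ler_pXn2r (_ : (0 < 2)%N)) ?nnegrE ?nrm_ge0//.
by rewrite sqr_nrmC real_normK ?num_real// lerDr sqr_ge0.
Qed.

Lemma nrm_real x : nrm ((x%:C)%C : R[i]) = `|x|.
Proof. by rewrite nrmC_def/= expr0n/= addr0 sqrtr_sqr. Qed.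

Lemma nrm_le_ReIm z : nrm z <= `|complex.Re z| + `|complex.Im z|.
Proof.
rewrite -(ler_pXn2r (_ : (0 < 2)%N)) ?nnegrE ?nrm_ge0 ?addr_ge0//.
rewrite sqr_nrmC sqrrD !real_normK ?num_real// lerD2r lerDl.
by rewrite mulrn_wge0// mulr_ge0.
Qed.

Lemma nrm_cis x : nrm (cis x) = 1.
Proof. by rewrite nrmC_def/= cos2Dsin2 sqrtr1. Qed.

Lemma cisD x y : cis (x + y) = cis x * cis y.
Proof. by apply/eqP; rewrite eq_complex/= cosD sinD eqxx/= addrC mulrC. Qed.

Lemma cis0 : cis 0 = 1 :> R[i].
Proof. by rewrite /cis cos0 sin0. Qed.

Lemma complex_eta z : z = (complex.Re z +i* complex.Im z)%C.
Proof. by case: z. Qed.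

Lemma complex_eqP a z : complex.Re a = complex.Re z ->
  complex.Im a = complex.Im z -> a = z.
Proof. by case: a z => [? ?] [? ?] /= -> ->. Qed.

Lemma Re_mul a z : complex.Re (a * z) =
  complex.Re a * complex.Re z - complex.Im a * complex.Im z.
Proof. by case: a z => [? ?] [? ?]. Qed.

Lemma Im_mul a z : complex.Im (a * z) =
  complex.Re a * complex.Im z + complex.Im a * complex.Re z.
Proof. by case: a z => [? ?] [? ?]/=; rewrite mulrC [in X in _ + X]mulrC. Qed.

Lemma Re_add a z : complex.Re (a + z) = complex.Re a + complex.Re z.
Proof. by case: a z => [? ?] [? ?]. Qed.

Lemma Im_add a z : complex.Im (a + z) = complex.Im a + complex.Im z.
Proof. by case: a z => [? ?] [? ?]. Qed.

Lemma Re_opp z : complex.Re (- z) = - complex.Re z.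
Proof. by case: z. Qed.

Lemma Im_opp z : complex.Im (- z) = - complex.Im z.
Proof. by case: z. Qed.

Definition ReImE := (Re_mul, Im_mul, Re_add, Im_add, Re_opp, Im_opp).

(** The choice of phase reduces a bound on moduli to a bound on real parts; it serves the
    complexified Hahn-Banach functional and the triangle inequality for complex integrals. *)
Lemma unimodular_rotation z : exists2 a : R[i], nrm a = 1 & a * z = ((nrm z)%:C)%C.
Proof.
have [->|z0] := eqVneq z 0.
  by exists 1; rewrite ?mulr0 ?nrm0// nrmC_def/= expr1n expr0n/= addr0 sqrtr1.
have nz : nrm z != 0 by apply: contra_neq z0; exact: nrm0_eq0.
exists (((nrm z)^-1)%:C * (complex.Re z -i* complex.Im z))%C.
  rewrite nrmM nrm_real ger0_norm ?invr_ge0 ?nrm_ge0//.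
  by rewrite [X in _ * X]nrmC_def/= sqrrN -nrmC_def mulVf.
apply: complex_eqP; rewrite !ReImE/=; last by ring.
apply: (mulIf nz); rewrite -expr2 sqr_nrmC.
transitivity ((complex.Re z ^+ 2 + complex.Im z ^+ 2) * ((nrm z)^-1 * nrm z)).
  by ring.
by rewrite mulVf// mulr1.
Qed.

End norms.

(* The extension is built over the reals, as a maximal element among the graphs
   of real-linear functionals dominated by the norm, and complexified as
   f(v) = u(v) - i u(iv). *)
Section hahn_banach.
Context (R : realType) (F : completeNormedModType R[i]).
Implicit Types (G : set (F * R)) (v x : F).

Local Notation rscale a v := (((a : R)%:C)%C *: v).

Let rlin_graph G := forall (a : R) p q, G p -> G q ->
  G (rscale a p.1 + q.1, a * p.2 + q.2).

Let dominated_graph G := forall p, G p -> p.2 <= nrm p.1.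

(** Conditional on [G] being nonempty, so that the empty graph, the union of the empty chain, is
    admissible for Zorn's lemma; maximality against [line v] then excludes it. *)
Let through v G := forall p, G p -> G (v, nrm v).

Let graph_ok v G := [/\ rlin_graph G, dominated_graph G & through v G].

Let nrm_rscale (a : R) v : nrm (rscale a v) = `|a| * nrm v.
Proof. by rewrite nrmZ nrm_real. Qed.

Let line v : set (F * R) := [set (rscale a v, a * nrm v) | a in [set: R]].

Let line_ok v : graph_ok v (line v).
Proof.
split.
- move=> a _ _ [b _ <-] [b' _ <-]; exists (a * b + b') => //=.
  by rewrite rmorphD rmorphM/= scalerDl -scalerA mulrDl mulrA.
- by move=> _ [a _ <-]/=; rewrite nrm_rscale ler_wpM2r ?nrm_ge0// ler_norm.
- by move=> _ _; exists 1 => //; rewrite rmorph1 scale1r mul1r.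
Qed.

Let graph_zero v G : graph_ok v G -> G !=set0 -> G (0, 0).
Proof.
move=> [lG _ _] [p Gp]; have := lG (-1) p p Gp Gp.
by rewrite rmorphN rmorph1 scaleN1r addNr mulN1r addNr.
Qed.

Let graph_fun v G w r s : graph_ok v G -> G (w, r) -> G (w, s) -> r = s.
Proof.
move=> [lG dG _] Gr Gs; apply/eqP; rewrite eq_le; apply/andP; split.
  have /dG := lG (-1) _ _ Gs Gr.
  by rewrite /= rmorphN rmorph1 scaleN1r addNr nrm0 mulN1r addrC subr_le0.
have /dG := lG (-1) _ _ Gr Gs.
by rewrite /= rmorphN rmorph1 scaleN1r addNr nrm0 mulN1r addrC subr_le0.
Qed.

(** Up to scaling, dominance at q + t x restricts the value at [x] only for t = 1 and t = -1: it has
    to lie above all [q.2 - nrm (q.1 - x)] and below all [nrm (p.1 + x) - p.2]. The triangle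
    inequality separates the two families, and the supremum of the first is taken. *)
Let extension v G x : graph_ok v G -> G !=set0 ->
  exists H, [/\ graph_ok v H, G `<=` H & exists r, H (x, r)].
Proof.
move=> okG G0; have [lG dG tG] := okG.
have Gz := graph_zero okG G0.
pose L := [set q.2 - nrm (q.1 - x) | q in G].
have LU p q : G p -> G q -> q.2 - nrm (q.1 - x) <= nrm (p.1 + x) - p.2.
  move=> Gp Gq; rewrite lerBrDr addrAC -lerBrDr opprK.
  have /dG/= := lG 1 _ _ Gq Gp.
  rewrite rmorph1 scale1r mul1r => /le_trans; apply.
  rewrite addrC (le_trans _ (nrm_triangle _ _))//.
  by rewrite addrACA subrr addr0 addrC.
have Lub : has_ubound L.
  by exists (nrm ((0 : F) + x) - 0) => _ [q Gq <-]; exact: LU (_ , _) _ Gz Gq.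
have L0 : L !=set0 by exists (0 - nrm (0 - x)); exists (0, 0).
pose r := sup L.
have rL q : G q -> q.2 - nrm (q.1 - x) <= r.
  by move=> Gq; apply: ub_le_sup => //; exists q.
have rU p : G p -> r <= nrm (p.1 + x) - p.2.
  by move=> Gp; apply: ge_sup => // _ [q Gq <-]; exact: LU.
pose H := [set p | exists t q, G q /\ p = (q.1 + rscale t x, q.2 + t * r)].
have GH : G `<=` H.
  move=> [w s] Gws; exists 0, (w, s); split => //=.
  by rewrite scale0r addr0 mul0r addr0.
exists H; split => //; last first.
  exists r; exists 1, (0, 0); split => //=.
  by rewrite rmorph1 scale1r add0r mul1r add0r.
split.
- move=> a _ _ [t [q [Gq ->]]] [t' [q' [Gq' ->]]]/=.
  exists (a * t + t'), (rscale a q.1 + q'.1, a * q.2 + q'.2); split.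
    exact: lG.
  congr pair; rewrite /=.
    by rewrite rmorphD rmorphM/= scalerDl scalerDr -scalerA addrACA.
  by rewrite mulrDl mulrDr -mulrA addrACA.
- move=> _ [t [q [Gq ->]]]/=.
  have scal (a : R) : G (rscale a q.1, a * q.2).
    by have := lG a _ _ Gq Gz; rewrite /= !addr0.
  have [t0|t0|->] := ltgtP t 0.
  + have nt : 0 < - t by rewrite oppr_gt0.
    have := rL _ (scal ((- t)^-1)) => /=.
    have -> : rscale (- t)^-1 q.1 - x = rscale (- t)^-1 (q.1 + rscale t x).
      rewrite scalerDr scalerA -rmorphM/= invrN mulNr mulVf ?lt_eqF//.
      by rewrite !rmorphN rmorph1 scaleN1r.
    rewrite nrm_rscale gtr0_norm ?invr_gt0// -mulrBr ler_pdivrMl//.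
    lra.
  + have := rU _ (scal (t^-1)) => /=.
    have -> : rscale t^-1 q.1 + x = rscale t^-1 (q.1 + rscale t x).
      rewrite scalerDr scalerA -rmorphM/= mulVf ?gt_eqF//.
      by rewrite rmorph1 scale1r.
    rewrite nrm_rscale gtr0_norm ?invr_gt0// -mulrBr ler_pdivlMl//.
    lra.
  + by rewrite scale0r addr0 mul0r addr0 dG.
- by move=> _ [t [q [Gq _]]]; apply: GH; exact: tG Gq.
Qed.

Lemma hahn_banach v : exists f : F -> R[i],
  [/\ forall a u w, f (a *: u + w) = a * f u + f w,
      forall u, nrm (f u) <= nrm u &
      f v = ((nrm v)%:C)%C].
Proof.
have [C CP totC|G [okG maxG]] := @Zorn_bigcup _ (graph_ok v).
  split.
  - move=> a p q [X CX Xp] [Y CY Yq].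
    have [XY|YX] := totC _ _ CX CY.
      by exists Y => //; have [lY _ _] := CP _ CY; apply: lY => //; exact: XY.
    by exists X => //; have [lX _ _] := CP _ CX; apply: lX => //; exact: YX.
  - by move=> p [X CX Xp]; have [_ dX _] := CP _ CX; exact: dX.
  - by move=> p [X CX Xp]; exists X => //; have [_ _ tX] := CP _ CX; exact: tX Xp.
have G0 : G !=set0.
  apply/set0P/eqP => G0; apply: (maxG (line v)); last exact: line_ok.
  rewrite G0; split; first by move=> _ [].
  move=> /(_ (v, nrm v)); apply.
  by exists 1 => //; rewrite rmorph1 scale1r mul1r.
have totG x : exists r, G (x, r).
  have [H [okH GH [r Hr]]] := extension x okG G0.
  have [HG|nHG] := pselect (H `<=` G); first by exists r; exact: HG.
  by exfalso; apply: (maxG H) => //; split.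
have [u Gu] : {u : F -> R & forall x, G (x, u x)}.
  by exists (fun x => sval (cid (totG x))) => x; case: cid.
have [lG dG tG] := okG.
have uP a x y : u (rscale a x + y) = a * u x + u y.
  by apply: (graph_fun okG) (Gu _) _; exact: lG a _ _ (Gu x) (Gu y).
have uD x y : u (x + y) = u x + u y.
  by rewrite -[x in LHS](scale1r) -(rmorph1 (real_complex R)) uP mul1r.
have u0 : u 0 = 0 by apply: (graph_fun okG) (Gu _) (graph_zero okG G0).
have uZ a x : u (rscale a x) = a * u x by rewrite -[rscale a x]addr0 uP u0 addr0.
have un x : u x <= nrm x by exact: (dG _ (Gu x)).
have uv : u v = nrm v by apply: (graph_fun okG) (Gu _) (tG _ (Gu 0)).
pose f x : R[i] := (u x +i* - u ('i%C *: x))%C.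
have iiN x : 'i%C *: ('i%C *: x) = rscale (-1) x.
  by rewrite scalerA -expr2 sqr_i rmorphN rmorph1.
have fl a x y : f (a *: x + y) = a * f x + f y.
  have aE : a *: x = rscale (complex.Re a) x + rscale (complex.Im a) ('i%C *: x).
    rewrite scalerA -scalerDl; congr (_ *: _).
    by apply: complex_eqP; rewrite !ReImE/=; ring.
  have iaE : 'i%C *: (a *: x) =
      rscale (complex.Re a) ('i%C *: x) + rscale (- complex.Im a) x.
    rewrite aE scalerDr ![_ *: rscale _ _]scalerA ![_ * (_)%:C%C]mulrC.
    rewrite -!scalerA iiN; congr (_ + _).
    by rewrite scalerA -rmorphM/= mulrN1.
  apply: complex_eqP; rewrite !ReImE/=.
    by rewrite uD aE uD !uZ; ring.
  by rewrite scalerDr uD iaE uD !uZ; ring.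
have fn x : nrm (f x) <= nrm x.
  have [a a1 afx] := unimodular_rotation (f x).
  have fax : f (a *: x) = a * f x.
    have f0 : f 0 = 0 by apply: complex_eqP => /=; rewrite ?scaler0 u0 ?oppr0.
    by rewrite -[a *: x]addr0 fl f0 addr0.
  have -> : nrm (f x) = u (a *: x).
    by rewrite -[RHS]/(complex.Re (f (a *: x))) fax afx.
  by rewrite (le_trans (un _))// nrmZ a1 mul1r.
exists f; split => //.
apply: complex_eqP; rewrite /= ?uv//.
(* The real part of [f v] already has modulus [nrm v], which leaves no room for an imaginary
   part. *)
have := fn v; rewrite -(ler_pXn2r (_ : (0 < 2)%N)) ?nnegrE ?nrm_ge0// sqr_nrmC/= uv.
by rewrite gerDl => /(conj (sqr_ge0 (- u ('i%C *: v))))/andP/le_anti/esym/eqP;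
  rewrite sqrf_eq0 => /eqP.
Qed.

End hahn_banach.

(** * Lebesgue measure on tuples and complex integrals *)

Section tuple_measure.
Context (R : realType) (d : nat).
Local Notation V := 'rV[R]_d.
Local Notation T := (Rtuple R d).

Lemma normr_coord_le (x : V) i : `|x 0 i| <= `|x|.
Proof.
rewrite [leRHS]mx_normrE.
exact: (le_bigmax _ (fun k : 'I_1 * 'I_d => `|x k.1 k.2|) (ord0, i)).
Qed.

Lemma norm_lt_coord (x : V) e : 0 < e ->
  (forall i, `|x 0 i| < e) -> `|x| < e.
Proof.
move=> e0 xe; rewrite [ltLHS]mx_normrE; apply/bigmax_ltP; split => //.
by move=> [i j] _ /=; rewrite ord1.
Qed.

Lemma norm_le_coord (x : V) e : 0 <= e ->
  (forall i, `|x 0 i| <= e) -> `|x| <= e.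
Proof.
move=> e0 xe; rewrite [leLHS]mx_normrE; apply/bigmax_leP; split => //.
by move=> [i j] _ /=; rewrite ord1.
Qed.

Definition tuple_of_vec (x : V) : T := [tuple x 0 i | i < d].

Lemma tuple_of_vecK : cancel tuple_of_vec (@vec_of_tuple R d).
Proof. by move=> x; apply/rowP => i; rewrite mxE tnth_mktuple. Qed.

Lemma vec_of_tupleK : cancel (@vec_of_tuple R d) tuple_of_vec.
Proof. by move=> t; apply/eq_from_tnth => i; rewrite tnth_mktuple mxE. Qed.

(** The rational cubes contained in [U] cover it and are countably many, so the product
    sigma-algebra contains the open sets. *)
Lemma measurable_vec_open (U : set V) : open U ->
  measurable (@vec_of_tuple R d @^-1` U).
Proof.
move=> oU; pose c (q : 'rV[rat]_d) : V := map_mx ratr q.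
pose B (q : 'rV[rat]_d * nat) : set T :=
  if `[< ball (c q.1) (q.2.+1%:R^-1) `<=` U >] then
    [set t | forall i, `|c q.1 0 i - tnth t i| < q.2.+1%:R^-1] else set0.
have -> : @vec_of_tuple R d @^-1` U = \bigcup_q B q.
  apply/seteqP; split => t.
    move=> /= /oU /nbhs_ballP[e /= e0 eU].
    have [n ne] : exists n : nat, n.+1%:R^-1 < e / 2.
      have /ltr_add_invr[n] : 0 < e / 2 by rewrite divr_gt0.
      by rewrite add0r => ?; exists n.
    have n0 : 0 < n.+1%:R^-1 :> R by rewrite invr_gt0.
    have [q qt] : exists q : 'rV[rat]_d,
        forall i, `|c q 0 i - tnth t i| < n.+1%:R^-1.
      have rt i : exists r : rat, `|ratr r - tnth t i| < n.+1%:R^-1.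
        have [r] : exists r : rat, ratr r \in `]tnth t i - n.+1%:R^-1, tnth t i + n.+1%:R^-1[.
          by apply: rat_in_itvoo; rewrite ltrBlDr -addrA ltrDl addr_gt0.
        by rewrite in_itv/= => r1; exists r; rewrite ltr_distl.
      pose q := \row_i sval (cid (rt i)).
      by exists q => i; rewrite !mxE; case: cid.
    exists (q, n) => //; rewrite /B/=; case: asboolP => // -[].
    move=> y; rewrite -ball_normE/= => qy; apply: eU; rewrite -ball_normE/=.
    apply: norm_lt_coord => // i; rewrite !mxE.
    have /= := normr_coord_le (c q - y) i; rewrite !mxE => qyi.
    rewrite (le_lt_trans (ler_distD (ratr (q 0 i)) _ _))// (splitr e) ltrD//.
      by rewrite distrC (lt_trans _ ne)//; have := qt i; rewrite mxE.
    by rewrite (le_lt_trans qyi)// (lt_trans qy).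
  move=> [[q n] _]; rewrite /B/=; case: asboolP => // qU qt.
  apply: qU; rewrite -ball_normE/=; apply: norm_lt_coord.
    by rewrite invr_gt0.
  by move=> i; rewrite !mxE; have := qt i; rewrite mxE.
apply: countable_bigcupT_measurable => // q; rewrite /B; case: asboolP => // _.
rewrite (_ : [set t | _] =
    \bigcap_(i in [set: 'I_d]) [set t | `|c q.1 0 i - tnth t i| < q.2.+1%:R^-1]).
  apply: fin_bigcap_measurable => // i _.
  rewrite -[X in measurable X]setTI.
  have mf : measurable_fun setT (fun t : T => `|c q.1 0 i - tnth t i|).
    apply: measurableT_comp => //; apply: measurable_funB => //.
    exact: measurable_tnth.
  by have := mf measurableT _ (measurable_itv `]-oo, (q.2.+1%:R^-1)[);
    congr (measurable (_ `&` _)); apply/seteqP; split => t/=; rewrite in_itv.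
by apply/seteqP; split => t/= h i => [_|]; exact: h.
Qed.

Lemma measurable_vec_continuous (f : V -> R) : continuous f ->
  measurable_fun setT (f \o @vec_of_tuple R d).
Proof.
move=> /continuousP cf; apply: (measurability _ (RGenOpens.measurableE R)).
move=> _ [_ [a [b ->] <-]]; rewrite setTI.
apply: (measurable_vec_open (U := f @^-1` `]a, b[%classic)).
by apply: cf; exact: interval_open.
Qed.

(** The hypothesis is lower semicontinuity. The case needed is an operator norm, a supremum of
    continuous functions of the parameter. *)
Lemma measurable_vec_lower (f : V -> \bar R) :
  (forall a : R, open [set x | (a%:E < f x)%E]) ->
  measurable_fun setT (f \o @vec_of_tuple R d).
Proof.
move=> lf; apply: (measurability _ (ErealGenOInfty.measurableE R)).
move=> _ [_ [a ->]] <-; rewrite setTI preimage_itvoy.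
exact: (measurable_vec_open (lf a)).
Qed.

Definition affine_tuple (s : R) (x : V) (t : T) : T :=
  [tuple s * tnth t i + x 0 i | i < d].

Lemma affine_tupleE s x t :
  vec_of_tuple (affine_tuple s x t) = s *: vec_of_tuple t + x.
Proof. by apply/rowP => i; rewrite !mxE tnth_mktuple. Qed.

Lemma measurable_affine_tuple s x : measurable_fun setT (affine_tuple s x).
Proof.
apply/measurable_fun_tnthP => i.
rewrite (_ : _ \o _ = fun t : T => s * tnth t i + x 0 i); last first.
  by apply/funext => t; rewrite /= tnth_mktuple.
apply: measurable_funD => //; apply: measurable_funM => //.
exact: measurable_tnth.
Qed.

End tuple_measure.

(** * Invariance of Lebesgue measure under translations and reflections *)

Section affine_invariance.
Context (R : realType).

Let affine1 (s x : R) (u : measurableTypeR R) : measurableTypeR R := s * u + x.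

Let measurable_affine1 s x : measurable_fun setT (affine1 s x).
Proof. by apply: measurable_funD => //; exact: measurable_funM. Qed.

(** Compared on half-open intervals, which determine the measure. A reflection exchanges the open
    and the closed end, which does not alter the length. *)
Let lebesgue_affine1 (s x : R) A : s = 1 \/ s = -1 -> measurable A ->
  lebesgue_measure (affine1 s x @^-1` A) = lebesgue_measure A.
Proof.
move=> s1 mA.
have := @lebesgue_measure_unique R
  (pushforward lebesgue_measure (affine1 s x)) _ A mA.
move=> ->// X /ocitvP[->|[[a b] /= ab ->]].
  by rewrite measure0; apply/esym; exact: measure0.
rewrite /pushforward/=; case: s1 => ->.
  rewrite (_ : _ @^-1` _ = `]a - x, b - x]%classic); last first.
    by apply/seteqP; split => u; rewrite /affine1/= !in_itv/= mul1r ltrBlDr lerBrDr.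
  rewrite !lebesgue_measure_itv/= !lte_fin ltrD2r; case: ifPn => // _.
  by rewrite -!EFinB; congr EFin; ring.
rewrite (_ : _ @^-1` _ = `[x - b, x - a[%classic); last first.
  have flip (u : R) : (a < - 1 * u + x <= b) = (x - b <= u < x - a).
    rewrite mulN1r [- u + x]addrC !ltrBrDr !lerBlDr andbC.
    by rewrite [u + a]addrC [u + b]addrC.
  by apply/seteqP; split => u; rewrite /affine1/= !in_itv/= flip.
rewrite !lebesgue_measure_itv/= !lte_fin ltrD2l ltrN2; case: ifPn => // _.
by rewrite -!EFinB; congr EFin; ring.
Qed.

(** By induction on the dimension: slices of the preimage are preimages of slices, and the outer
    integral is invariant in one variable. Only translations and reflections occur, hence no
    Jacobian. *)
Lemma lebesgue_affine (d : nat) (s : R) (x : 'rV[R]_d) A :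
  s = 1 \/ s = -1 -> measurable A ->
  lebesgue R d (affine_tuple s x @^-1` A) = lebesgue R d A.
Proof.
move=> s1; elim: d x A => [|n IH] x A mA.
  suff -> : affine_tuple s x = id by [].
  by apply/funext => t; apply/eq_from_tnth => -[].
rewrite /= /lebesgue_cons /pushforward.
pose x0 := x 0 ord0; pose y : 'rV[R]_n := \row_i x 0 (lift ord0 i).
have affine_cons p : affine_tuple s x (Defs.cons_tuple p) =
    Defs.cons_tuple (affine1 s x0 p.1, affine_tuple s y p.2).
  apply/eq_from_tnth => i; rewrite tnth_mktuple /Defs.cons_tuple.
  case: (unliftP ord0 i) => [k|] ->; first by rewrite !tnthS/= tnth_mktuple mxE.
  by rewrite !tnth0.
set B := @Defs.cons_tuple R n @^-1` A.
have mB : measurable B.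
  by rewrite -[X in measurable X]setTI; exact: measurable_cons_tuple.
rewrite /product_measure1.
transitivity (\int[lebesgue_measure]_u
    (lebesgue R n \o xsection B) (affine1 s x0 u))%E.
  apply: eq_integral => u _ /=; rewrite -(IH y (xsection B (affine1 s x0 u)));
    last exact: (measurable_xsection _ mB).
  congr (lebesgue R n _); apply/seteqP; split => t;
  by rewrite /xsection/= !inE /B/= affine_cons.
rewrite -[LHS](@ge0_integral_pushforward _ _ _ _ R _ (measurable_affine1 s x0)
   lebesgue_measure setT (lebesgue R n \o xsection B))//.
- apply: eq_measure_integral => C mC _; exact: lebesgue_affine1.
- exact: measurable_fun_xsection.
Qed.

Lemma ge0_integral_affine (d : nat) (s : R) (x : 'rV[R]_d)
    (f : Rtuple R d -> \bar R) : s = 1 \/ s = -1 ->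
  measurable_fun setT f -> (forall t, 0 <= f t)%E ->
  (\int[lebesgue R d]_t f (affine_tuple s x t) = \int[lebesgue R d]_t f t)%E.
Proof.
move=> s1 mf f0.
rewrite -[LHS](@ge0_integral_pushforward _ _ _ _ R _ (measurable_affine_tuple s x)
   (lebesgue R d) setT f)//.
apply: eq_measure_integral => [|mphi C mC _];
  [exact: measurable_affine_tuple|exact: (lebesgue_affine x s1 mC)].
Qed.

Lemma integrable_affine (d : nat) (s : R) (x : 'rV[R]_d)
    (f : Rtuple R d -> \bar R) : s = 1 \/ s = -1 ->
  (lebesgue R d).-integrable setT f ->
  (lebesgue R d).-integrable setT (fun t => f (affine_tuple s x t)).
Proof.
move=> s1 /integrableP[mf fi]; apply/integrableP; split.
  exact: measurableT_comp (measurable_affine_tuple s x).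
rewrite (ge0_integral_affine x (f := fun t => `|f t|%E) s1)//.
exact: measurableT_comp.
Qed.

Lemma integral_affine (d : nat) (s : R) (x : 'rV[R]_d)
    (f : Rtuple R d -> \bar R) : s = 1 \/ s = -1 ->
  (lebesgue R d).-integrable setT f ->
  (\int[lebesgue R d]_t f (affine_tuple s x t) = \int[lebesgue R d]_t f t)%E.
Proof.
move=> s1 fi.
rewrite -[LHS](@integral_pushforward _ _ _ _ R _ (measurable_affine_tuple s x)
   (lebesgue R d) setT f)//.
- apply: eq_measure_integral => [|mphi C mC _];
  [exact: measurable_affine_tuple|exact: (lebesgue_affine x s1 mC)].
- exact: measurable_int fi.
- exact: integrable_affine.
Qed.

End affine_invariance.

(** * A universal integrable majorant *)

Section polynomial_weight.
Context (R : realType).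

(** A product of one-dimensional functions 1 / (1 + u^2), integrable by Tonelli's theorem. It is at
    least (1 + |x|)^(-2d), hence majorises every function of sufficient polynomial decay up to a
    constant. *)
Definition rho (d : nat) (x : 'rV[R]_d) : R := \prod_i (1 + x 0 i ^+ 2)^-1.

Lemma rho_ge0 d (x : 'rV[R]_d) : 0 <= rho x.
Proof. by apply: prodr_ge0 => i _; rewrite invr_ge0 addr_ge0 ?sqr_ge0. Qed.

Lemma integrable_oneDsqrV :
  (lebesgue_measure.-integrable setT (fun u : R => ((1 + u ^+ 2)^-1)%:E)).
Proof.
have c := @continuous_oneDsqrV R.
apply/integrableP; split.
  by apply/measurable_EFinP; apply: continuous_measurable_fun.
under eq_integral do rewrite /= ger0_norm ?invr_ge0 ?addr_ge0 ?sqr_ge0//.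
rewrite (@ge0_symfun_integralT R (fun u => (1 + u ^+ 2)^-1))//.
- rewrite (_ : [set x | _] = `[0, +oo[%classic); last first.
    by apply/seteqP; split => x/=; rewrite in_itv/= andbT.
  by rewrite integral0y_oneDsqr -EFinM ltry.
- by move=> x; rewrite invr_ge0 addr_ge0 ?sqr_ge0.
- by move=> x; rewrite /= sqrrN.
Qed.

Lemma measurable_rho d :
  measurable_fun setT (fun t : Rtuple R d => rho (vec_of_tuple t)).
Proof.
rewrite /rho; apply: measurable_prod => i _.
have c := @continuous_oneDsqrV R.
rewrite (_ : (fun _ => _) = (fun u : R => (1 + u ^+ 2)^-1) \o
    (fun t : Rtuple R d => tnth t i : R)); last first.
  by apply/funext => t; rewrite /= mxE.
apply: measurableT_comp; first exact: continuous_measurable_fun.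
exact: measurable_tnth.
Qed.

Lemma ge0_integral_lebesgueS n (f : Rtuple R n.+1 -> \bar R) :
  measurable_fun setT f -> (forall t, 0 <= f t)%E ->
  (\int[lebesgue R n.+1]_t f t =
   \int[lebesgue_measure]_u \int[lebesgue R n]_t f (Defs.cons_tuple (u, t)))%E.
Proof.
move=> mf f0.
rewrite [LHS](@ge0_integral_pushforward _ _ _ _ R _ (@measurable_cons_tuple R n)
  (lebesgue_measure \x lebesgue R n)%E setT f)//.
rewrite (@fubini_tonelli1 _ _ _ _ R lebesgue_measure (lebesgue R n)
  (f \o @Defs.cons_tuple R n))// => [|x].
- exact: measurableT_comp (@measurable_cons_tuple R n).
- exact: f0.
Qed.

Lemma integrable_rho d :
  (lebesgue R d).-integrable setT (fun t => (rho (vec_of_tuple t))%:E).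
Proof.
apply/integrableP; split; first by apply/measurable_EFinP; exact: measurable_rho.
under eq_integral do rewrite /= ger0_norm ?rho_ge0//.
elim: d => [|n IH].
  rewrite /= integral_dirac ?diracT ?mul1e//.
    by rewrite ltry.
  by apply/measurable_EFinP; exact: measurable_rho.
rewrite ge0_integral_lebesgueS; last 2 first.
  by apply/measurable_EFinP; exact: measurable_rho.
  by move=> t; rewrite lee_fin rho_ge0.
have rhoS u (t : Rtuple R n) : rho (vec_of_tuple (Defs.cons_tuple (u, t))) =
    (1 + u ^+ 2)^-1 * rho (vec_of_tuple t).
  rewrite /rho big_ord_recl mxE tnth0; congr (_ * _).
  by apply: eq_bigr => i _; rewrite !mxE tnthS.
under eq_integral => u _.
  under eq_integral do rewrite rhoS EFinM.
  rewrite ge0_integralZl_EFin ?invr_ge0 ?addr_ge0 ?sqr_ge0//; last 2 first.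
    by move=> t _; rewrite lee_fin rho_ge0.
    by apply/measurable_EFinP; exact: measurable_rho.
  over.
rewrite ge0_integralZr//; first last.
- by apply: integral_ge0 => t _; rewrite lee_fin rho_ge0.
- by move=> u _; rewrite lee_fin invr_ge0 addr_ge0 ?sqr_ge0.
- exact: measurable_int integrable_oneDsqrV.
rewrite lte_mul_pinfty//.
- by apply: integral_ge0 => u _; rewrite lee_fin invr_ge0 addr_ge0 ?sqr_ge0.
- exact: (integrable_fin_num _ integrable_oneDsqrV).
Qed.

End polynomial_weight.

(** * Calculus of complex integrals *)

Section complex_integral.
Context (R : realType) (d : nat).
Local Notation V := 'rV[R]_d.
Local Notation T := (Rtuple R d).
Local Notation mu := (lebesgue R d).
Local Notation vec := (@vec_of_tuple R d).
Implicit Types (f g : Cfun R d) (A : set T).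

Lemma cmeasurableD f g : cmeasurable f -> cmeasurable g ->
  cmeasurable (fun x => f x + g x).
Proof.
move=> [rf jf] [rg jg]; split.
  under eq_fun do rewrite Re_add; exact: measurable_funD.
under eq_fun do rewrite Im_add; exact: measurable_funD.
Qed.

Lemma cmeasurableM f g : cmeasurable f -> cmeasurable g ->
  cmeasurable (fun x => f x * g x).
Proof.
move=> [rf jf] [rg jg]; split.
  under eq_fun do rewrite Re_mul.
  by apply: measurable_funB; exact: measurable_funM.
under eq_fun do rewrite Im_mul.
by apply: measurable_funD; exact: measurable_funM.
Qed.

Lemma cmeasurable_cst (a : R[i]) : @cmeasurable R d (fun=> a).
Proof. by split; exact: measurable_cst. Qed.

Lemma cmeasurable_continuous f : continuous (fun x => complex.Re (f x)) ->
  continuous (fun x => complex.Im (f x)) -> cmeasurable f.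
Proof.
by move=> cr ci; split; [apply: (measurable_vec_continuous cr)|
  apply: (measurable_vec_continuous ci)].
Qed.

Lemma cmeasurable_real (f : V -> R) : measurable_fun setT (f \o vec) ->
  cmeasurable (fun x => ((f x)%:C)%C).
Proof. by move=> mf; split => //=; exact: measurable_cst. Qed.

Lemma cmeasurable_affine (s : R) (x : V) f : cmeasurable f ->
  cmeasurable (fun y => f (s *: y + x)).
Proof.
move=> [rf jf]; split; under eq_fun do rewrite -affine_tupleE.
  exact: (measurableT_comp rf (measurable_affine_tuple s x)).
exact: (measurableT_comp jf (measurable_affine_tuple s x)).
Qed.

Lemma measurable_nrm f : cmeasurable f ->
  measurable_fun setT (fun t => nrm (f (vec t))).
Proof.
move=> [rf jf]; under eq_fun do rewrite nrmC_def.
apply: measurableT_comp => //; first exact: continuous_measurable_fun (@sqrt_continuous R).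
by apply: measurable_funD; exact: measurable_funX.
Qed.

Lemma cintegrable_measurable f : cintegrable f -> cmeasurable f.
Proof.
by move=> [rf jf]; split; apply/measurable_EFinP; exact: measurable_int (rf) ||
  exact: measurable_int (jf).
Qed.

Lemma cintegrable_dominated f (g : V -> R) : cmeasurable f ->
  mu.-integrable setT (fun t => (g (vec t))%:E) ->
  (forall x, nrm (f x) <= g x) -> cintegrable f.
Proof.
move=> [rf jf] ig fg; split; apply: le_integrable ig => //=;
  try exact/measurable_EFinP.
  move=> t _; rewrite lee_fin (le_trans (normr_Re_le _))// (le_trans (fg _))//.
  exact: ler_norm.
move=> t _; rewrite lee_fin (le_trans (normr_Im_le _))// (le_trans (fg _))//.
exact: ler_norm.
Qed.

Lemma integrable_nrm f : cintegrable f ->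
  mu.-integrable setT (fun t => (nrm (f (vec t)))%:E).
Proof.
move=> If; have mf := cintegrable_measurable If; have [rf jf] := If.
apply: (le_integrable measurableT _ _
  (integrableD measurableT (integrable_abse rf) (integrable_abse jf))) => //=.
  by apply/measurable_EFinP; exact: measurable_nrm.
move=> t _; rewrite lee_fin ger0_norm ?nrm_ge0//.
by rewrite (le_trans (nrm_le_ReIm _))// ler_norm.
Qed.

Lemma cintegrableP f : cintegrable f <->
  cmeasurable f /\ (\int[mu]_t (nrm (f (vec t)))%:E < +oo)%E.
Proof.
split=> [If|[mf If]].
  split; first exact: cintegrable_measurable.
  have /integrableP[_] := integrable_nrm If.
  by under eq_integral do rewrite /= ger0_norm ?nrm_ge0//.
apply: (cintegrable_dominated mf (g := fun x => nrm (f x))) => //.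
apply/integrableP; split; first by apply/measurable_EFinP; exact: measurable_nrm.
by under eq_integral do rewrite /= ger0_norm ?nrm_ge0//.
Qed.

Lemma cintegrableM_bounded f g (K : R) : cintegrable f -> cmeasurable g ->
  (forall x, nrm (g x) <= K) -> cintegrable (fun x => g x * f x).
Proof.
move=> If mg gK.
apply: (cintegrable_dominated (g := fun x => K * nrm (f x))).
- exact: cmeasurableM mg (cintegrable_measurable If).
- under eq_fun do rewrite EFinM.
  by apply: integrableZl => //; exact: integrable_nrm.
- by move=> x; rewrite nrmM ler_wpM2r ?nrm_ge0.
Qed.

Lemma cintegrable_lin (a : R[i]) f g : cintegrable f -> cintegrable g ->
  cintegrable (fun x => a * f x + g x).
Proof.
move=> If Ig.
apply: (cintegrable_dominated (g := fun x => nrm a * nrm (f x) + nrm (g x))).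
- apply: cmeasurableD (cintegrable_measurable Ig).
  by apply: cmeasurableM (cintegrable_measurable If); exact: cmeasurable_cst.
- under eq_fun do rewrite EFinD EFinM.
  apply: integrableD => //; last exact: integrable_nrm.
  by apply: integrableZl => //; exact: integrable_nrm.
- by move=> x; rewrite -nrmM nrm_triangle.
Qed.

Lemma cintegral_lin A (a : R[i]) f g : measurable A ->
  cintegrable f -> cintegrable g ->
  cintegral A (fun x => a * f x + g x) = a * cintegral A f + cintegral A g.
Proof.
move=> mA [rf jf] [rg jg].
have S h : mu.-integrable setT h -> mu.-integrable A h.
  by move=> ih; exact: (integrableS measurableT mA _ ih).
have L (r1 r2 : R) (h1 h2 : T -> R) : mu.-integrable setT (EFin \o h1) ->
    mu.-integrable setT (EFin \o h2) ->
    mu.-integrable A (EFin \o (fun t => r1 * h1 t + r2 * h2 t)) /\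
    Rintegral mu A (fun t => r1 * h1 t + r2 * h2 t) =
      r1 * Rintegral mu A h1 + r2 * Rintegral mu A h2.
  move=> /S i1 /S i2.
  have j1 := integrableZl mA r1 i1; have j2 := integrableZl mA r2 i2.
  split; last first.
    rewrite (RintegralD (f1 := fun t => r1 * h1 t) (f2 := fun t => r2 * h2 t))//.
    by rewrite !RintegralZl.
  by apply: eq_integrable (integrableD mA j1 j2) => // t _ /=; rewrite EFinD !EFinM.
have [i1 e1] := L (complex.Re a) (- complex.Im a) _ _ rf jf.
have [i2 e2] := L (complex.Re a) (complex.Im a) _ _ jf rf.
apply: complex_eqP; rewrite /cintegral !ReImE/=.
  rewrite -mulNr -e1 -RintegralD//; last exact: S.
  by apply: eq_Rintegral => t _; rewrite Re_add Re_mul mulNr.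
rewrite -e2 -RintegralD//; last exact: S.
by apply: eq_Rintegral => t _; rewrite Im_add Im_mul.
Qed.

Lemma eq_cintegral A f g : f =1 g -> cintegral A f = cintegral A g.
Proof. by move=> /funext ->. Qed.

Lemma cintegral0 A : cintegral A (fun=> 0) = 0.
Proof.
by apply: complex_eqP; rewrite /cintegral/= /Rintegral integral0.
Qed.

End complex_integral.

Section complex_integral_bounds.
Context (R : realType) (d : nat).
Local Notation V := 'rV[R]_d.
Local Notation T := (Rtuple R d).
Local Notation mu := (lebesgue R d).
Local Notation vec := (@vec_of_tuple R d).
Implicit Types (f g : Cfun R d) (A : set T).

Lemma cintegrable0 : @cintegrable R d (fun=> 0).
Proof. by split; exact: integrable0. Qed.

Lemma cintegrableZ (a : R[i]) f : cintegrable f -> cintegrable (fun x => a * f x).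
Proof.
move=> If; have := cintegrable_lin a If cintegrable0.
by congr cintegrable; apply/funext => x; rewrite addr0.
Qed.

Lemma cintegralZ A (a : R[i]) f : measurable A -> cintegrable f ->
  cintegral A (fun x => a * f x) = a * cintegral A f.
Proof.
move=> mA If; have := cintegral_lin a mA If cintegrable0.
rewrite cintegral0 addr0 => <-; apply: eq_cintegral => x; exact/esym/addr0.
Qed.

Lemma cintegralB A f g : measurable A -> cintegrable f -> cintegrable g ->
  cintegral A (fun x => f x - g x) = cintegral A f - cintegral A g.
Proof.
move=> mA If Ig; have := cintegral_lin (-1) mA Ig If.
rewrite mulN1r addrC => <-; apply: eq_cintegral => x; by rewrite mulN1r addrC.
Qed.

(** A rotation makes the integral real and nonnegative; it is then the integral of a real part,
    which the modulus dominates. *)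
Lemma nrm_cintegral_le A f : measurable A -> cintegrable f ->
  nrm (cintegral A f) <= Rintegral mu A (fun t => nrm (f (vec t))).
Proof.
move=> mA If; have [a a1 aI] := unimodular_rotation (cintegral A f).
have -> : nrm (cintegral A f) = complex.Re (cintegral A (fun x => a * f x)).
  by rewrite cintegralZ// aI.
have S h : mu.-integrable setT h -> mu.-integrable A h.
  by move=> ih; exact: (integrableS measurableT mA _ ih).
apply: le_Rintegral => //.
- by apply: S; have [] := cintegrableZ a If.
- by apply: S; exact: integrable_nrm.
- move=> t _; rewrite (le_trans (ler_norm _))// (le_trans (normr_Re_le _))//.
  by rewrite nrmM a1 mul1r.
Qed.

Lemma nrm_cintegral_dominated A f (g : V -> R) : measurable A -> cintegrable f ->
  mu.-integrable setT (fun t => (g (vec t))%:E) ->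
  (forall x, nrm (f x) <= g x) ->
  nrm (cintegral A f) <= Rintegral mu setT (fun t => g (vec t)).
Proof.
move=> mA If Ig fg; rewrite (le_trans (nrm_cintegral_le mA If))//.
have inf := integrable_nrm If.
apply: (@le_trans _ _ (Rintegral mu setT (fun t => nrm (f (vec t))))); last first.
  by apply: le_Rintegral => // t _; exact: fg.
rewrite /Rintegral fine_le//.
- by apply: integrable_fin_num => //; exact: (integrableS measurableT mA _ inf).
- exact: integrable_fin_num.
- apply: ge0_subset_integral => //; last by move=> t _; rewrite lee_fin nrm_ge0.
  exact: measurable_int inf.
Qed.

Lemma cintegrable_affine (s : R) (y : V) f : s = 1 \/ s = -1 ->
  cintegrable f -> cintegrable (fun x => f (s *: x + y)).
Proof.
move=> s1 [rf jf]; split; under eq_fun do rewrite -affine_tupleE.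
  exact: (integrable_affine y s1 rf).
exact: (integrable_affine y s1 jf).
Qed.

Lemma cintegral_affine (s : R) (y : V) f : s = 1 \/ s = -1 ->
  cintegrable f -> cintegral setT (fun x => f (s *: x + y)) = cintegral setT f.
Proof.
move=> s1 [rf jf]; apply: complex_eqP; rewrite /cintegral/= /Rintegral;
  under eq_integral do rewrite -affine_tupleE.
  by rewrite (integral_affine y s1 rf).
by rewrite (integral_affine y s1 jf).
Qed.

Lemma cintegrable_shift (y : V) f :
  cintegrable f -> cintegrable (fun x => f (x + y)).
Proof.
move=> /(cintegrable_affine y (or_introl erefl)).
by under eq_fun do rewrite scale1r.
Qed.

Lemma cintegral_shift (y : V) f : cintegrable f ->
  cintegral setT (fun x => f (x + y)) = cintegral setT f.
Proof.
move=> /(cintegral_affine y (or_introl erefl)).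
by under eq_fun do rewrite scale1r.
Qed.

Lemma Rintegral_dominated_cvg0 (r : nat -> T -> R) (g : T -> R) :
  (forall n, measurable_fun setT (r n)) ->
  mu.-integrable setT (EFin \o g) ->
  (forall n t, 0 <= r n t <= g t) ->
  (forall t, r n t @[n --> \oo] --> 0) ->
  Rintegral mu setT (r n) @[n --> \oo] --> (0 : R).
Proof.
move=> mr ig rg r0.
have [] := @dominated_convergence _ T R mu setT measurableT
  (fun n => EFin \o r n) (cst 0%E) (EFin \o g).
- by move=> n; apply/measurable_EFinP.
- exact: measurable_cst.
- by apply: aeW => t _; apply: cvg_EFin (r0 t); exact: nearW.
- exact: ig.
- apply: aeW => t n _ /=; have /andP[r0n rgn] := rg n t.
  by rewrite lee_fin ger0_norm.
move=> _ _; rewrite integral0 => /fine_cvg.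
exact.
Qed.

Lemma cintegral_dominated_cvg A (f_ : nat -> Cfun R d) f (g : V -> R) :
  measurable A -> (forall n, cmeasurable (f_ n)) -> cmeasurable f ->
  mu.-integrable setT (fun t => (g (vec t))%:E) ->
  (forall n x, nrm (f_ n x) <= g x) -> (forall x, nrm (f x) <= g x) ->
  (forall x, nrm (f_ n x - f x) @[n --> \oo] --> 0) ->
  nrm (cintegral A (f_ n) - cintegral A f) @[n --> \oo] --> 0.
Proof.
move=> mA mf_ mf ig fg_ fg f_f.
have If_ n := cintegrable_dominated (mf_ n) ig (fg_ n).
have If := cintegrable_dominated mf ig fg.
have ID n : cintegrable (fun x => f_ n x - f x).
  have := cintegrable_lin (-1) If (If_ n).
  by under eq_fun do rewrite mulN1r addrC.
apply: (@squeeze_cvgr _ _ _ _ (fun=> 0)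
  (fun n => Rintegral mu setT (fun t => nrm (f_ n (vec t) - f (vec t))))).
- apply: nearW => n; rewrite nrm_ge0/= -cintegralB//.
  apply: (nrm_cintegral_dominated (g := fun x => nrm (f_ n x - f x)) mA (ID n)) => //.
  exact: integrable_nrm (ID n).
- exact: cvg_cst.
- apply: (Rintegral_dominated_cvg0 (g := fun t => g (vec t) + g (vec t))).
  + by move=> n; apply: (measurable_nrm (cintegrable_measurable (ID n))).
  + exact: (integrableD measurableT ig ig).
  + move=> n t; rewrite nrm_ge0/= (le_trans (nrm_triangle _ _))// nrmN.
    by rewrite lerD.
  + by move=> t; exact: f_f.
Qed.

End complex_integral_bounds.

(** * Fubini's theorem for complex functions *)

Section complex_fubini.
Context (R : realType) (d : nat).
Local Notation V := 'rV[R]_d.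
Local Notation T := (Rtuple R d).
Local Notation mu := (lebesgue R d).
Local Notation vec := (@vec_of_tuple R d).
Implicit Types (f g : V -> V -> R[i]).

Definition cmeasurable2 f :=
  measurable_fun setT (fun p : T * T => complex.Re (f (vec p.1) (vec p.2))) /\
  measurable_fun setT (fun p : T * T => complex.Im (f (vec p.1) (vec p.2))).

Lemma cmeasurable2M f g : cmeasurable2 f -> cmeasurable2 g ->
  cmeasurable2 (fun x y => f x y * g x y).
Proof.
move=> [rf jf] [rg jg]; split.
  under eq_fun do rewrite Re_mul.
  by apply: measurable_funB; exact: measurable_funM.
under eq_fun do rewrite Im_mul.
by apply: measurable_funD; exact: measurable_funM.
Qed.

Lemma cmeasurable2_fst (f : Cfun R d) : cmeasurable f ->
  cmeasurable2 (fun x _ => f x).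
Proof.
move=> [rf jf]; split; first exact: (measurableT_comp rf measurable_fst).
exact: (measurableT_comp jf measurable_fst).
Qed.

Lemma cmeasurable2_snd (f : Cfun R d) : cmeasurable f ->
  cmeasurable2 (fun _ y => f y).
Proof.
move=> [rf jf]; split; first exact: (measurableT_comp rf measurable_snd).
exact: (measurableT_comp jf measurable_snd).
Qed.

Let measurable_tnth1 i : measurable_fun setT (fun p : T * T => tnth p.1 i : R).
Proof. exact: (measurableT_comp (measurable_tnth i) measurable_fst). Qed.

Let measurable_tnth2 i : measurable_fun setT (fun p : T * T => tnth p.2 i : R).
Proof. exact: (measurableT_comp (measurable_tnth i) measurable_snd). Qed.

Lemma cmeasurable2_add (f : Cfun R d) (s : R) : cmeasurable f ->
  cmeasurable2 (fun x y => f (x + s *: y)).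
Proof.
move=> [rf jf].
pose h (p : T * T) : T := [tuple tnth p.1 i + s * tnth p.2 i | i < d].
have hE p : vec p.1 + s *: vec p.2 = vec (h p).
  by apply/rowP => i; rewrite !mxE tnth_mktuple.
have mh : measurable_fun setT h.
  apply/measurable_fun_tnthP => i.
  rewrite (_ : _ \o _ = fun p : T * T => tnth p.1 i + s * tnth p.2 i); last first.
    by apply/funext => t; rewrite /= tnth_mktuple.
  by apply: measurable_funD => //; exact: measurable_funM.
split; under eq_fun do rewrite hE.
  exact: measurableT_comp rf mh.
exact: measurableT_comp jf mh.
Qed.

Lemma cmeasurable2_cis (s : R) :
  cmeasurable2 (fun x y => cis (s * dotv x y)).
Proof.
have mh : measurable_fun setT (fun p : T * T => s * dotv (vec p.1) (vec p.2)).
  apply: measurable_funM => //; apply: measurable_sum => i.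
  by under eq_fun do rewrite !mxE; apply: measurable_funM.
split => /=.
  apply: (measurableT_comp _ mh); apply: continuous_measurable_fun.
  exact: continuous_cos.
apply: (measurableT_comp _ mh); apply: continuous_measurable_fun.
exact: continuous_sin.
Qed.

Variables (f : V -> V -> R[i]) (g h : V -> R).
Hypothesis mf : cmeasurable2 f.
Hypothesis ig : mu.-integrable setT (fun t => (g (vec t))%:E).
Hypothesis ih : mu.-integrable setT (fun t => (h (vec t))%:E).
Hypothesis fgh : forall x y, nrm (f x y) <= g x * h y.

(** A majorant in separated variables gives integrability on the product by Tonelli's theorem; all
    double integrals below come with such a majorant. *)
Let fubini_real (r : T * T -> R) : measurable_fun setT r ->
  (forall p, `|r p| <= g (vec p.1) * h (vec p.2)) ->
  Rintegral mu setT (fun s => Rintegral mu setT (fun t => r (s, t))) =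
  Rintegral mu setT (fun t => Rintegral mu setT (fun s => r (s, t))) /\
  mu.-integrable setT (fun s => (Rintegral mu setT (fun t => r (s, t)))%:E).
Proof.
move=> mr rgh.
have mrE : measurable_fun setT (EFin \o r) by apply/measurable_EFinP.
have gh0 x y : 0 <= g x * h y by rewrite (le_trans _ (fgh x y))// nrm_ge0.
have I12 : (mu \x mu)%E.-integrable setT (EFin \o r).
  apply/integrable12ltyP => //.
  apply: (@le_lt_trans _ _ (\int[mu]_s \int[mu]_t (`|g (vec s)|%:E * `|h (vec t)|%:E))%E).
    apply: ge0_le_integral => //.
    - by move=> s _; exact: integral_ge0.
    - apply: (@measurable_fun_fubini_tonelli_F _ _ _ _ R mu (fun p => `|(EFin \o r) p|)%E) => //.
      exact: measurableT_comp.
    - under eq_fun => s.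
        rewrite ge0_integralZl_EFin//; last first.
          by apply: (measurable_int mu); exact: (integrable_norm ih).
        over.
      apply: emeasurable_funM => //.
      by apply: (measurable_int mu); exact: (integrable_norm ig).
    - move=> s _; apply: ge0_le_integral => //.
      + by apply: measurableT_comp => //; exact: measurableT_comp (pair1_measurable s).
      + apply: emeasurable_funM => //.
        by apply: (measurable_int mu); exact: (integrable_norm ih).
      + move=> t _ /=; rewrite -EFinM lee_fin (le_trans (rgh _))//=.
        by rewrite -normrM ler_norm.
  under eq_integral => s _.
    rewrite ge0_integralZl_EFin//; last first.
      by apply: (measurable_int mu); exact: (integrable_norm ih).
    over.
  rewrite ge0_integralZr//; last 2 first.
  - by apply: (measurable_int mu); exact: (integrable_norm ig).
  - by apply: integral_ge0 => t _; rewrite lee_fin.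
  rewrite lte_mul_pinfty//.
  - by apply: integral_ge0 => t _; rewrite lee_fin.
  - exact: (integrable_fin_num measurableT (integrable_norm ig)).
  - exact: integrable_lty (integrable_norm ih).
have If s : mu.-integrable setT (fun t => (r (s, t))%:E).
  apply: (@le_integrable _ _ _ mu setT measurableT _ (fun t => (g (vec s) * h (vec t))%:E)).
  - by apply: measurableT_comp mrE (pair1_measurable s).
  - by move=> t _ /=; rewrite lee_fin (le_trans (rgh _))//= ler_norm.
  - by under eq_fun do rewrite EFinM; exact: integrableZl.
have Ig t : mu.-integrable setT (fun s => (r (s, t))%:E).
  apply: (@le_integrable _ _ _ mu setT measurableT _ (fun s => (g (vec s) * h (vec t))%:E)).
  - by apply: measurableT_comp mrE (pair2_measurable t).
  - by move=> s _ /=; rewrite lee_fin (le_trans (rgh _))//= ler_norm.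
  - by under eq_fun do rewrite mulrC EFinM; exact: integrableZl.
have EF s : (Rintegral mu setT (fun t => r (s, t)))%:E = (\int[mu]_t (r (s, t))%:E)%E.
  by rewrite fineK//; exact: integrable_fin_num.
have EG t : (Rintegral mu setT (fun s => r (s, t)))%:E = (\int[mu]_s (r (s, t))%:E)%E.
  by rewrite fineK//; exact: integrable_fin_num.
split; last first.
  under eq_fun do rewrite EF.
  exact: (integrable_fubini_F I12).
rewrite /Rintegral; congr fine.
under eq_integral do rewrite EF.
under [RHS]eq_integral do rewrite EG.
exact: Fubini I12.
Qed.

Lemma cintegral_fubini :
  cintegral setT (fun x => cintegral setT (fun y => f x y)) =
  cintegral setT (fun y => cintegral setT (fun x => f x y)).
Proof.
have [mrf mjf] := mf.
have [e1 _] := fubini_real mrf (fun p => le_trans (normr_Re_le _) (fgh _ _)).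
have [e2 _] := fubini_real mjf (fun p => le_trans (normr_Im_le _) (fgh _ _)).
by apply: complex_eqP; [exact: e1|exact: e2].
Qed.

Lemma cintegrable_fubini : cintegrable (fun x => cintegral setT (fun y => f x y)).
Proof.
have [mrf mjf] := mf.
have [_ i1] := fubini_real mrf (fun p => le_trans (normr_Re_le _) (fgh _ _)).
have [_ i2] := fubini_real mjf (fun p => le_trans (normr_Im_le _) (fgh _ _)).
by split.
Qed.

End complex_fubini.

(** * Weights and steps of the Gelfand-Shilov spaces *)

Section euclidean_norm.
Context (R : realType) (d : nat).
Implicit Types x y : 'rV[R]_d.

Lemma dotv_ge0 x : 0 <= dotv x x.
Proof. by apply: sumr_ge0 => i _; rewrite -expr2 sqr_ge0. Qed.

Lemma enorm_ge0 x : 0 <= enorm x.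
Proof. exact: sqrtr_ge0. Qed.

Lemma sqr_enorm x : enorm x ^+ 2 = dotv x x.
Proof. by rewrite sqr_sqrtr// dotv_ge0. Qed.

Lemma enormN x : enorm (- x) = enorm x.
Proof.
by congr Num.sqrt; apply: eq_bigr => i _; rewrite !mxE mulrNN.
Qed.

Lemma normr_le_enorm x i : `|x 0 i| <= enorm x.
Proof.
rewrite -(ler_pXn2r (_ : (0 < 2)%N)) ?nnegrE ?enorm_ge0//.
rewrite sqr_enorm real_normK ?num_real// /dotv (bigD1 i)//= expr2 lerDl.
by apply: sumr_ge0 => j _; rewrite -expr2 sqr_ge0.
Qed.

Lemma enorm_le_sum x : enorm x <= \sum_i `|x 0 i|.
Proof.
rewrite -(ler_pXn2r (_ : (0 < 2)%N)) ?nnegrE ?enorm_ge0 ?sumr_ge0//.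
rewrite sqr_enorm expr2 mulr_suml; apply: ler_sum => i _.
rewrite -expr2 -real_normK ?num_real// expr2 ler_wpM2l// (bigD1 i)//= lerDl.
by apply: sumr_ge0.
Qed.

Lemma enorm_le_norm x : enorm x <= d%:R * `|x|.
Proof.
rewrite -(ler_pXn2r (_ : (0 < 2)%N)) ?nnegrE ?enorm_ge0 ?mulr_ge0//.
rewrite sqr_enorm exprMn.
apply: (@le_trans _ _ (d%:R * `|x| ^+ 2)).
  rewrite -[X in X%:R]card_ord -sum1_card natr_sum mulr_suml.
  apply: ler_sum => i _; rewrite mul1r -expr2 -real_normK ?num_real//.
  by rewrite lerXn2r ?nnegrE// normr_coord_le.
rewrite ler_wpM2r ?sqr_ge0// -natrX ler_nat.
by case: (d) => // n; rewrite expnS leq_pmulr// expn_gt0.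
Qed.

(** Takes the place of the triangle inequality; it follows coordinatewise from 2 a^2 + 2 b^2 - (a +
    b)^2 = (a - b)^2. *)
Lemma enorm_le_max x y : enorm y <= 2 * Num.max (enorm (y - x)) (enorm x).
Proof.
have m0 : 0 <= Num.max (enorm (y - x)) (enorm x).
  by rewrite le_max enorm_ge0.
rewrite -(ler_pXn2r (_ : (0 < 2)%N)) ?nnegrE ?enorm_ge0 ?mulr_ge0//.
apply: (@le_trans _ _ (2 * enorm (y - x) ^+ 2 + 2 * enorm x ^+ 2)).
  rewrite !sqr_enorm /dotv !mulr_sumr -big_split/=; apply: ler_sum => i _.
  rewrite !mxE -subr_ge0 (le_trans (sqr_ge0 (y 0 i - 2 * x 0 i)))//.
  by rewrite le_eqVlt; apply/orP; left; apply/eqP; ring.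
have : enorm (y - x) ^+ 2 <= Num.max (enorm (y - x)) (enorm x) ^+ 2.
  by rewrite lerXn2r ?nnegrE ?enorm_ge0// le_max lexx.
have : enorm x ^+ 2 <= Num.max (enorm (y - x)) (enorm x) ^+ 2.
  by rewrite lerXn2r ?nnegrE ?enorm_ge0// le_max lexx orbT.
by rewrite exprMn; lra.
Qed.

End euclidean_norm.

(** * Consequences of (M.1), (M.2) and (M.6) for the associated function *)

Section associated_function.
Context (R : realType) (A : nat -> R).
Hypothesis wsA : weight_sequence A.

Let A0 p : 0 < A p. Proof. exact: (ws_gt0 wsA). Qed.

Lemma factorial_power_le (x : R) p : 0 <= x -> x ^+ p <= (p`!)%:R * expR x.
Proof.
move=> x0; rewrite -ler_pdivrMl ?ltr0n ?fact_gt0// mulrC.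
case: p => [|p]; first by rewrite expr0 fact0 divr1 -expR0 ler_expR.
by rewrite (le_trans _ (expR_ge1Dxn p x0))// lerDr.
Qed.

(** By (M.6), x^p / A_p is at most c0 (L0 x)^p / p!, which is controlled by the exponential series:
    the associated function grows at most linearly. *)
Lemma assoc_fun_exp_type : exists C L : R, [/\ 0 < C, 0 <= L &
  forall x p, 0 <= x -> x ^+ p / A p <= C * expR (L * x)].
Proof.
have [c0 [L0 [c1 L1 A6]]] := ws_M6 wsA.
exists c0, L0; split; [lra|lra|move=> x p x0].
rewrite ler_pdivrMr//.
have := factorial_power_le p (mulr_ge0 (le_trans ler01 L1) x0).
rewrite exprMn => h.
have Lp : 1 <= L0 ^+ p by rewrite exprn_ege1.
rewrite -(ler_pM2l (lt_le_trans ltr01 Lp)) (le_trans h)//.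
rewrite (le_trans (ler_wpM2r (expR_ge0 _) (A6 p)))//.
by rewrite le_eqVlt; apply/orP; left; apply/eqP; ring.
Qed.

Lemma assoc_fun_has_ubound (x : R) : 0 <= x ->
  has_ubound [set ln_plus (x ^+ p / A p) | p in @setT nat].
Proof.
move=> x0; have [C [L [C0 L0 CL]]] := assoc_fun_exp_type.
exists (ln_plus (C * expR (L * x))) => _ [p _ <-].
rewrite /ln_plus ge_max le_max lexx/= le_max.
have [xp|xp] := ltP 0 (x ^+ p / A p); last by rewrite ln0// lexx.
have CE : 0 < C * expR (L * x) by rewrite mulr_gt0// expR_gt0.
by apply/orP; right; rewrite ler_ln ?posrE//; exact: CL.
Qed.

Lemma assoc_fun_ge0 (x : R) : 0 <= x -> 0 <= assoc_fun A x.
Proof.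
move=> x0; apply: (@le_trans _ _ (ln_plus (x ^+ 0 / A 0%N))).
  by rewrite le_max lexx.
by apply: ub_le_sup; [exact: assoc_fun_has_ubound|exists 0%N].
Qed.

(** With [expR_assoc_fun_le] this says that exp (A(x)) is the supremum of the x^p / A_p: passing
    from ln to its positive part changes nothing because the term p = 0 equals 1. *)
Lemma expR_assoc_fun_ge (x : R) p : 0 <= x -> x ^+ p / A p <= expR (assoc_fun A x).
Proof.
move=> x0; have [xp|xp] := ltP 0 (x ^+ p / A p); last first.
  by rewrite (le_trans xp)// expR_ge0.
rewrite -[leLHS]lnK ?posrE// ler_expR.
apply: (@le_trans _ _ (ln_plus (x ^+ p / A p))); first by rewrite le_max lexx orbT.
by apply: ub_le_sup; [exact: assoc_fun_has_ubound|exists p].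
Qed.

Lemma expR_assoc_fun_le (x K : R) : 0 <= x ->
  (forall p, x ^+ p / A p <= K) -> expR (assoc_fun A x) <= K.
Proof.
move=> x0 xK.
have K1 : 1 <= K by have := xK 0%N; rewrite expr0 (ws_0 wsA) divr1.
have K0 : 0 < K by rewrite (lt_le_trans _ K1).
rewrite -[leRHS]lnK ?posrE// ler_expR; apply: ge_sup.
  by exists (ln_plus (x ^+ 0 / A 0%N)), 0%N.
move=> _ [p _ <-]; rewrite ge_max ln_ge0//=.
have [xp|xp] := ltP 0 (x ^+ p / A p); last by rewrite ln0// ln_ge0.
by rewrite ler_ln ?posrE.
Qed.

Lemma expR_assoc_fun_exp_type : exists C L : R, [/\ 0 < C, 0 <= L &
  forall x, 0 <= x -> expR (assoc_fun A x) <= C * expR (L * x)].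
Proof.
have [C [L [C0 L0 CL]]] := assoc_fun_exp_type.
by exists C, L; split => // x x0; apply: expR_assoc_fun_le => // p; exact: CL.
Qed.

Lemma expR_assoc_fun_mono (x y : R) : 0 <= x -> x <= y ->
  expR (assoc_fun A x) <= expR (assoc_fun A y).
Proof.
move=> x0 xy; apply: expR_assoc_fun_le => // p.
rewrite (le_trans _ (expR_assoc_fun_ge p (le_trans x0 xy)))//.
by rewrite ler_pM2r ?invr_gt0// lerXn2r ?nnegrE// (le_trans x0).
Qed.

(** Stability (M.2) with q = 1: the factor x turns the term x^p / A_p into the next one, as A_(p+1)
    <= c0 H^(p+1) A_p. *)
Lemma expR_assoc_fun_absorb : exists C H : R, [/\ 0 < C, 1 <= H &
  forall x, 0 <= x -> (1 + x) * expR (assoc_fun A x) <= C * expR (assoc_fun A (H * x))].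
Proof.
have [c0 [H [c1 H1 A2]]] := ws_M2 wsA.
exists (1 + c0), H; split => //; first lra.
move=> x x0; rewrite mulrC -ler_pdivlMr; last lra.
apply: expR_assoc_fun_le => // p; rewrite ler_pdivlMr; last lra.
have Hx0 : 0 <= H * x by rewrite mulr_ge0//; lra.
have Hx : x <= H * x by rewrite ler_peMl.
rewrite [in leLHS]mulrDr mulr1 [in leRHS]mulrDl mul1r lerD//.
  exact: le_trans (expR_assoc_fun_ge p x0) (expR_assoc_fun_mono x0 Hx).
have h := expR_assoc_fun_ge p.+1 Hx0.
have := A2 p.+1 1%N (ltn0Sn p); rewrite subn1/= (ws_1 wsA) mulr1 => Ap.
apply: (@le_trans _ _ (c0 * ((H * x) ^+ p.+1 / A p.+1))); last first.
  by rewrite ler_wpM2l//; lra.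
have -> : x ^+ p / A p * x = x ^+ p.+1 * (A p)^-1 by rewrite exprSr; ring.
have -> : c0 * ((H * x) ^+ p.+1 / A p.+1) = x ^+ p.+1 * (c0 * H ^+ p.+1 / A p.+1).
  by rewrite exprMn; ring.
rewrite ler_wpM2l ?exprn_ge0// ler_pdivlMr// mulrC ler_pdivrMr//.
Qed.

(** Log-convexity makes the quotients A_(k+1) / A_k nondecreasing, so the product of m of them
    starting at n is at least the product of m of them starting at 0. *)
Lemma weight_superadditive n m : A n * A m <= A (n + m)%N.
Proof.
have q_mono k l : A k.+1 / A k <= A (k + l).+1 / A (k + l)%N.
  elim: l => [|l IH]; first by rewrite addn0.
  rewrite (le_trans IH)// addnS ler_pdivrMr// mulrAC ler_pdivlMr//.
  by have := ws_M1 wsA (ltn0Sn (k + l)); rewrite expr2 /= mulrC [A _ * A _.+2]mulrC.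
elim: m => [|m IH]; first by rewrite addn0 (ws_0 wsA) mulr1.
have := q_mono m n; rewrite ler_pdivrMr// mulrAC ler_pdivlMr// addnC => h.
rewrite addnS -(ler_pM2r (A0 m)) (le_trans _ h)//.
by rewrite [A n * _]mulrC -mulrA ler_wpM2l// ltW.
Qed.

End associated_function.

(** * Comparison of the steps *)

Section growth.
Context (R : realType).
Implicit Types (A M : nat -> R).

(* Each step of the limits defining the Gelfand-Shilov spaces is given by the
   factor of the derivatives of order n and by the weight in space. *)
Definition step (d : nat) : Type := ((nat -> R) * ('rV[R]_d -> R))%type.

Definition ultra_factor M (h : R) (n : nat) : R := h ^+ n / M n.

(** A coefficient 1 or 0 puts the norms of order at most [k] into the same shape as the
    ultradifferentiable ones; where it vanishes, a bound for the step says nothing about the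
    derivatives. *)
Definition order_factor (k n : nat) : R := (n <= k)%N%:R.

Definition exp_weight d A (h : R) (x : 'rV[R]_d) : R :=
  expR (assoc_fun A (h * enorm x)).

Definition power_weight d (k : nat) (x : 'rV[R]_d) : R := (1 + enorm x) ^+ k.

Definition steps (d : nat) (c : gs_class R) : set (step d) :=
  match c with
  | GSBeurling M A | GSRoumieu M A =>
      [set (ultra_factor M h, @exp_weight d A h) | h in [set h : R | 0 < h]]
  | GSSmoothBeurling A =>
      [set (order_factor k, @exp_weight d A k%:R) | k in [set k : nat | (0 < k)%N]]
  | GSBeurlingTempered M =>
      [set (ultra_factor M k%:R, @power_weight d k) | k in [set k : nat | (0 < k)%N]]
  | GSSchwartz =>
      [set (order_factor k, @power_weight d k) | k in [set k : nat | (0 < k)%N]]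
  end.

(** The numbers n and m count the derivatives that fall on the character and on the function when a
    modulation is differentiated, and [k] bounds each factor produced by the character. Of
    [4 ^+ (n + m)], one power of 2 pays for the terms of the Leibniz rule and the other remains to
    spare. *)
Definition finer_factor (co co' : nat -> R) := forall k : R, 0 <= k ->
  exists2 C : R, 0 < C &
    forall n m, co (n + m)%N * k ^+ n * 4 ^+ (n + m) <= C * co' m.

(** The factor 1 + |y| is the room to spare in space; with the spare power of 2 it will make tails
    uniformly small. *)
Definition finer_weight d (w w' : 'rV[R]_d -> R) := forall B : R,
  exists2 C : R, 0 < C &
    forall x y, enorm x <= B -> (1 + enorm y) * w y <= C * w' (y - x).

(* [s'] is so much finer than [s] that a bound for [s'] gives a bound for [s],
   locally uniform under translations and modulations, with room to spare. *)
Definition finer d (s s' : step d) :=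
  finer_factor s.1 s'.1 /\ finer_weight s.2 s'.2.

(** Superadditivity of the weights separates the two factors. The supremum over n of (4 h k)^n / M_n
    is the exponential of the associated function at 4 h k, which serves as constant. *)
Lemma finer_ultra M (h h' : R) : weight_sequence M -> 0 < h -> 4 * h <= h' ->
  finer_factor (ultra_factor M h) (ultra_factor M h').
Proof.
move=> wsM h0 hh' k k0; exists (expR (assoc_fun M (4 * h * k))).
  exact: expR_gt0.
move=> n m; rewrite /ultra_factor.
have M0 := ws_gt0 wsM.
have h4 : 0 <= 4 * h by rewrite mulr_ge0// ltW.
have En := expR_assoc_fun_ge wsM n (mulr_ge0 h4 k0).
have Hm : (4 * h) ^+ m / M m <= h' ^+ m / M m.
  by rewrite ler_pM2r ?invr_gt0// lerXn2r ?nnegrE// (le_trans h4).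
apply: (@le_trans _ _ (((4 * h * k) ^+ n / M n) * ((4 * h) ^+ m / M m))); last first.
  rewrite ler_pM// ?divr_ge0 ?exprn_ge0 ?mulr_ge0// ?ltW//.
have -> : (4 * h * k) ^+ n / M n * ((4 * h) ^+ m / M m) =
   (4 * h) ^+ (n + m) * k ^+ n * (M n * M m)^-1.
  by rewrite exprMn exprD invfM; ring.
have -> : h ^+ (n + m) / M (n + m)%N * k ^+ n * 4 ^+ (n + m) =
   (4 * h) ^+ (n + m) * k ^+ n * (M (n + m)%N)^-1.
  by rewrite exprMn; ring.
rewrite ler_wpM2l ?mulr_ge0 ?exprn_ge0// lef_pV2 ?posrE ?mulr_gt0//.
exact: weight_superadditive.
Qed.

Lemma finer_order (k k' : nat) : (k <= k')%N ->
  finer_factor (order_factor k) (order_factor k').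
Proof.
move=> kk' q q0; exists ((1 + q) ^+ k * 4 ^+ k).
  by rewrite mulr_gt0 ?exprn_gt0// ltr_wpDr.
move=> n m; rewrite /order_factor; case: leqP => nmk; last first.
  by rewrite !mul0r mulr_ge0// mulr_ge0 ?exprn_ge0// addr_ge0.
rewrite mul1r (leq_trans (leq_trans (leq_addl _ _) nmk) kk') mulr1.
rewrite ler_pM ?exprn_ge0//; last by rewrite ler_weXn2l// ler1n.
apply: (@le_trans _ _ ((1 + q) ^+ n)).
  by rewrite lerXn2r ?nnegrE ?addr_ge0// lerDr.
by rewrite ler_weXn2l ?lerDl// (leq_trans (leq_addr _ _) nmk).
Qed.

(** The factor [H] absorbs 1 + |y|; the factor 2 comes from |y| <= 2 max (|y - x|, |x|). *)
Lemma finer_exp d A : weight_sequence A -> exists2 H : R, 1 <= H &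
  forall h h', 0 < h -> 2 * H * h <= h' ->
  finer_weight (@exp_weight d A h) (@exp_weight d A h').
Proof.
move=> wsA; have [C [H [C0 H1 CH]]] := expR_assoc_fun_absorb wsA.
exists H => // h h' h0 hh' B.
pose B' := Num.max B 0.
(* 1 + h^-1 trades 1 + |y| for 1 + h |y|; the last factor covers the points y with |y - x| <= B'. *)
pose K := (1 + h^-1) * C * expR (assoc_fun A (h' * B')).
have hi0 : 0 < h^-1 by rewrite invr_gt0.
have HI : 0 < 1 + h^-1 by rewrite addr_gt0.
exists K; first by rewrite !mulr_gt0// expR_gt0.
move=> x y xB; rewrite /exp_weight.
have y0 := enorm_ge0 y; have hy0 : 0 <= h * enorm y by rewrite mulr_ge0// ltW.
have B0 : 0 <= B' by rewrite le_max lexx orbT.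
have h'0 : 0 <= h'.
  by rewrite (le_trans _ hh')// !mulr_ge0//; [exact: le_trans ler01 H1|exact: ltW].
have H0 : 0 <= H by exact: le_trans H1.
apply: (@le_trans _ _ ((1 + h^-1) * (C * expR (assoc_fun A (H * (h * enorm y)))))).
  rewrite (le_trans _ (ler_wpM2l (ltW HI) (CH _ hy0)))// mulrA.
  have -> : (1 + h^-1) * (1 + h * enorm y) = (1 + enorm y) + (h^-1 + h * enorm y).
    by field; rewrite gt_eqF.
  by rewrite ler_wpM2r ?expR_ge0// lerDl addr_ge0// ltW.
rewrite /K -!mulrA; rewrite ler_wpM2l ?(ltW HI)// ler_wpM2l ?(ltW C0)//.
have E1 z : 0 <= z -> 1 <= expR (assoc_fun A z).
  by move=> z0; rewrite -expR0 ler_expR assoc_fun_ge0.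
have yx0 := enorm_ge0 (y - x).
have : H * (h * enorm y) <= h' * Num.max (enorm (y - x)) B'.
  apply: (@le_trans _ _ (2 * H * h * Num.max (enorm (y - x)) B')); last first.
    by rewrite ler_wpM2r// le_max yx0.
  rewrite -!mulrA [2 * _]mulrCA !mulrA -!mulrA ler_wpM2l// [2 * _]mulrCA ler_wpM2l ?(ltW h0)//.
  rewrite (le_trans (enorm_le_max x y))// ler_wpM2l// ge_max le_max lexx/=.
  by rewrite !le_max xB !orbT.
move=> /(expR_assoc_fun_mono wsA (mulr_ge0 H0 hy0)) /le_trans; apply.
case: (leP (enorm (y - x)) B') => _.
  by rewrite ler_peMr ?expR_ge0// E1// mulr_ge0.
by rewrite ler_peMl ?expR_ge0// E1// mulr_ge0.
Qed.

Lemma finer_power d (k k' : nat) : (k < k')%N ->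
  finer_weight (@power_weight d k) (@power_weight d k').
Proof.
move=> kk' B; pose B' := Num.max B 0.
have B0 : 0 <= B' by rewrite le_max lexx orbT.
exists ((2 * (1 + B')) ^+ k'); first by rewrite exprn_gt0// mulr_gt0// ltr_wpDr.
move=> x y xB; rewrite /power_weight -exprS -exprMn.
have y0 := enorm_ge0 y; have yx0 := enorm_ge0 (y - x).
apply: (@le_trans _ _ ((1 + enorm y) ^+ k')).
  by rewrite ler_weXn2l// lerDl.
rewrite lerXn2r ?nnegrE ?addr_ge0 ?mulr_ge0 ?addr_ge0//.
have := enorm_le_max x y.
have : Num.max (enorm (y - x)) (enorm x) <= enorm (y - x) + B'.
  have xB' : enorm x <= B' by rewrite (le_trans xB)// le_max lexx.
  by rewrite ge_max lerDl B0 (le_trans xB')// lerDr.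
nra.
Qed.

(** In a projective limit a bound for [s] is obtained from a bound for some finer [s']; in the
    inductive limit the function comes with its step [s'], and some coarser [s] has to receive the
    result. *)
Lemma finer_step d (c : gs_class R) : gs_admissible c ->
  if is_roumieu c
  then forall s', steps c s' -> exists2 s : step d, steps c s & finer s s'
  else forall s, steps c s -> exists2 s' : step d, steps c s' & finer s s'.
Proof.
have bnd (x : R) : exists2 n : nat, (0 < n)%N & x <= n%:R.
  exists (Num.bound `|x|).+1 => //; rewrite (le_trans (ler_norm _))//.
  by rewrite (le_trans (ltW (archi_boundP (normr_ge0 x))))// ler_nat.
case: c => [M A [wM wA]|M A [wM wA]|A wA|M wM|_] /=.
- have [H H1 HH] := finer_exp d wA.
  (* The factor [4 * H] is at least 4, as the derivatives require, and at least [2 * H], as the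
     weight requires. *)
  move=> _ [h /= h0 <-]; exists (ultra_factor M (4 * H * h), @exp_weight d A (4 * H * h)).
    by exists (4 * H * h) => //=; nra.
  by split; [apply: finer_ultra => //|apply: HH => //]; nra.
- have [H H1 HH] := finer_exp d wA.
  have H0 : 0 < H by lra.
  move=> _ [h /= h0 <-].
  have h'0 : 0 < (4 * H)^-1 * h by rewrite mulr_gt0// invr_gt0 mulr_gt0.
  have hE : h = 4 * H * ((4 * H)^-1 * h) by rewrite mulrA divff ?mul1r// gt_eqF// mulr_gt0.
  exists (ultra_factor M ((4 * H)^-1 * h), @exp_weight d A ((4 * H)^-1 * h)).
    by exists ((4 * H)^-1 * h).
  split; [apply: finer_ultra => //=|apply: HH => //=]; rewrite [leRHS]hE; nra.
- have [H H1 HH] := finer_exp d wA.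
  move=> _ [k /= k0 <-]; have [n n0 kn] := bnd (4 * H * k%:R).
  have k0' : 0 < k%:R :> R by rewrite ltr0n.
  exists (order_factor n, @exp_weight d A n%:R); first by exists n.
  split; [apply: finer_order|apply: HH => //=]; last by rewrite (le_trans _ kn)//; nra.
  by rewrite -(ler_nat R) (le_trans _ kn)//; nra.
- move=> _ [k /= k0 <-].
  exists (ultra_factor M (4 * k)%:R, @power_weight d (4 * k)).
    by exists (4 * k)%N => //=; rewrite muln_gt0.
  split; [apply: finer_ultra => //=|apply: finer_power => //=].
  + by rewrite ltr0n.
  + by rewrite natrM.
  + by rewrite ltn_Pmull.
- move=> _ [k /= k0 <-].
  exists (order_factor (4 * k)%N, @power_weight d (4 * k)).
    by exists (4 * k)%N => //=; rewrite muln_gt0.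
  split; [apply: finer_order => //=|apply: finer_power => //=].
  + by rewrite leq_pmull.
  + by rewrite ltn_Pmull.
Qed.

End growth.

(** * Norms, membership and seminorms in terms of real bounds *)

Section step_bounds.
Context (R : realType) (d : nat).
Implicit Types (c : gs_class R) (f g : Cfun R d) (s : step R d) (p : Cfun R d -> R).

(** A real bound in place of the extended norm, so that the supremum over multi-indices and points
    need not be formed. *)
Definition bounded_by s f (K : R) := forall (a : 'I_d -> nat) x,
  s.1 (mlength a) * (s.2 x * nrm (cderiv a f x)) <= K.

Let weighted_sup_le w (a : 'I_d -> nat) f (K : R) :
  (weighted_sup w a f <= K%:E)%E <-> forall x, w x * nrm (cderiv a f x) <= K.
Proof.
split=> [h x|h].
  by rewrite -lee_fin (le_trans _ h)//; apply: ereal_sup_ubound; exists x.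
by apply: ge_ereal_sup => _ [x _ <-]; rewrite lee_fin.
Qed.

Let ultra_norm_le M (h : R) w f (K : R) : weight_sequence M -> 0 < h ->
  (ultra_norm M h w f <= K%:E)%E <-> bounded_by (ultra_factor M h, w) f K.
Proof.
move=> wsM h0.
have co0 n : 0 < ultra_factor M h n.
  by rewrite divr_gt0 ?exprn_gt0//; exact: ws_gt0 wsM n.
have H a : ((ultra_factor M h (mlength a))%:E * weighted_sup w a f <= K%:E)%E <->
    forall x, ultra_factor M h (mlength a) * (w x * nrm (cderiv a f x)) <= K.
  rewrite -lee_pdivlMl// -EFinM; split.
    by move/weighted_sup_le => h' x; rewrite -ler_pdivlMl.
  by move=> h'; apply/weighted_sup_le => x; rewrite ler_pdivlMl.
split=> [h' a|h'].
  by apply/H; rewrite (le_trans _ h')//; apply: ereal_sup_ubound; exists a.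
by apply: ge_ereal_sup => _ [a _ <-]; apply/H => x; exact: h'.
Qed.

Lemma mlength0 : mlength (fun _ : 'I_d => 0%N) = 0%N.
Proof. by rewrite /mlength big1. Qed.

Let finite_order_norm_le k w f (K : R) : (forall x, 0 <= w x) ->
  (finite_order_norm k w f <= K%:E)%E <-> bounded_by (order_factor R k, w) f K.
Proof.
move=> w0; split=> [h a x|h].
  have H b : (mlength b <= k)%N -> forall x, w x * nrm (cderiv b f x) <= K.
    move=> bk; apply/weighted_sup_le; rewrite (le_trans _ h)//.
    by apply: ereal_sup_ubound; exists b.
  rewrite /= /order_factor; case: leqP => ak; first by rewrite mul1r H.
  rewrite mul0r; have := H (fun=> 0%N); rewrite mlength0 => /(_ isT x).
  by apply: le_trans; rewrite mulr_ge0// nrm_ge0.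
apply: ge_ereal_sup => _ [a /= ak <-]; apply/weighted_sup_le => x.
by have := h a x; rewrite /= /order_factor ak mul1r.
Qed.

Lemma steps_pos c s : gs_admissible c -> steps c s ->
  [/\ forall n, 0 <= s.1 n, 0 < s.1 0%N & forall x, 1 <= s.2 x].
Proof.
have co M (h : R) : weight_sequence M -> 0 < h ->
    (forall n, 0 <= ultra_factor M h n) /\ 0 < ultra_factor M h 0.
  move=> wM h0; have M0 := ws_gt0 wM.
  by split => [n|]; rewrite /ultra_factor ?divr_ge0 ?exprn_ge0 ?ltW// divr_gt0.
have we A (h : R) (x : 'rV[R]_d) : weight_sequence A -> 0 < h -> 1 <= exp_weight A h x.
  move=> wA h0; rewrite -expR0 ler_expR assoc_fun_ge0// mulr_ge0 ?enorm_ge0//.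
  exact: ltW.
have wp k (x : 'rV[R]_d) : 1 <= power_weight k x.
  by rewrite exprn_ege1// lerDl enorm_ge0.
case: c => [M A [wM wA]|M A [wM wA]|A wA|M wM|_] /= [h /= h0 <-] /=.
- by have [? ?] := co M h wM h0; split => // x; exact: we.
- by have [? ?] := co M h wM h0; split => // x; exact: we.
- split; [by move=> n; exact: ler0n|exact: ltr01|].
  by move=> x; apply: we => //; rewrite ltr0n.
- have hR : 0 < h%:R :> R by rewrite ltr0n.
  by have [? ?] := co M h%:R wM hR; split.
- by split; [move=> n; exact: ler0n|exact: ltr01|exact: wp].
Qed.

Lemma step_of_norm c N : gs_admissible c -> step_norms c N ->
  exists2 s, steps c s & forall f K, (N f <= K%:E)%E <-> bounded_by s f K.
Proof.
case: c => [M A [wM wA]|M A [wM wA]|A wA|M wM|_] /= [h /= h0 <-] /=.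
- exists (ultra_factor M h, @exp_weight R d A h); first by exists h.
  by move=> f K; exact: ultra_norm_le.
- exists (ultra_factor M h, @exp_weight R d A h); first by exists h.
  by move=> f K; exact: ultra_norm_le.
- exists (order_factor R h, @exp_weight R d A h%:R); first by exists h.
  by move=> f K; apply: finite_order_norm_le => x; exact: expR_ge0.
- exists (ultra_factor M h%:R, @power_weight R d h); first by exists h.
  by move=> f K; apply: ultra_norm_le => //; rewrite ltr0n.
- exists (order_factor R h, @power_weight R d h); first by exists h.
  move=> f K; apply: finite_order_norm_le => x.
  by rewrite exprn_ge0// addr_ge0 ?enorm_ge0.
Qed.

Lemma norm_of_step c s : gs_admissible c -> steps c s ->
  exists2 N, step_norms c N & forall f K, (N f <= K%:E)%E <-> bounded_by s f K.
Proof.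
case: c => [M A [wM wA]|M A [wM wA]|A wA|M wM|_] /= [h /= h0 <-] /=.
- eexists; first by exists h; [exact: h0|reflexivity].
  by move=> f K; exact: ultra_norm_le.
- eexists; first by exists h; [exact: h0|reflexivity].
  by move=> f K; exact: ultra_norm_le.
- eexists; first by exists h; [exact: h0|reflexivity].
  by move=> f K; apply: finite_order_norm_le => x; exact: expR_ge0.
- eexists; first by exists h; [exact: h0|reflexivity].
  by move=> f K; apply: ultra_norm_le => //; rewrite ltr0n.
- eexists; first by exists h; [exact: h0|reflexivity].
  move=> f K; apply: finite_order_norm_le => x.
  by rewrite exprn_ge0// addr_ge0 ?enorm_ge0.
Qed.

Lemma bounded_by_ge0 c s f K : gs_admissible c -> steps c s ->
  bounded_by s f K -> 0 <= K.
Proof.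
move=> adm cs /(_ (fun=> 0%N) 0); have [co0 _ w1] := steps_pos adm cs.
by apply: le_trans; rewrite mulr_ge0// mulr_ge0 ?nrm_ge0// (le_trans _ (w1 _)).
Qed.

Lemma gs_spaceP c f : gs_admissible c -> gs_space c f <->
  smooth f /\ if is_roumieu c then exists2 s, steps c s & exists K, bounded_by s f K
              else forall s, steps c s -> exists K, bounded_by s f K.
Proof.
move=> adm.
have fin (N : Cfun R d -> \bar R) : (N f < +oo)%E <-> exists K : R, (N f <= K%:E)%E.
  split; last by case=> K /le_lt_trans; apply; rewrite ltry.
  case: (N f) => [r _| |_]; [by exists r|by rewrite ltxx|].
  by exists 0; rewrite leNye.
rewrite /gs_space /=; case: ifP => rc; split => -[sf h]; split => //.
- have [N cN /fin[K NK]] := h; have [s cs sN] := step_of_norm adm cN.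
  by exists s => //; exists K; apply/sN.
- have [s cs [K sK]] := h; have [N cN sN] := norm_of_step adm cs.
  by exists N => //; apply/fin; exists K; apply/sN.
- move=> s cs; have [N cN sN] := norm_of_step adm cs.
  by have /fin[K NK] := h N cN; exists K; apply/sN.
- move=> N cN; have [s cs sN] := step_of_norm adm cN.
  by have [K sK] := h s cs; apply/fin; exists K; apply/sN.
Qed.

Lemma gs_seminorm_bound c p : gs_admissible c -> gs_continuous_seminorm c p ->
  let dominated s := exists2 C : R, 0 <= C &
    forall f K, gs_space c f -> bounded_by s f K -> p f <= C * K in
  if is_roumieu c then forall s, steps c s -> dominated s
  else exists2 s, steps c s & dominated s.
Proof.
move=> adm [_ h] dominated.
have dom N s K : step_norms c N -> steps c s ->
    (forall f K, (N f <= K%:E)%E <-> bounded_by s f K) ->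
    (forall f, gs_space c f -> (N f < +oo)%E -> ((p f)%:E <= K%:E * N f)%E) ->
    dominated s.
  move=> cN cs sN pN; exists `|K| => // f K' Sf sf.
  have NK' : (N f <= K'%:E)%E by apply/sN.
  have N0 : (0 <= N f)%E.
    case E : (N f) => [r| |] //.
      have : (N f <= r%:E)%E by rewrite E.
      by move/sN/(bounded_by_ge0 adm cs).
    have : (N f <= (-1)%:E)%E by rewrite E leNye.
    by move/sN/(bounded_by_ge0 adm cs); rewrite oppr_ge0 ler10.
  have := pN f Sf (le_lt_trans NK' (ltry _)).
  rewrite -lee_fin => /le_trans; apply; rewrite EFinM.
  apply: (@le_trans _ _ (`|K|%:E * N f)%E).
    by apply: lee_wpmul2r => //; rewrite lee_fin ler_norm.
  by apply: lee_wpmul2l.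
case: ifP h => rc h.
  move=> s cs; have [N cN sN] := norm_of_step adm cs.
  by have [K pK] := h N cN; exact: dom cN cs sN pK.
have [N cN [K pK]] := h; have [s cs sN] := step_of_norm adm cN.
by exists s => //; exact: dom cN cs sN pK.
Qed.

End step_bounds.

(** * Smooth functions, translations and modulations *)

Section directional_derivatives.
Context (R : realType) (d : nat).
Local Notation V := 'rV[R]_d.
Implicit Types (f g : V -> R) (x y eta : V) (i : 'I_d).

(** The difference quotients at [x] in direction [v] and those of the restriction to the line at 0
    coincide, so partial derivatives are computed by one-variable calculus. *)
Lemma is_derive_line f x (v : V) (df : R) :
  is_derive (0 : R) 1 (fun h : R => f (h *: v + x)) df -> is_derive x v f df.
Proof.
move=> [dv de].
have E : (fun h : R => h^-1 *: (((fun k : R => f (k *: v + x)) \o shift (0 : R)) (h *: 1)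
     - f (0 *: v + x))) = (fun h : R => h^-1 *: ((f \o shift x) (h *: v) - f x)).
  by apply/funext => h; rewrite /= scale0r add0r addr0 scaler1.
split; first by move: dv; rewrite /derivable E.
by rewrite -de /derive E.
Qed.

Lemma line_is_derive f x (v : V) : derivable f x v ->
  is_derive (0 : R) 1 (fun h : R => f (h *: v + x)) ('D_v f x).
Proof.
move=> dv.
have E : (fun h : R => h^-1 *: (((fun k : R => f (k *: v + x)) \o shift (0 : R)) (h *: 1)
     - f (0 *: v + x))) = (fun h : R => h^-1 *: ((f \o shift x) (h *: v) - f x)).
  by apply/funext => h; rewrite /= scale0r add0r addr0 scaler1.
by split; rewrite /derivable /derive E.
Qed.

Lemma derivable_translate f x y (v : V) :
  (derivable (fun z : V => f (z - y)) x v <-> derivable f (x - y) v) /\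
  'D_v (fun z : V => f (z - y)) x = 'D_v f (x - y).
Proof.
have E : (fun h : R => h^-1 *: (((fun z : V => f (z - y)) \o shift x) (h *: v) - f (x - y))) =
   (fun h : R => h^-1 *: ((f \o shift (x - y)) (h *: v) - f (x - y))).
  by apply/funext => h; rewrite /= addrA.
by split; rewrite /derivable /derive E.
Qed.

Lemma is_CkW k f : is_Ck k.+1 f -> is_Ck k f.
Proof.
elim: k f => [|k IH] f; first by case.
move=> [cf df]; split => // i; have [di Ci] := df i; split => //; exact: IH.
Qed.

Lemma continuous_translate f y : continuous f -> continuous (fun z : V => f (z - y)).
Proof.
move=> cf z; apply: (@continuous_comp _ _ _ (fun u : V => u - y) f); last exact: cf.
exact: cvgB cvg_id (cvg_cst _).
Qed.

Lemma is_Ck_translate k f y : is_Ck k f -> is_Ck k (fun z : V => f (z - y)).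
Proof.
elim: k f => [|k IH] f; first exact: continuous_translate.
move=> [cf df]; split; first exact: continuous_translate.
move=> i; have [di Ci] := df i; split.
  by move=> x; apply/(derivable_translate f x y 'e_i).1; exact: di.
rewrite (_ : (fun x => _) = (fun x => 'D_('e_i) f (x - y))).
  exact: (IH (fun z => 'D_('e_i) f z)).
by apply/funext => x; rewrite (derivable_translate f x y 'e_i).2.
Qed.

Lemma continuous_lin (a b : R) f g : continuous f -> continuous g ->
  continuous (fun x => a * f x + b * g x).
Proof.
move=> cf cg x; apply: (@continuousD _ _ _ (fun x => a * f x) (fun x => b * g x)).
  by apply: continuousM; [exact: cst_continuous|exact: cf].
by apply: continuousM; [exact: cst_continuous|exact: cg].
Qed.

Lemma is_derive_lin (a b : R) f g x (v : V) df dg :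
  is_derive x v f df -> is_derive x v g dg ->
  is_derive x v (fun x => a * f x + b * g x) (a * df + b * dg).
Proof.
move=> Df Dg.
exact: is_deriveD (is_deriveZ a Df) (is_deriveZ b Dg).
Qed.

Lemma is_Ck_lin k (a b : R) f g : is_Ck k f -> is_Ck k g ->
  is_Ck k (fun x => a * f x + b * g x).
Proof.
elim: k f g => [|k IH] f g; first exact: continuous_lin.
move=> [cf df] [cg dg]; split; first exact: continuous_lin.
move=> i; have [di Ci] := df i; have [di' Ci'] := dg i.
have D x := is_derive_lin a b (derivableP (di x)) (derivableP (di' x)).
split=> [x|]; first by have [] := D x.
rewrite (_ : (fun x => _) = (fun x => a * 'D_('e_i) f x + b * 'D_('e_i) g x)).
  exact: (IH (fun z => 'D_('e_i) f z) (fun z => 'D_('e_i) g z)).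
by apply/funext => x; have [] := D x.
Qed.

Lemma continuous_bigsum (I : Type) (r : seq I) (F : I -> V -> R) :
  (forall k, continuous (F k)) -> continuous (fun x => \sum_(k <- r) F k x).
Proof.
move=> cF x; elim: r => [|k r IH].
  by under eq_fun do rewrite big_nil; exact: cst_continuous.
under eq_fun do rewrite big_cons.
by apply: (@continuousD _ _ _ (F k) (fun x => \sum_(j <- r) F j x)) IH; exact: cF.
Qed.

Lemma continuous_dotv eta : continuous (dotv eta).
Proof.
apply: continuous_bigsum => i x.
by apply: continuousM; [exact: cst_continuous|exact: coord_continuous].
Qed.

Lemma dotv_line eta x i (h : R) : dotv eta (h *: 'e_i + x) = h * eta 0 i + dotv eta x.
Proof.
rewrite /dotv (bigD1 i)//= [in RHS](bigD1 i)//= !mxE !eqxx/= mulr1 mulrDr addrA.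
rewrite [h * _]mulrC; congr (_ + _); apply: eq_bigr => j ji.
by rewrite !mxE (negbTE ji)/= mulr0 add0r.
Qed.

(** Real form of the multiplication by e^(i l(x)): the real part of the product is the rotation of
    (Re, -Im), the imaginary part that of (Im, Re). *)
Definition rotate (l : V -> R) f g x := cos (l x) * f x + sin (l x) * g x.

Lemma continuous_rotate eta f g : continuous f -> continuous g ->
  continuous (rotate (dotv eta) f g).
Proof.
move=> cf cg x; have cl := @continuous_dotv eta.
apply: (@continuousD _ _ _ (fun x => cos (dotv eta x) * f x) (fun x => sin (dotv eta x) * g x)).
  apply: continuousM; last exact: cf.
  by apply: (@continuous_comp _ _ _ (dotv eta) cos); [exact: cl|exact: continuous_cos].
apply: continuousM; last exact: cg.
by apply: (@continuous_comp _ _ _ (dotv eta) sin); [exact: cl|exact: continuous_sin].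
Qed.

Lemma is_derive_rotate eta f g x i df dg :
  is_derive x 'e_i f df -> is_derive x 'e_i g dg ->
  is_derive x 'e_i (rotate (dotv eta) f g)
    (rotate (dotv eta) (fun=> 1 * df + eta 0 i * g x) (fun=> 1 * dg + (- eta 0 i) * f x) x).
Proof.
move=> [Df <-] [Dg <-]; apply: is_derive_line.
have lf := line_is_derive Df; have lg := line_is_derive Dg.
pose l (h : R) := h * eta 0 i + dotv eta x.
have Dl : is_derive (0 : R) 1 l (eta 0 i).
  have -> : l = (eta 0 i \*: (id : R -> R)) + cst (dotv eta x).
    by apply/funext => h; rewrite /l /= /GRing.scale/= mulrC.
  apply: is_derive_eq; rewrite addr0; exact: mulr1.
have Dc : is_derive (0 : R) 1 (cos \o l) (- sin (l 0) * eta 0 i).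
  by apply: is_derive1_comp.
have Ds : is_derive (0 : R) 1 (sin \o l) (cos (l 0) * eta 0 i).
  by apply: is_derive1_comp.
have := is_deriveD (is_deriveM Dc lf) (is_deriveM Ds lg).
have -> : (fun h : R => rotate (dotv eta) f g (h *: 'e_i + x)) =
   (cos \o l) * (fun h : R => f (h *: 'e_i + x)) + (sin \o l) * (fun h : R => g (h *: 'e_i + x)).
  by apply/funext => h; rewrite /rotate dotv_line.
move/is_derive_eq; apply.
rewrite /rotate /= /l !mul0r !add0r !scale0r !add0r /GRing.scale/=.
by ring.
Qed.

(** A partial derivative of a rotation is a rotation of linear combinations of the functions and
    their derivatives, so the induction on [k] stays within this form. *)
Lemma is_Ck_rotate k eta f g : is_Ck k f -> is_Ck k g ->
  is_Ck k (rotate (dotv eta) f g).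
Proof.
elim: k f g => [|k IH] f g; first exact: continuous_rotate.
move=> Cf Cg; have [cf df] := Cf; have [cg dg] := Cg.
split; first exact: continuous_rotate.
move=> i; have [di Ci] := df i; have [di' Ci'] := dg i.
have D x := is_derive_rotate eta (derivableP (di x)) (derivableP (di' x)).
split=> [x|]; first by have [] := D x.
rewrite (_ : (fun x => _) = rotate (dotv eta)
  (fun x => 1 * 'D_('e_i) f x + eta 0 i * g x)
  (fun x => 1 * 'D_('e_i) g x + (- eta 0 i) * f x)).
  by apply: IH; apply: is_Ck_lin => //; exact: is_CkW.
by apply/funext => x; have [] := D x.
Qed.

End directional_derivatives.

(** * Words of partial derivatives *)

Section complex_derivatives.
Context (R : realType) (d : nat).
Local Notation V := 'rV[R]_d.
Implicit Types (f g : Cfun R d) (x y : V) (i : 'I_d) (W U : seq 'I_d).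

Definition cpartial i f : Cfun R d := fun x =>
  ('D_('e_i) (fun y => complex.Re (f y)) x +i* 'D_('e_i) (fun y => complex.Im (f y)) x)%C.

(** Derivatives are indexed by words: deleting letters describes the Leibniz rule for a modulation,
    and partial derivatives need never be commuted. *)
Definition cwderiv W f : Cfun R d := foldr cpartial f W.

Definition multi_word (e : seq 'I_d) (a : 'I_d -> nat) : seq 'I_d :=
  flatten [seq nseq (a i) i | i <- e].

Lemma cderiv_word a f : cderiv a f = cwderiv (multi_word (enum 'I_d) a) f.
Proof.
pose D (i : 'I_d) (h : V -> R) := iter (a i) (fun (r : V -> R) x => 'D_('e_i) r x) h.
have -> : cderiv a f = fun x => (foldr D (fun y => complex.Re (f y)) (enum 'I_d) x +i*
    foldr D (fun y => complex.Im (f y)) (enum 'I_d) x)%C by [].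
rewrite /multi_word; elim: (enum 'I_d) => [|i e IH] /=.
  by apply/funext => x; rewrite -complex_eta.
rewrite /cwderiv foldr_cat -[foldr _ _ (flatten _)]/(cwderiv (flatten [seq nseq (a j) j | j <- e]) f) -IH.
rewrite /D; elim: (a i) => [//|n IHn]; apply/funext => x /=.
by rewrite -IHn.
Qed.

Lemma size_multi_word a : size (multi_word (enum 'I_d) a) = mlength a.
Proof.
rewrite /multi_word size_flatten /shape -map_comp sumnE big_map /mlength big_enum.
by apply: eq_bigr => i _ /=; rewrite size_nseq.
Qed.

(** A subword of a word grouped by coordinate is grouped in the same order, hence comes from a
    multi-index; this brings the terms of the Leibniz rule back to [cderiv]. *)
Lemma subseq_multi_word (e : seq 'I_d) a W : uniq e ->
  subseq W (multi_word e a) -> exists b, W = multi_word e b.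
Proof.
elim: e W => [|i e IH] W /=.
  by move=> _; rewrite /multi_word/= => /eqP ->; exists a.
move=> /andP[ie ue] /subseqP[m]; rewrite size_cat => sm.
rewrite -(cat_take_drop (size (nseq (a i) i)) m) mask_cat; last first.
  by rewrite size_takel// sm leq_addr.
set W1 := mask _ (nseq _ _); set W2 := mask _ (flatten _) => ->.
have [b ->] : exists b, W2 = multi_word e b.
  by apply: IH => //; exact: mask_subseq.
have -> : W1 = nseq (size W1) i.
  by apply/all_pred1P/allP => j /mem_mask; rewrite mem_nseq => /andP[_ /eqP ->] /=.
exists (fun j => if j == i then size W1 else b j); rewrite /multi_word /= eqxx.
congr (_ ++ flatten _); apply/eq_in_map => j je; case: eqP => // ji.
by rewrite ji (negbTE ie) in je.
Qed.

Lemma subseq_cwderiv a W f : subseq W (multi_word (enum 'I_d) a) ->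
  exists2 b, cwderiv W f = cderiv b f & mlength b = size W.
Proof.
move=> /(subseq_multi_word (enum_uniq _))[b ->]; exists b; first by rewrite cderiv_word.
by rewrite size_multi_word.
Qed.

End complex_derivatives.

Section smooth_functions.
Context (R : realType) (d : nat).
Local Notation V := 'rV[R]_d.
Implicit Types (f g : Cfun R d) (x y xi eta : V) (i : 'I_d) (W U : seq 'I_d).

Lemma smooth_derivable f i x : smooth f ->
  derivable (fun y => complex.Re (f y)) x 'e_i /\
  derivable (fun y => complex.Im (f y)) x 'e_i.
Proof. by move=> /(_ 1%N)[[_ /(_ i)[r _]] [_ /(_ i)[j _]]]. Qed.

Lemma smooth_continuous f : smooth f ->
  continuous (fun y => complex.Re (f y)) /\ continuous (fun y => complex.Im (f y)).
Proof. by move=> /(_ 0%N). Qed.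

Lemma smooth_lin (a : R[i]) f g : smooth f -> smooth g ->
  smooth (fun x => a * f x + g x).
Proof.
move=> sf sg k; have [rf jf] := sf k; have [rg jg] := sg k; split.
  have := is_Ck_lin 1 1 (is_Ck_lin (complex.Re a) (- complex.Im a) rf jf) rg.
  by congr is_Ck; apply/funext => x; rewrite !ReImE; ring.
have := is_Ck_lin 1 1 (is_Ck_lin (complex.Re a) (complex.Im a) jf rf) jg.
by congr is_Ck; apply/funext => x; rewrite !ReImE; ring.
Qed.

Lemma smooth_cpartial f i : smooth f -> smooth (cpartial i f).
Proof. by move=> sf k; have [[_ /(_ i)[_ r]] [_ /(_ i)[_ j]]] := sf k.+1. Qed.

Lemma smooth_cwderiv f W : smooth f -> smooth (cwderiv W f).
Proof. by move=> sf; elim: W => //= i W IH; exact: smooth_cpartial. Qed.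

Lemma cpartial_lin (a : R[i]) f g i : smooth f -> smooth g ->
  cpartial i (fun x => a * f x + g x) = fun x => a * cpartial i f x + cpartial i g x.
Proof.
move=> sf sg; apply/funext => x.
have [/derivableP rf /derivableP jf] := smooth_derivable i x sf.
have [/derivableP rg /derivableP jg] := smooth_derivable i x sg.
have [_ e1] := is_derive_lin 1 1 (is_derive_lin (complex.Re a) (- complex.Im a) rf jf) rg.
have [_ e2] := is_derive_lin 1 1 (is_derive_lin (complex.Re a) (complex.Im a) jf rf) jg.
apply: complex_eqP; rewrite !ReImE/=.
  rewrite (_ : (fun y => _) = (fun y => 1 * (complex.Re a * complex.Re (f y) +
    - complex.Im a * complex.Im (f y)) + 1 * complex.Re (g y))).
    by rewrite e1; ring.
  by apply/funext => y; rewrite !ReImE; ring.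
rewrite (_ : (fun y => _) = (fun y => 1 * (complex.Re a * complex.Im (f y) +
  complex.Im a * complex.Re (f y)) + 1 * complex.Im (g y))).
  by rewrite e2; ring.
by apply/funext => y; rewrite !ReImE; ring.
Qed.

Lemma cwderiv_lin (a : R[i]) f g W : smooth f -> smooth g ->
  cwderiv W (fun x => a * f x + g x) = fun x => a * cwderiv W f x + cwderiv W g x.
Proof.
move=> sf sg; elim: W => [//|i W IH] /=.
by rewrite IH cpartial_lin//; exact: smooth_cwderiv.
Qed.

Lemma cderiv_lin (a : R[i]) f g b : smooth f -> smooth g ->
  cderiv b (fun x => a * f x + g x) = fun x => a * cderiv b f x + cderiv b g x.
Proof. by move=> sf sg; rewrite !cderiv_word cwderiv_lin. Qed.

Lemma smooth_translate f x : smooth f -> smooth (translate x f).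
Proof.
by move=> sf k; have [r j] := sf k; split; [exact: (is_Ck_translate x r)|
  exact: (is_Ck_translate x j)].
Qed.

Lemma cpartial_translate f x i : cpartial i (translate x f) = translate x (cpartial i f).
Proof.
apply/funext => y; rewrite /cpartial /translate.
by rewrite (derivable_translate (fun z => complex.Re (f z)) y x 'e_i).2
  (derivable_translate (fun z => complex.Im (f z)) y x 'e_i).2.
Qed.

Lemma cwderiv_translate f x W : cwderiv W (translate x f) = translate x (cwderiv W f).
Proof. by elim: W => //= i W ->; rewrite cpartial_translate. Qed.

Lemma dotvZ (a : R) xi x : dotv (a *: xi) x = a * dotv xi x.
Proof. by rewrite /dotv mulr_sumr; apply: eq_bigr => i _; rewrite mxE mulrA. Qed.

Let Re_modulate f xi : (fun y => complex.Re (modulate xi f y)) =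
  rotate (dotv ((2 * pi) *: xi)) (fun y => complex.Re (f y))
    (fun y => (-1) * complex.Im (f y) + 0 * complex.Im (f y)).
Proof. by apply/funext => y; rewrite /modulate /rotate dotvZ Re_mul /=; ring. Qed.

Let Im_modulate f xi : (fun y => complex.Im (modulate xi f y)) =
  rotate (dotv ((2 * pi) *: xi)) (fun y => complex.Im (f y)) (fun y => complex.Re (f y)).
Proof. by apply/funext => y; rewrite /modulate /rotate dotvZ Im_mul. Qed.

Lemma smooth_modulate f xi : smooth f -> smooth (modulate xi f).
Proof.
move=> sf k; have [r j] := sf k; rewrite Re_modulate Im_modulate.
by split; apply: is_Ck_rotate => //; exact: is_Ck_lin.
Qed.

(* Modulation by e^(i eta.x) conjugates the partial derivative into this operator. *)
Definition mpartial eta i f : Cfun R d :=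
  fun y => (0 +i* eta 0 i)%C * f y + cpartial i f y.

Definition mwderiv eta W f : Cfun R d := foldr (mpartial eta) f W.

Lemma smooth_mwderiv eta W f : smooth f -> smooth (mwderiv eta W f).
Proof.
move=> sf; elim: W => //= i W IH; apply: smooth_lin => //; exact: smooth_cpartial.
Qed.

Lemma cpartial_modulate f xi i : smooth f ->
  cpartial i (modulate xi f) = modulate xi (mpartial ((2 * pi) *: xi) i f).
Proof.
move=> sf; apply/funext => x.
have [/derivableP rf /derivableP jf] := smooth_derivable i x sf.
have nj := is_derive_lin (-1) 0 jf jf.
have [_ e1] := is_derive_rotate ((2 * pi) *: xi) rf nj.
have [_ e2] := is_derive_rotate ((2 * pi) *: xi) jf rf.
rewrite /cpartial Re_modulate Im_modulate e1 e2 /modulate /mpartial /rotate dotvZ.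
by apply: complex_eqP; rewrite !ReImE/=; ring.
Qed.

Lemma cwderiv_modulate f xi W : smooth f ->
  cwderiv W (modulate xi f) = modulate xi (mwderiv ((2 * pi) *: xi) W f).
Proof.
move=> sf; elim: W => //= i W ->; rewrite cpartial_modulate//.
exact: smooth_mwderiv.
Qed.

Lemma nrm_i (a : R) : nrm (0 +i* a)%C = `|a|.
Proof. by rewrite nrmC_def/= expr0n add0r sqrtr_sqr. Qed.

(** Each letter of [W] either contributes a factor i eta_i, of modulus at most [k], or is passed on
    to the outer word [U]. Two choices per letter give [2 ^+ size W], and the terms are derivatives
    along subwords [Z] with one [k] for every missing letter. *)
Lemma mwderiv_bound eta (k t X : R) W U f y : smooth f ->
  (forall i, `|eta 0 i| <= k) -> 0 <= k -> 0 <= t ->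
  (forall Z, subseq Z (U ++ W) ->
     t * k ^+ (size U + size W - size Z) * nrm (cwderiv Z f y) <= X) ->
  t * nrm (cwderiv U (mwderiv eta W f) y) <= 2 ^+ size W * X.
Proof.
move=> sf ek k0; elim: W U t => [|i W IH] U t t0 H.
  rewrite expr0 mul1r /= (le_trans _ (H U _)) ?cats0// addn0 subnn mulr1//.
have sW := smooth_mwderiv eta W sf.
rewrite /= cwderiv_lin//; last exact: smooth_cpartial.
have h1 : t * nrm (cwderiv (rcons U i) (mwderiv eta W f) y) <= 2 ^+ size W * X.
  apply: IH => // Z; rewrite cat_rcons => sZ; rewrite size_rcons.
  by have := H Z sZ; rewrite /= addnS addSn.
have h2 : t * k * nrm (cwderiv U (mwderiv eta W f) y) <= 2 ^+ size W * X.
  apply: IH => [|Z sZ]; first exact: mulr_ge0.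
  have sZ' : subseq Z (U ++ i :: W).
    by apply: subseq_trans sZ _; apply: cat_subseq => //; exact: subseq_cons.
  have := H Z sZ'; rewrite /= addnS subSn ?exprS//.
    by rewrite !mulrA.
  by have := size_subseq sZ; rewrite size_cat.
have -> : cwderiv U (cpartial i (mwderiv eta W f)) = cwderiv (rcons U i) (mwderiv eta W f).
  by rewrite /cwderiv foldr_rcons.
rewrite exprS mulrDl mul1r mulrDl; rewrite (le_trans (ler_wpM2l t0 (nrm_triangle _ _)))//.
rewrite mulrDr lerD// nrmM nrm_i (le_trans _ h2)// -mulrA ler_wpM2l//.
by rewrite ler_wpM2r ?nrm_ge0.
Qed.

Definition jointly_continuous (F : V -> V -> R[i]) :=
  continuous (fun p : V * V => complex.Re (F p.1 p.2)) /\
  continuous (fun p : V * V => complex.Im (F p.1 p.2)).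

Lemma jointly_continuousD F G : jointly_continuous F -> jointly_continuous G ->
  jointly_continuous (fun x y => F x y + G x y).
Proof.
move=> [rF jF] [rG jG]; split => p.
  under eq_fun do rewrite Re_add.
  by apply: continuousD; [exact: rF|exact: rG].
under eq_fun do rewrite Im_add.
by apply: continuousD; [exact: jF|exact: jG].
Qed.

Lemma jointly_continuousM F G : jointly_continuous F -> jointly_continuous G ->
  jointly_continuous (fun x y => F x y * G x y).
Proof.
move=> [rF jF] [rG jG]; split => p.
  under eq_fun do rewrite Re_mul.
  apply: (@continuousB _ _ _ (fun p : V * V => complex.Re (F p.1 p.2) * complex.Re (G p.1 p.2))
    (fun p : V * V => complex.Im (F p.1 p.2) * complex.Im (G p.1 p.2))).
    by apply: continuousM; [exact: rF|exact: rG].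
  by apply: continuousM; [exact: jF|exact: jG].
under eq_fun do rewrite Im_mul.
apply: (@continuousD _ _ _ (fun p : V * V => complex.Re (F p.1 p.2) * complex.Im (G p.1 p.2))
  (fun p : V * V => complex.Im (F p.1 p.2) * complex.Re (G p.1 p.2))).
  by apply: continuousM; [exact: rF|exact: jG].
by apply: continuousM; [exact: jF|exact: rG].
Qed.

Lemma jointly_continuous_snd f : smooth f -> jointly_continuous (fun _ y => f y).
Proof.
move=> /smooth_continuous[r j]; split => p.
  by apply: (@continuous_comp _ _ _ (@snd V V) (fun y => complex.Re (f y)));
    [exact: cvg_snd|exact: r].
by apply: (@continuous_comp _ _ _ (@snd V V) (fun y => complex.Im (f y)));
    [exact: cvg_snd|exact: j].
Qed.

Lemma jointly_continuous_translate f : smooth f ->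
  jointly_continuous (fun x y => translate x f y).
Proof.
move=> /smooth_continuous[r j].
have cs : continuous (fun p : V * V => p.2 - p.1).
  by move=> p; apply: cvgB; [exact: cvg_snd|exact: cvg_fst].
split => p.
  by apply: (@continuous_comp _ _ _ (fun p : V * V => p.2 - p.1) (fun y => complex.Re (f y)));
    [exact: cs|exact: r].
by apply: (@continuous_comp _ _ _ (fun p : V * V => p.2 - p.1) (fun y => complex.Im (f y)));
    [exact: cs|exact: j].
Qed.

Lemma continuous_pair_bigsum (I : Type) (r : seq I) (F : I -> V * V -> R) :
  (forall k, continuous (F k)) -> continuous (fun q : V * V => \sum_(k <- r) F k q).
Proof.
move=> cF q; elim: r => [|k r IH].
  by under eq_fun do rewrite big_nil; exact: cst_continuous.
under eq_fun do rewrite big_cons.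
by apply: (@continuousD _ _ _ (F k) (fun q => \sum_(j <- r) F j q)) IH; exact: cF.
Qed.

Let continuous_coord1 i : continuous (fun p : V * V => p.1 0 i).
Proof.
move=> p; apply: (@continuous_comp _ _ _ (@fst V V) (fun x : V => x 0 i)).
  exact: cvg_fst.
exact: coord_continuous.
Qed.

Let continuous_coord2 i : continuous (fun p : V * V => p.2 0 i).
Proof.
move=> p; apply: (@continuous_comp _ _ _ (@snd V V) (fun x : V => x 0 i)).
  exact: cvg_snd.
exact: coord_continuous.
Qed.

Lemma jointly_continuous_cis (a : R) :
  jointly_continuous (fun x y => cis (a * dotv x y)).
Proof.
have cd : continuous (fun p : V * V => a * dotv p.1 p.2).
  move=> p; apply: (@continuousM _ _ (cst a) (fun p : V * V => dotv p.1 p.2)).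
    exact: cst_continuous.
  apply: continuous_pair_bigsum => i q.
  apply: (@continuousM _ _ (fun p : V * V => p.1 0 i) (fun p : V * V => p.2 0 i)).
    exact: continuous_coord1.
  exact: continuous_coord2.
split => p /=.
  by apply: (@continuous_comp _ _ _ (fun p : V * V => a * dotv p.1 p.2) cos);
    [exact: cd|exact: continuous_cos].
by apply: (@continuous_comp _ _ _ (fun p : V * V => a * dotv p.1 p.2) sin);
    [exact: cd|exact: continuous_sin].
Qed.

Lemma jointly_continuous_modulate f W : smooth f ->
  jointly_continuous (fun x y => cwderiv W (modulate x f) y).
Proof.
move=> sf.
have -> : (fun x y => cwderiv W (modulate x f) y) =
    (fun x y => cis (2 * pi * dotv x y) * mwderiv ((2 * pi) *: x) W f y).
  by apply/funext => x; rewrite cwderiv_modulate.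
apply: jointly_continuousM (jointly_continuous_cis _) _.
have H U : jointly_continuous (fun x y => cwderiv U (mwderiv ((2 * pi) *: x) W f) y).
  elim: W U => [|i W IH] U; first exact: jointly_continuous_snd (smooth_cwderiv U sf).
  have -> : (fun x y => cwderiv U (mwderiv ((2 * pi) *: x) (i :: W) f) y) =
      (fun x y => (0 +i* (2 * pi * x 0 i))%C * cwderiv U (mwderiv ((2 * pi) *: x) W f) y
         + cwderiv (rcons U i) (mwderiv ((2 * pi) *: x) W f) y).
    apply/funext => x; have sW := smooth_mwderiv ((2 * pi) *: x) W sf.
    rewrite /= cwderiv_lin//; last exact: smooth_cpartial.
    by rewrite mxE /cwderiv foldr_rcons.
  apply: jointly_continuousD (IH _); apply: jointly_continuousM (IH _).
  split => p /=; first exact: cst_continuous.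
  apply: (@continuousM _ _ (cst (2 * pi)) (fun p : V * V => p.1 0 i)).
    exact: cst_continuous.
  exact: continuous_coord1.
exact: (H [::]).
Qed.

End smooth_functions.

(** * Continuity of translations and modulations in the step norms *)

Section families.
Context (R : realType) (d : nat).
Local Notation V := 'rV[R]_d.
Implicit Types (c : gs_class R) (f g : Cfun R d) (s : step R d) (x y : V).
Implicit Types (U : V -> Cfun R d -> Cfun R d).

Definition positive_step s := (forall n, 0 <= s.1 n) /\ (forall x, 1 <= s.2 x).

(** Common to translations and modulations. The bound exceeds that of the step by 2^|a| (1 + |y|),
    which makes the contribution of high orders and of distant points small, uniformly for [x] in a
    ball. *)
Definition locally_bounded_family U :=
  forall s s', positive_step s -> positive_step s' -> finer s s' ->
  forall f K B, smooth f -> bounded_by s' f K -> exists C, forall x, enorm x <= B ->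
  forall a y, s.1 (mlength a) * 2 ^+ mlength a * ((1 + enorm y) * s.2 y) *
              nrm (cderiv a (U x f) y) <= C.

Definition admissible_family U :=
  [/\ forall x f, smooth f -> smooth (U x f),
      forall a f, smooth f -> jointly_continuous (fun x y => cderiv a (U x f) y) &
      locally_bounded_family U].

Lemma translate_family : admissible_family (@translate R d).
Proof.
split.
- by move=> x f; exact: smooth_translate.
- move=> a f sf; rewrite (_ : (fun x y => _) = fun x y => translate x (cderiv a f) y).
    by apply: jointly_continuous_translate; rewrite cderiv_word; exact: smooth_cwderiv.
  by apply/funext => x; rewrite !cderiv_word cwderiv_translate.
- move=> s s' [s0 s1] [s0' s1'] [fco fwt] f K B sf bf.
  (* A translation does not mix orders: [k] is 0 and only n = 0 is used, where [k ^+ n] is 1. *)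
  have [C1 C10 co] := fco 0 (lexx _).
  have [C2 C20 wt] := fwt B.
  exists (C1 * C2 * K) => x xB a y.
  rewrite cderiv_word cwderiv_translate -cderiv_word /translate.
  have := bf a (y - x); set n := mlength a; set D := nrm _ => bD.
  have D0 : 0 <= D by exact: nrm_ge0.
  have h1 : s.1 n * 2 ^+ n <= C1 * s'.1 n.
    have := co 0%N n; rewrite add0n expr0 mulr1; apply: le_trans.
    by rewrite ler_wpM2l// lerXn2r ?nnegrE// ler_nat.
  have h2 := wt x y xB.
  have y0 : 0 <= (1 + enorm y) * s.2 y.
    by rewrite mulr_ge0 ?addr_ge0 ?enorm_ge0// (le_trans _ (s1 _)).
  have z0 : 0 <= s.1 n * 2 ^+ n by rewrite mulr_ge0 ?exprn_ge0.
  rewrite (le_trans (ler_wpM2r D0 (ler_pM z0 y0 h1 h2)))//.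
  rewrite (_ : _ * D = C1 * C2 * (s'.1 n * (s'.2 (y - x) * D))); last by ring.
  by rewrite ler_wpM2l// mulr_ge0// ltW.
Qed.

Lemma modulate_family : admissible_family (@modulate R d).
Proof.
split.
- by move=> x f; exact: smooth_modulate.
- move=> a f sf; rewrite (_ : (fun x y => _) =
    fun x y => cwderiv (multi_word (enum 'I_d) a) (modulate x f) y).
    exact: jointly_continuous_modulate.
  by apply/funext => x; rewrite cderiv_word.
- move=> s s' [s0 s1] [s0' s1'] [fco fwt] f K B sf bf.
  have [B0|B0] := ltP B 0.
    by exists 0 => x xB; have := le_lt_trans (enorm_ge0 x) (le_lt_trans xB B0); rewrite ltxx.
  (* Bounds the coordinates of 2 pi x for |x| <= B, the factors produced by differentiating the
     character. *)
  pose k := 2 * pi * B.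
  have k0 : 0 <= k by rewrite mulr_ge0// mulr_ge0// pi_ge0.
  have [C1 C10 co] := fco k k0.
  have [C2 C20 wt] := fwt 0.
  exists (C1 * C2 * K) => x xB a y.
  set W := multi_word (enum 'I_d) a.
  rewrite cderiv_word cwderiv_modulate// /modulate nrmM nrm_cis mul1r -/W.
  have sW : size W = mlength a := size_multi_word a.
  set n := mlength a.
  have y0 : 0 <= (1 + enorm y) * s.2 y.
    by rewrite mulr_ge0 ?addr_ge0 ?enorm_ge0// (le_trans _ (s1 _)).
  have h2 : (1 + enorm y) * s.2 y <= C2 * s'.2 y.
    have := wt 0 y; rewrite subr0; apply.
    by rewrite /enorm /dotv big1 ?sqrtr0// => i _; rewrite mxE mul0r.
  have := @mwderiv_bound R d ((2 * pi) *: x) k (s.1 n * 4 ^+ n * ((1 + enorm y) * s.2 y))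
    (C1 * C2 * K) W [::] f y sf _ k0 _ _.
  move=> H; have {H} : s.1 n * 4 ^+ n * ((1 + enorm y) * s.2 y) *
      nrm (mwderiv ((2 * pi) *: x) W f y) <= 2 ^+ size W * (C1 * C2 * K).
    apply: H.
    - move=> i; rewrite mxE normrM ger0_norm ?mulr_ge0 ?pi_ge0//.
      rewrite ler_wpM2l ?mulr_ge0 ?pi_ge0//.
      exact: le_trans (normr_le_enorm _ _) xB.
    - by rewrite mulr_ge0// mulr_ge0// exprn_ge0.
    - move=> Z sZ; have [b -> bZ] := subseq_cwderiv f sZ.
      rewrite /= add0n sW -/n -bZ; set m := mlength b.
      have mn : (m <= n)%N by rewrite /n -sW /m bZ; exact: size_subseq.
      have := co (n - m)%N m; rewrite subnK// => h1.
      have bD := bf b y; rewrite -/m in bD.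
      set D := nrm _ in bD *.
      have D0 : 0 <= D by exact: nrm_ge0.
      have z0 : 0 <= s.1 n * k ^+ (n - m) * 4 ^+ n.
        by rewrite mulr_ge0 ?exprn_ge0// mulr_ge0 ?exprn_ge0.
      rewrite (_ : _ * D = s.1 n * k ^+ (n - m) * 4 ^+ n * ((1 + enorm y) * s.2 y) * D); last by ring.
      rewrite (le_trans (ler_wpM2r D0 (ler_pM z0 y0 h1 h2)))//.
      rewrite (_ : _ * D = C1 * C2 * (s'.1 m * (s'.2 y * D))); last by ring.
      by rewrite ler_wpM2l// mulr_ge0// ltW.
  rewrite sW -/n (_ : 4 = 2 * 2); last by ring.
  rewrite exprMn.
  set D := nrm _; set w := _ * s.2 y.
  rewrite (_ : _ * D = 2 ^+ n * (s.1 n * 2 ^+ n * w * D)); last by ring.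
  by rewrite ler_pM2l// exprn_gt0.
Qed.

Lemma positive_steps c s : gs_admissible c -> steps c s -> positive_step s.
Proof. by move=> adm cs; have [s0 _ s1] := steps_pos adm cs. Qed.

Lemma finer_weight_locally_bounded s s' : positive_step s -> finer_weight s.2 s'.2 ->
  forall r : R, exists C, forall y, enorm y <= r -> s.2 y <= C.
Proof.
move=> [_ s1] fw r; have [C C0 h] := fw r.
exists (C * s'.2 0) => y yr; have := h y y yr; rewrite subrr; apply: le_trans.
by rewrite ler_peMl ?lerDl ?enorm_ge0// (le_trans _ (s1 _)).
Qed.

Lemma compact_ball (r : R) : compact [set y : V | `|y| <= r].
Proof.
apply: bounded_closed_compact.
  exists r; split; first exact: num_real.
  by move=> u ru y /= yr; rewrite (le_trans yr)// ltW.
by apply: closed_comp (@closed_le R r) => y _; exact: norm_continuous.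
Qed.

(** Outside finitely many orders and a ball the spare factor 2^|a| (1 + |y|) is at least n0 >= 2 K /
    e, so both functions contribute at most e / 2. The remaining orders are treated one at a time by
    uniform continuity on the compact ball. *)
Lemma family_bound_continuous U s f x0 (C Cw : R -> R) : positive_step s ->
  (forall x, smooth (U x f)) ->
  (forall a, jointly_continuous (fun x y => cderiv a (U x f) y)) ->
  (forall r y, enorm y <= r -> s.2 y <= Cw r) ->
  (forall B x, enorm x <= B -> forall a y,
     s.1 (mlength a) * 2 ^+ mlength a * ((1 + enorm y) * s.2 y) *
       nrm (cderiv a (U x f) y) <= C B) ->
  forall e : R, 0 < e -> \forall x \near x0, bounded_by s (fun y => U x f y - U x0 f y) e.
Proof.
move=> [s0 s1] sU jU wB CB e e0.
pose B := d%:R * (`|x0| + 1); pose K := C B.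
have xB : \forall x \near x0, enorm x <= B.
  near=> x; rewrite (le_trans (enorm_le_norm x))// ler_wpM2l//.
  have : `|x - x0| < 1.
    by near: x; apply: (@cvgr_distC_lt _ _ _ (nbhs x0) _ id x0) => //; exact: cvg_id.
  have := ler_normD (x - x0) x0; rewrite subrK; lra.
have x0B : enorm x0 <= B by exact: nbhs_singleton xB.
have K0 : 0 <= K.
  have := CB B x0 x0B (fun=> 0%N) 0; apply: le_trans.
  rewrite mulr_ge0 ?nrm_ge0// mulr_ge0 ?mulr_ge0 ?exprn_ge0 ?addr_ge0 ?enorm_ge0//.
  exact: le_trans (s1 _).
have cD x a y : cderiv a (fun y => U x f y - U x0 f y) y = cderiv a (U x f) y - cderiv a (U x0 f) y.
  rewrite (_ : (fun y => _) = (fun y => (-1) * U x0 f y + U x f y)).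
    by rewrite cderiv_lin// mulN1r addrC.
  by apply/funext => z; rewrite mulN1r addrC.
have [n0 n0P] : exists n0 : nat, 2 * K / e <= n0%:R.
  exists (Num.bound `|2 * K / e|).
  by rewrite (le_trans (ler_norm _))// ltW// archi_boundP.
pose r0 : R := n0%:R.
have tail x a y : enorm x <= B -> (n0 <= mlength a)%N \/ r0 <= enorm y ->
    s.1 (mlength a) * (s.2 y * nrm (cderiv a (U x f) y)) <= e / 2.
  move=> xB' ay; have := CB B x xB' a y; rewrite -/K.
  set co := s.1 _; set D := nrm _; set n := mlength a => h.
  have n2 : n0%:R <= 2 ^+ n * (1 + enorm y).
    have y0 := enorm_ge0 y.
    have n2 : (n%:R : R) <= 2 ^+ n by rewrite -natrX ler_nat ltnW// ltn_expl.
    have p1 : (1 : R) <= 2 ^+ n by rewrite exprn_ege1// ler1n.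
    case: ay => [an|ry]; last by rewrite /r0 in ry; nra.
    have : (n0%:R : R) <= n%:R by rewrite ler_nat.
    nra.
  have cwD : 0 <= co * (s.2 y * D).
    apply: mulr_ge0; first exact: s0.
    by rewrite mulr_ge0 ?nrm_ge0// (le_trans _ (s1 _)).
  have : (2 * K / e) * (co * (s.2 y * D)) <= K.
    apply: le_trans h; rewrite (le_trans (ler_wpM2r cwD (le_trans n0P n2)))//.
    by rewrite le_eqVlt; apply/orP; left; apply/eqP; ring.
  (* For K = 0 one cannot divide by 2 K / e, but then the term itself is at most 0. *)
  have [K00|K00] := eqVneq K 0; last first.
    have Kp : 0 < K by rewrite lt_def K00.
    move=> hK; rewrite -(@ler_pM2l _ (2 * K / e)) ?divr_gt0 ?mulr_gt0//.
    by rewrite (le_trans hK)// le_eqVlt; apply/orP; left; apply/eqP; field; rewrite gt_eqF.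
  move=> _; rewrite (@le_trans _ _ 0)//; last by rewrite ltW// divr_gt0.
  apply: le_trans (_ : K <= 0); last by rewrite K00.
  apply: le_trans h.
  rewrite (_ : co * 2 ^+ n * ((1 + enorm y) * s.2 y) * D =
    (2 ^+ n * (1 + enorm y)) * (co * (s.2 y * D))); last by ring.
  rewrite ler_peMl//.
  have y0 := enorm_ge0 y.
  have p1 : (1 : R) <= 2 ^+ n by rewrite exprn_ege1// ler1n.
  nra.
pose Kr := [set y : V | `|y| <= r0].
have core a : \forall x \near x0, forall y, Kr y ->
    s.1 (mlength a) * (s.2 y * nrm (cderiv a (U x f) y - cderiv a (U x0 f) y)) <= e.
  pose wmax := Cw (d%:R * r0).
  have wle y : Kr y -> s.2 y <= wmax.
    by move=> yr; apply: wB; rewrite (le_trans (enorm_le_norm y))// ler_wpM2l.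
  pose e1 := e / (1 + s.1 (mlength a) * `|wmax|).
  have den : 0 < 1 + s.1 (mlength a) * `|wmax|.
    by rewrite ltr_wpDr// mulr_ge0.
  have e10 : 0 < e1 by rewrite divr_gt0.
  have small : \forall x \near x0, forall y, Kr y ->
      nrm (cderiv a (U x f) y - cderiv a (U x0 f) y) <= e1.
    (* Compactness of the ball turns closeness near each [y] into closeness for all [y] at once. *)
    have /compact_near_coveringP cK := @compact_ball r0.
    apply: (cK _ (nbhs x0) (fun x y => nrm (cderiv a (U x f) y - cderiv a (U x0 f) y) <= e1)) => y _.
    have [rc jc] := jU a.
    have close (F : V -> V -> R) : continuous (fun p : V * V => F p.1 p.2) ->
        \forall y' \near y & x \near x0, `|F x y' - F x0 y'| <= e1 / 2.
      move=> cF.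
      have e40 : 0 < e1 / 4 by rewrite divr_gt0.
      have := @cvgr_distC_lt _ _ _ _ _ _ _ (cF (x0, y)) _ e40.
      move=> -[[P Q] [/= Px Qy] PQ].
      exists (Q, P) => //= -[y' x] [/= Qy' Px'].
      have /= := PQ (x, y') (conj Px' Qy').
      have /= := PQ (x0, y') (conj (nbhs_singleton Px) Qy').
      move=> h1 h2; rewrite ltW// (le_lt_trans (ler_distD (F x0 y) _ _))//.
      rewrite [`|F x0 y - _|]distrC; lra.
    have := close (fun x y => complex.Im (cderiv a (U x f) y)) jc.
    have := close (fun x y => complex.Re (cderiv a (U x f) y)) rc.
    apply: filterS2 => -[y' x] /= h1 h2.
    rewrite (le_trans (nrm_le_ReIm _))// !ReImE.
    lra.
  apply: filterS small => x h y Ky.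
  have w0 : 0 <= s.2 y by exact: le_trans (s1 _).
  have wy : s.2 y <= `|wmax| by rewrite (le_trans (wle y Ky))// ler_norm.
  apply: (@le_trans _ _ (s.1 (mlength a) * (`|wmax| * e1))).
    by rewrite ler_wpM2l// ler_pM ?nrm_ge0// h.
  rewrite /e1 mulrA [leLHS]mulrA ler_pdivrMr// mulrC ler_wpM2l ?ltW//.
  by rewrite ltrDr.
(* Multi-indices of length below n0 have entries below n0 and thus come from a finite type, over
   which neighbourhoods may be intersected. *)
pose bn (b : {ffun 'I_d -> 'I_n0.+1}) : 'I_d -> nat := fun i => b i.
have fin : \forall x \near x0, forall a, (mlength a < n0)%N -> forall y, Kr y ->
    s.1 (mlength a) * (s.2 y * nrm (cderiv a (U x f) y - cderiv a (U x0 f) y)) <= e.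
  have : \forall x \near x0, forall b : {ffun 'I_d -> 'I_n0.+1}, forall y, Kr y ->
    s.1 (mlength (bn b)) * (s.2 y * nrm (cderiv (bn b) (U x f) y - cderiv (bn b) (U x0 f) y)) <= e.
    exact: (@filter_forall _ {ffun 'I_d -> 'I_n0.+1}
      (fun b => [set x | forall y, Kr y -> s.1 (mlength (bn b)) *
         (s.2 y * nrm (cderiv (bn b) (U x f) y - cderiv (bn b) (U x0 f) y)) <= e])
      (nbhs x0) _ (fun b => core (bn b))).
  apply: filterS => x h a an y Ky.
  pose b : {ffun 'I_d -> 'I_n0.+1} := [ffun i => inord (a i)].
  have -> : a = bn b.
    apply/funext => i; rewrite /bn ffunE inordK// ltnS (leq_trans _ (ltnW an))//.
    by rewrite /mlength (bigD1 i)//= leq_addr.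
  exact: h.
near=> x => a y.
have xBn : enorm x <= B by near: x.
have tl : (n0 <= mlength a)%N \/ r0 <= enorm y ->
    s.1 (mlength a) * (s.2 y * nrm (cderiv a (fun y => U x f y - U x0 f y) y)) <= e.
  move=> ay; rewrite cD.
  have := tail x a y xBn ay; have := tail x0 a y x0B ay.
  have := nrm_triangle (cderiv a (U x f) y) (- cderiv a (U x0 f) y); rewrite nrmN.
  have c0 := s0 (mlength a); have w0 : 0 <= s.2 y by exact: le_trans (s1 _).
  move=> /(ler_wpM2l w0)/(ler_wpM2l c0) => t1 t2 t3; rewrite (le_trans t1)//.
  rewrite !mulrDr; lra.
have [an|an] := leqP n0 (mlength a); first by apply: tl; left.
have [ry|yr] := leP r0 (enorm y); first by apply: tl; right.
rewrite cD; move: a an y yr {tl}; near: x; apply: filterS fin => x h a an y yr.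
apply: h => //; rewrite /Kr/=; apply: norm_le_coord; first exact: ler0n.
by move=> i; rewrite (le_trans (normr_le_enorm y i))// ltW.
Unshelve. all: by end_near.
Qed.

End families.

(** * Linearity, invariance and decay of the Gelfand-Shilov space *)

Section gelfand_shilov_space.
Context (R : realType) (d : nat) (c : gs_class R).
Hypothesis adm : gs_admissible c.
Local Notation V := 'rV[R]_d.
Implicit Types (f g : Cfun R d) (s : step R d) (x y : V).
Implicit Types (U : V -> Cfun R d -> Cfun R d).

Lemma gs_smooth f : gs_space c f -> smooth f.
Proof. by case. Qed.

Let pos s : steps c s -> positive_step s.
Proof. exact: positive_steps. Qed.

Lemma bounded_by_family U s s' f K (x0 : V) : locally_bounded_family U ->
  positive_step s -> positive_step s' -> finer s s' -> smooth f -> bounded_by s' f K ->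
  exists K', bounded_by s (U x0 f) K'.
Proof.
move=> bU ps ps' fss sf bf; have [s0 s1] := ps.
have [C CP] := bU _ _ ps ps' fss f K (enorm x0) sf bf.
exists C => a y; apply: le_trans (CP x0 (lexx _) a y).
have w0 : 0 <= s.2 y by exact: le_trans (s1 _).
rewrite mulrA ler_wpM2r ?nrm_ge0//.
rewrite ler_pM//.
  by rewrite ler_peMr// exprn_ege1// ler1n.
by rewrite ler_peMl// lerDl enorm_ge0.
Qed.

Lemma gs_family U x f : admissible_family U -> gs_space c f -> gs_space c (U x f).
Proof.
move=> [sU jU bU] /gs_spaceP - /(_ adm)[sf h]; apply/(gs_spaceP _ adm).
split; first exact: sU.
have := finer_step d adm; case: ifP h => rc h fin.
  have [s' cs' [K bK]] := h; have [s cs fss] := fin s' cs'.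
  by exists s => //; exact: bounded_by_family bU (pos cs) (pos cs') fss sf bK.
move=> s cs; have [s' cs' fss] := fin s cs; have [K bK] := h s' cs'.
exact: bounded_by_family bU (pos cs) (pos cs') fss sf bK.
Qed.

Lemma bounded_by_lin s (a : R[i]) f g K K' : positive_step s -> smooth f -> smooth g ->
  bounded_by s f K -> bounded_by s g K' ->
  bounded_by s (fun x => a * f x + g x) (nrm a * K + K').
Proof.
move=> [s0 s1] sf sg bf bg b y; rewrite cderiv_lin//.
have w0 : 0 <= s.2 y by exact: le_trans (s1 _).
have := nrm_triangle (a * cderiv b f y) (cderiv b g y).
move=> /(ler_wpM2l w0)/(ler_wpM2l (s0 (mlength b)))/le_trans; apply.
rewrite !mulrDr lerD// nrmM.
apply: le_trans (ler_wpM2l (nrm_ge0 a) (bf b y)).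
by rewrite le_eqVlt; apply/orP; left; apply/eqP; ring.
Qed.

(** Two elements of the inductive limit may come from different steps; the step with the smaller h
    contains both. *)
Let roumieu_directed s s' : is_roumieu c -> steps c s -> steps c s' ->
  exists2 t, steps c t & forall f K, (bounded_by s f K -> bounded_by t f K) /\
                                     (bounded_by s' f K -> bounded_by t f K).
Proof.
case: c adm => // M A [wM wA] _ [h /= h0 <-] [h' /= h'0 <-].
have mono (k l : R) f K : 0 < k -> k <= l ->
    bounded_by (ultra_factor M l, @exp_weight R d A l) f K ->
    bounded_by (ultra_factor M k, @exp_weight R d A k) f K.
  move=> k0 kl bf a y; apply: le_trans (bf a y) => /=.
  have l0 : 0 <= l by rewrite (le_trans (ltW k0)).
  have M0 := ws_gt0 wM.
  apply: ler_pM.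
  - by rewrite divr_ge0 ?exprn_ge0// ltW.
  - by rewrite mulr_ge0 ?expR_ge0 ?nrm_ge0.
  - by rewrite /ultra_factor ler_pM2r ?invr_gt0// lerXn2r ?nnegrE// ltW.
  - rewrite ler_wpM2r ?nrm_ge0//; apply: expR_assoc_fun_mono => //.
      by rewrite mulr_ge0 ?enorm_ge0// ltW.
    by rewrite ler_wpM2r ?enorm_ge0.
have [hh'|hh'] := leP h h'.
  exists (ultra_factor M h, @exp_weight R d A h); first by exists h.
  by move=> f K; split; [exact: id|exact: (mono _ _ _ _ h0 hh')].
exists (ultra_factor M h', @exp_weight R d A h'); first by exists h'.
by move=> f K; split; [exact: (mono _ _ _ _ h'0 (ltW hh'))|exact: id].
Qed.

Lemma gs_lin (a : R[i]) f g : gs_space c f -> gs_space c g ->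
  gs_space c (fun x => a * f x + g x).
Proof.
move=> /gs_spaceP - /(_ adm)[sf hf] /gs_spaceP - /(_ adm)[sg hg].
apply/(gs_spaceP _ adm); split; first exact: smooth_lin.
case: ifP hf hg => rc hf hg.
  have [s cs [K bK]] := hf; have [s' cs' [K' bK']] := hg.
  have [t ct tP] := roumieu_directed rc cs cs'.
  exists t => //; exists (nrm a * K + K'); apply: bounded_by_lin => //.
  - exact: pos.
  - exact: (tP f K).1.
  - exact: (tP g K').2.
move=> s cs; have [K bK] := hf s cs; have [K' bK'] := hg s cs.
by exists (nrm a * K + K'); apply: bounded_by_lin => //; exact: pos.
Qed.

Lemma gs_sub f g : gs_space c f -> gs_space c g -> gs_space c (fun x => f x - g x).
Proof.
move=> Sf Sg; have := gs_lin (-1) Sg Sf.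
by congr gs_space; apply/funext => x; rewrite mulN1r addrC.
Qed.

(** In the Beurling cases the seminorm selects the step [s] and [f] is bounded for a finer one; in
    the Roumieu case [f] selects [s'], and the seminorm is continuous on every step, in particular
    on a coarser one. *)
Lemma gs_family_continuous U f x0 p : admissible_family U -> gs_space c f ->
  gs_continuous_seminorm c p ->
  forall e : R, 0 < e -> \forall x \near x0, p (fun y => U x f y - U x0 f y) <= e.
Proof.
move=> fU Sf cp e e0; have [sU jU bU] := fU.
have /gs_spaceP - /(_ adm)[sf h] := Sf.
have SU x : gs_space c (fun y => U x f y - U x0 f y).
  by apply: gs_sub; exact: gs_family.
have key s s' K : steps c s -> steps c s' -> finer s s' -> bounded_by s' f K ->
    (exists2 C : R, 0 <= C & forall f K, gs_space c f -> bounded_by s f K -> p f <= C * K) ->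
    \forall x \near x0, p (fun y => U x f y - U x0 f y) <= e.
  move=> cs cs' fss bf [C C0 pC].
  have [Cw CwP] := choice (finer_weight_locally_bounded (pos cs) fss.2).
  have [CB CBP] := choice (fun B => bU _ _ (pos cs) (pos cs') fss f K B sf bf).
  have e1 : 0 < e / (1 + C) by rewrite divr_gt0// ltr_wpDr.
  have := @family_bound_continuous R d U s f x0 CB Cw (pos cs) (fun x => sU x f sf)
    (fun a => jU a f sf) CwP CBP _ e1.
  apply: filterS => x /(pC _ _ (SU x)) /le_trans; apply.
  rewrite mulrA ler_pdivrMr; last by rewrite ltr_wpDr.
  by rewrite mulrC ler_wpM2l ?lerDr// ltW.
have := gs_seminorm_bound adm cp; have := finer_step d adm; case: ifP h => rc h fin dom.
  have [s' cs' [K bK]] := h; have [s cs fss] := fin s' cs'.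
  exact: key cs cs' fss bK (dom s cs).
have [s cs ds] := dom; have [s' cs' fss] := fin s cs; have [K bK] := h s' cs'.
exact: key cs cs' fss bK ds.
Qed.

(** From (1 + r)^k <= 2^k (1 + r^k) and the term (h r)^k / A_k, which the exponential weight
    dominates. *)
Lemma power_le_exp A (h : R) k : weight_sequence A -> 0 < h -> exists2 C : R, 0 < C &
  forall y, (1 + enorm y) ^+ k <= C * @exp_weight R d A h y.
Proof.
move=> wA h0; have A0 := ws_gt0 wA.
exists (2 ^+ k * (1 + A k / h ^+ k)).
  by rewrite mulr_gt0 ?exprn_gt0// addr_gt0// divr_gt0// exprn_gt0.
move=> y; have y0 := enorm_ge0 y.
have E1 : 1 <= exp_weight A h y.
  by rewrite -expR0 ler_expR assoc_fun_ge0// mulr_ge0// ltW.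
apply: (@le_trans _ _ (2 ^+ k * (1 + enorm y ^+ k))).
  have [y1|y1] := leP (enorm y) 1.
    apply: (@le_trans _ _ (2 ^+ k)).
      by rewrite lerXn2r ?nnegrE ?addr_ge0//; lra.
    by rewrite ler_peMr ?exprn_ge0// lerDl exprn_ge0.
  apply: (@le_trans _ _ ((2 * enorm y) ^+ k)).
    by rewrite lerXn2r ?nnegrE ?addr_ge0 ?mulr_ge0//; lra.
  by rewrite exprMn ler_wpM2l ?exprn_ge0// lerDr.
rewrite -mulrA ler_wpM2l ?exprn_ge0// mulrDl mul1r lerD//.
have hy0 : 0 <= h * enorm y by rewrite mulr_ge0// ltW.
have := expR_assoc_fun_ge wA k hy0; rewrite -/(exp_weight A h y) exprMn => E2.
have q : 0 <= A k / h ^+ k by rewrite divr_ge0 ?exprn_ge0// ltW.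
apply: le_trans (ler_wpM2l q E2).
rewrite le_eqVlt; apply/orP; left; apply/eqP; field.
by rewrite ?expf_neq0 ?gt_eqF.
Qed.

Lemma steps_power k n : 
  let dominates s := (exists2 C : R, 0 < C & forall y, (1 + enorm y) ^+ k <= C * s.2 y) /\
    0 < s.1 n in
  if is_roumieu c then forall s, steps c s -> dominates s
  else exists2 s, steps c s & dominates s.
Proof.
have uf M (h : R) : weight_sequence M -> 0 < h -> 0 < ultra_factor M h n.
  by move=> wM h0; rewrite divr_gt0 ?exprn_gt0//; exact: ws_gt0 wM n.
have pw m : (k <= m)%N -> exists2 C : R, 0 < C &
    forall y, (1 + enorm y) ^+ k <= C * @power_weight R d m y.
  by move=> km; exists 1 => // y; rewrite mul1r ler_weXn2l// lerDl enorm_ge0.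
case: c adm => [M A [wM wA]|M A [wM wA]|A wA|M wM|_] /=.
- exists (ultra_factor M 1, @exp_weight R d A 1); first by exists 1 => //=.
  by split; [exact: power_le_exp|exact: uf].
- by move=> _ [h h0 <-]; split; [exact: power_le_exp|exact: uf].
- exists (order_factor R n.+1, @exp_weight R d A n.+1%:R); first by exists n.+1.
  split; first by apply: power_le_exp => //; rewrite ltr0n.
  by rewrite /= /order_factor leqnSn.
- exists (ultra_factor M k.+1%:R, @power_weight R d k.+1); first by exists k.+1.
  by split; [exact: pw|apply: uf => //; rewrite ltr0n].
- exists (order_factor R (k + n).+1, @power_weight R d (k + n).+1).
    by exists (k + n).+1.
  split; first by apply: pw; rewrite (leq_trans (leq_addr n _)).
  by rewrite /= /order_factor (leq_trans (leq_addl k _)).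
Qed.

Lemma gs_decay f a k : gs_space c f ->
  exists K, forall y, (1 + enorm y) ^+ k * nrm (cderiv a f y) <= K.
Proof.
move=> Sf; have /gs_spaceP - /(_ adm)[sf h] := Sf.
have key s K : bounded_by s f K ->
   (exists2 C : R, 0 < C & forall y, (1 + enorm y) ^+ k <= C * s.2 y) ->
   0 < s.1 (mlength a) -> exists K, forall y, (1 + enorm y) ^+ k * nrm (cderiv a f y) <= K.
  move=> bf [C C0 CP] co0; exists (C * (K / s.1 (mlength a))) => y.
  rewrite (le_trans (ler_wpM2r (nrm_ge0 _) (CP y)))// -mulrA ler_wpM2l ?(ltW C0)//.
  by rewrite ler_pdivlMr// mulrC; exact: bf.
have := steps_power k (mlength a); case: ifP h => rc h dom.
  by have [s cs [K bK]] := h; have [Cs co] := dom s cs; exact: key bK Cs co.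
by have [s cs [Cs co]] := dom; have [K bK] := h s cs; exact: key bK Cs co.
Qed.

(** Origin of the exponent 2 d: each of the d factors 1 + x_i^2 is at most (1 + |x|)^2. *)
Lemma rho_power_ge1 x : 1 <= (1 + enorm x) ^+ (2 * d) * rho x.
Proof.
rewrite /rho.
have -> : (1 + enorm x) ^+ (2 * d) = \prod_(i < d) (1 + enorm x) ^+ 2.
  by rewrite prodr_const card_ord exprM.
rewrite -big_split/=; apply: (big_ind (fun u : R => 1 <= u)) => //.
  by move=> u v u1 v1; rewrite (le_trans u1)// ler_peMr// (le_trans _ u1).
move=> i _; have xi := normr_le_enorm x i; have x0 := enorm_ge0 x.
have p : 0 < 1 + x 0 i ^+ 2 by rewrite ltr_wpDr// sqr_ge0.
rewrite ler_pdivlMr// mul1r.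
have : x 0 i ^+ 2 <= enorm x ^+ 2.
  by rewrite -real_normK ?num_real// lerXn2r ?nnegrE.
rewrite sqrrD expr1n mul1r; lra.
Qed.

Lemma gs_rho f a : gs_space c f ->
  exists2 K : R, 0 <= K & forall y, nrm (cderiv a f y) <= K * rho y.
Proof.
move=> Sf; have [K KP] := gs_decay a (2 * d) Sf.
have K0 : 0 <= K.
  by apply: le_trans (KP 0); rewrite mulr_ge0 ?nrm_ge0 ?exprn_ge0 ?addr_ge0 ?enorm_ge0.
exists K => // y; apply: le_trans (_ : nrm (cderiv a f y) * ((1 + enorm y) ^+ (2 * d) * rho y) <= _).
  by rewrite ler_peMr ?nrm_ge0// rho_power_ge1.
by rewrite mulrA [nrm _ * _]mulrC ler_wpM2r ?rho_ge0.
Qed.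

Lemma cderiv0 f : cderiv (fun=> 0%N) f = f.
Proof.
rewrite cderiv_word (_ : multi_word _ _ = [::])//.
by rewrite /multi_word; elim: (enum 'I_d).
Qed.

Lemma smooth_cmeasurable f : smooth f -> cmeasurable f.
Proof. by move=> /smooth_continuous[r j]; exact: cmeasurable_continuous. Qed.

Lemma integrable_rhoZ (K : R) :
  (lebesgue R d).-integrable setT (fun t => (K * rho (vec_of_tuple t))%:E).
Proof.
under eq_fun do rewrite EFinM.
by apply: integrableZl => //; exact: integrable_rho.
Qed.

Lemma gs_cintegrable f : gs_space c f -> cintegrable f.
Proof.
move=> Sf; have [K K0 KP] := gs_rho (fun=> 0%N) Sf; rewrite cderiv0 in KP.
apply: cintegrable_dominated (integrable_rhoZ K) KP.
exact: smooth_cmeasurable (gs_smooth Sf).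
Qed.

Lemma gs_bounded_fun f : gs_space c f -> exists K, forall y, nrm (f y) <= K.
Proof.
move=> Sf; have [K KP] := gs_decay (fun=> 0%N) 0 Sf; exists K => y.
by have := KP y; rewrite expr0 mul1r cderiv0.
Qed.

End gelfand_shilov_space.

(** * Gaussians *)

Section hermite.
Context (R : realType).
Implicit Types (s x e L : R) (n : nat).

(* The n-th derivative of exp (- s x ^ 2). *)
Fixpoint hermite s n x : R :=
  match n with
  | 0 => expR (- (s * x ^+ 2))
  | n'.+1 => - (2 * s * x) * hermite s n' x -
      (if n' is m.+1 then 2 * s * n'%:R * hermite s m x else 0)
  end.

Lemma hermiteSS s n x : hermite s n.+2 x =
  - (2 * s * x) * hermite s n.+1 x - 2 * s * n.+1%:R * hermite s n x.
Proof. by []. Qed.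

Lemma is_derive_hermite s n x : is_derive x (1 : R) (hermite s n) (hermite s n.+1 x).
Proof.
have D0 (y : R) : is_derive y 1 (hermite s 0) (hermite s 1 y).
  have Dq : is_derive y 1 (fun z : R => - (s * z ^+ 2)) (- (2 * s * y)).
    have -> : (fun z : R => - (s * z ^+ 2)) = (- s) \*: ((id : R -> R) * id).
      by apply/funext => z; rewrite /= /GRing.scale/= expr2 mulNr.
    by apply: is_derive_eq; rewrite /GRing.scale/=; ring.
  have := is_derive1_comp (is_derive_expR _) Dq.
  by move=> D; apply: is_derive_eq D _; rewrite /= subr0 mulrC.
have gen (y k d0 d1 : R) (f0 f1 : R -> R) : is_derive y 1 f0 d0 -> is_derive y 1 f1 d1 ->
    is_derive y 1 (fun z => - (2 * s * z) * f1 z - k * f0 z)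
      (- (2 * s) * f1 y - (2 * s * y) * d1 - k * d0).
  move=> D0' D1'.
  have -> : (fun z => - (2 * s * z) * f1 z - k * f0 z) =
      ((- (2 * s)) \*: ((id : R -> R) * f1)) - (k \*: f0).
    apply/funext => z; change (- (2 * s * z) * f1 z - k * f0 z = - (2 * s) * (z * f1 z) - k * f0 z).
    by ring.
  apply: is_derive_eq.
  change (- (2 * s) * (y * d1 + f1 y * 1) - k * d0 = - (2 * s) * f1 y - 2 * s * y * d1 - k * d0).
  by ring.
(* Two consecutive orders are carried along, as the recursion reaches back two steps. *)
suff H m : (forall y, is_derive y (1 : R) (hermite s m) (hermite s m.+1 y)) /\
    (forall y, is_derive y (1 : R) (hermite s m.+1) (hermite s m.+2 y)).
  exact: (H n).1.
elim: m => [|m [IH0 IH1]]; split.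
- exact: D0.
- move=> y; have := gen y 0 0 _ (cst 0) _ (is_derive_cst _ _ _) (D0 y).
  have -> : (fun z => - (2 * s * z) * hermite s 0 z - 0 * cst 0 z) = hermite s 1.
    by apply/funext => z; rewrite /= mul0r.
  move=> D1; apply: is_derive_eq D1 _.
  rewrite [RHS]hermiteSS; move: (hermite s 0 y) (hermite s 1 y) => u v; ring.
- exact: IH1.
- move=> y; have := gen y (2 * s * m.+1%:R) _ _ _ _ (IH0 y) (IH1 y).
  have -> : (fun z => - (2 * s * z) * hermite s m.+1 z - 2 * s * m.+1%:R * hermite s m z) =
      hermite s m.+2.
    by apply/funext => z; rewrite hermiteSS.
  move=> D2; apply: is_derive_eq D2 _.
  rewrite [RHS]hermiteSS -[m.+2%:R]natr1.
  by move: (hermite s m.+1 y) (hermite s m.+2 y) => u v; ring.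
Qed.

(* Majorises the numerators n! sum_(k <= n) c ^ k / k! appearing below. *)
Fixpoint exp_trunc (c : R) n : R :=
  if n is n'.+1 then n%:R * exp_trunc c n' + c ^+ n else 1.

Lemma exp_trunc_ge0 c n : 0 <= c -> 0 <= exp_trunc c n.
Proof. by move=> c0; elim: n => //= n IH; rewrite addr_ge0 ?exprn_ge0// mulr_ge0. Qed.

Lemma exp_trunc_mul c n : 0 <= c -> c * exp_trunc c n <= exp_trunc c n.+1.
Proof.
move=> c0; elim: n => [|n IH]; first by rewrite /= !mulr1 expr1 lerDr.
rewrite [X in c * X]/= mulrDr -exprS [leRHS]/= lerD// mulrCA.
rewrite (le_trans (ler_wpM2l (ler0n _ _) IH))//.
by rewrite ler_wpM2r ?exp_trunc_ge0// ler_nat.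
Qed.

(** The summand c^n equals (2 c)^n / 2^n and is at most n! e^(2c) / 2^n; the geometric series of
    these bounds yields the factor 2 - 2^(-n). *)
Lemma exp_trunc_le c n : 0 <= c ->
  exp_trunc c n <= (n`!)%:R * ((2 - (2 ^+ n)^-1) * expR (2 * c)).
Proof.
move=> c0; have E1 : 1 <= expR (2 * c) by rewrite -expR0 ler_expR mulr_ge0.
elim: n => [|n IH]; first by rewrite /= fact0 mul1r expr0 invr1; lra.
have p2 : (2 ^+ n : R) != 0 by rewrite expf_neq0.
rewrite /= (le_trans (lerD (ler_wpM2l (ler0n _ _) IH) (lexx _)))//.
have := factorial_power_le n.+1 (mulr_ge0 (ler0n R 2) c0).
rewrite exprMn -ler_pdivlMl ?exprn_gt0// => h.
rewrite (le_trans (lerD (lexx _) h))// factS natrM.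
by rewrite le_eqVlt; apply/orP; left; apply/eqP; rewrite exprS; field.
Qed.

(** The choice of [c] gives c e = 2 s |x| + 2 s / e: the first term matches the coefficient of the
    preceding order in the recursion, the second absorbs the order before that, since the truncated
    exponentials t satisfy n t_(n-1) <= t_n. *)
Lemma hermite_le s e n x c : 0 < s -> 0 < e ->
  c = (2 * s * `|x| + 2 * s / e) / e ->
  `|hermite s n x| <= e ^+ n * exp_trunc c n * expR (- (s * x ^+ 2)).
Proof.
move=> s0 e0 cE.
have c0 : 0 <= c.
  by rewrite cE divr_ge0 ?(ltW e0)// addr_ge0// ?divr_ge0 ?mulr_ge0 ?(ltW s0) ?(ltW e0).
have sx : `|- (2 * s * x)| = 2 * s * `|x|.
  by rewrite normrN normrM ger0_norm// mulr_ge0// ltW.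
set E := expR _; have E0 : 0 <= E by exact: expR_ge0.
have step0 : `|hermite s 0 x| <= e ^+ 0 * exp_trunc c 0 * E.
  by rewrite /= !mul1r ger0_norm ?expR_ge0.
have es : 2 * s / e * e = 2 * s by rewrite divfK// gt_eqF.
have ce : c * e = 2 * s * `|x| + 2 * s / e by rewrite cE divfK// gt_eqF.
have step1 : `|hermite s 1 x| <= e ^+ 1 * exp_trunc c 1 * E.
  rewrite [hermite s 1 x]/= subr0 normrM sx ger0_norm ?expR_ge0// ler_wpM2r//.
  rewrite /= expr1 !mul1r mulrDr mulr1 [e * c]mulrC ce.
  have : 0 <= 2 * s / e by rewrite divr_ge0 ?mulr_ge0// ltW.
  lra.
elim: n {-2}n (leqnn n) => [|n IH] [|[|m]] // mn.
rewrite hermiteSS (le_trans (ler_normB _ _))// !normrM sx.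
rewrite !normr_nat (ger0_norm (ltW s0)).
have h1 := IH m.+1 mn; have h0 := IH m (ltnW mn).
have t0 := exp_trunc_ge0 m c0; have t1 := exp_trunc_ge0 m.+1 c0.
have s2 : 0 <= 2 * s by rewrite mulr_ge0// ltW.
rewrite (le_trans (lerD (ler_wpM2l (mulr_ge0 s2 (normr_ge0 x)) h1)
  (ler_wpM2l (mulr_ge0 s2 (ler0n _ m.+1)) h0)))//.
have em : 0 <= e ^+ m by rewrite exprn_ge0// ltW.
have tm : m.+1%:R * exp_trunc c m <= exp_trunc c m.+1 by rewrite /= lerDl exprn_ge0.
apply: (@le_trans _ _ (e ^+ m * e * ((c * e) * exp_trunc c m.+1) * E)); last first.
  rewrite ler_wpM2r// exprS exprS.
  rewrite (_ : e ^+ m * e * _ = e * (e * e ^+ m) * (c * exp_trunc c m.+1)); last by ring.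
  by rewrite ler_wpM2l ?exp_trunc_mul// !mulr_ge0 ?(ltW e0).
rewrite ce exprS.
have h : 2 * s * (m.+1%:R * exp_trunc c m) <= 2 * s * exp_trunc c m.+1 by rewrite ler_wpM2l.
rewrite (_ : 2 * s * `|x| * _ + _ =
  e ^+ m * E * (e * (2 * s * `|x| * exp_trunc c m.+1) + 2 * s * (m.+1%:R * exp_trunc c m))); last by ring.
rewrite (_ : e ^+ m * e * _ * E =
  e ^+ m * E * (e * (2 * s * `|x| * exp_trunc c m.+1) + (2 * s / e * e) * exp_trunc c m.+1)); last by ring.
by rewrite es ler_wpM2l ?mulr_ge0// lerD2l.
Qed.

(** Arbitrarily small [e] is needed because the Beurling steps test the derivatives for every h. The
    price e^(2c) is exponential in |x|, with a rate of order 1 / e, and the Gaussian factor absorbs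
    it. *)
Lemma hermite_bound s e L : 0 < s -> 0 < e -> exists2 C : R, 1 <= C &
  forall n x, `|hermite s n x| * expR (L * `|x|) <= C * ((n`!)%:R * e ^+ n).
Proof.
move=> s0 e0.
(* Here 2 c = b + (a - L) |x|, and a |x| - s |x|^2 <= a^2 / (4 s) by completing the square. *)
pose b := 2 * (2 * s / e / e); pose a := L + 2 * (2 * s / e).
pose C := 2 * expR (b + a ^+ 2 / (4 * s)).
have b0 : 0 <= b by rewrite mulr_ge0// !divr_ge0 ?mulr_ge0// ltW.
exists C.
  have : 1 <= expR (b + a ^+ 2 / (4 * s)).
    by rewrite -expR0 ler_expR addr_ge0// divr_ge0 ?sqr_ge0// mulr_ge0// ltW.
  rewrite /C; lra.
move=> n x; pose c := (2 * s * `|x| + 2 * s / e) / e.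
have h := hermite_le n s0 e0 (erefl c).
have c0 : 0 <= c.
  by rewrite divr_ge0 ?(ltW e0)// addr_ge0// ?divr_ge0 ?mulr_ge0 ?(ltW s0) ?(ltW e0).
rewrite (le_trans (ler_wpM2r (expR_ge0 _) h))//.
have en : 0 <= e ^+ n by rewrite exprn_ge0// ltW.
have f0 : (0 : R) <= (n`!)%:R by exact: ler0n.
have t : exp_trunc c n <= (n`!)%:R * (2 * expR (2 * c)).
  rewrite (le_trans (exp_trunc_le n c0))// ler_wpM2l// ler_wpM2r ?expR_ge0//.
  by rewrite gerBl invr_ge0 exprn_ge0.
apply: (@le_trans _ _ (e ^+ n * ((n`!)%:R * (2 * expR (2 * c))) * expR (- (s * x ^+ 2)) * expR (L * `|x|))).
  by rewrite ler_wpM2r ?expR_ge0// ler_wpM2r ?expR_ge0// ler_wpM2l.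
rewrite (_ : e ^+ n * _ * _ * _ = (n`!)%:R * e ^+ n * (2 * (expR (2 * c) * expR (- (s * x ^+ 2)) * expR (L * `|x|)))); last by ring.
rewrite mulrC ler_wpM2r ?mulr_ge0// /C ler_wpM2l// -!expRD ler_expR.
have -> : 2 * c + - (s * x ^+ 2) + L * `|x| = b + (a * `|x| - s * `|x| ^+ 2).
  rewrite real_normK ?num_real// /b /a /c; field.
  by rewrite gt_eqF.
rewrite lerD2l -subr_ge0.
have -> : a ^+ 2 / (4 * s) - (a * `|x| - s * `|x| ^+ 2) = (a - 2 * s * `|x|) ^+ 2 / (4 * s).
  by field; rewrite gt_eqF.
by rewrite divr_ge0 ?sqr_ge0// mulr_ge0// ltW.
Qed.

End hermite.

Section gaussians.
Context (R : realType) (d : nat).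
Local Notation V := 'rV[R]_d.
Implicit Types (s : 'I_d -> R) (a : 'I_d -> nat) (x y : V) (i : 'I_d).

(* Derivatives of the anisotropic Gaussian exp (- sum_i s_i x_i ^ 2). *)
Definition gauss s a x : R := \prod_i hermite (s i) (a i) (x 0 i).

Definition cgauss s a : Cfun R d := fun x => ((gauss s a x)%:C)%C.

Definition incr_index a i : 'I_d -> nat := fun j => (a j + (j == i))%N.

Lemma continuous_gauss s a : continuous (gauss s a).
Proof.
have ch k n : continuous (hermite k n : R -> R).
  by move=> z; apply: differentiable_continuous; apply/derivable1_diffP;
    have [] := is_derive_hermite k n z.
rewrite /gauss => x; elim: (index_enum _) => [|i r IH].
  by under eq_fun do rewrite big_nil; exact: cst_continuous.
under eq_fun do rewrite big_cons.
apply: (@continuousM _ _ (fun x : V => hermite (s i) (a i) (x 0 i))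
  (fun x => \prod_(j <- r) hermite (s j) (a j) (x 0 j))) IH.
apply: (@continuous_comp _ _ _ (fun x : V => x 0 i) (hermite (s i) (a i))).
  exact: coord_continuous.
exact: ch.
Qed.

Lemma is_derive_gauss s a x i :
  is_derive x 'e_i (gauss s a) (gauss s (incr_index a i) x).
Proof.
apply: is_derive_line.
pose P := \prod_(j | j != i) hermite (s j) (a j) (x 0 j).
have line h : gauss s a (h *: 'e_i + x) = hermite (s i) (a i) (h + x 0 i) * P.
  rewrite /gauss (bigD1 i)//= !mxE !eqxx/= mulr1; congr (_ * _).
  by apply: eq_bigr => j ji; rewrite !mxE (negbTE ji)/= mulr0 add0r.
have Dh : is_derive (0 : R) 1 (fun h : R => h + x 0 i) 1.
  have -> : (fun h : R => h + x 0 i) = (id : R -> R) + cst (x 0 i) by [].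
  by apply: is_derive_eq; rewrite addr0.
have D := @is_derive1_comp R (hermite (s i) (a i)) (fun h => h + x 0 i) 0 _ _
  (is_derive_hermite (s i) (a i) (0 + x 0 i)) Dh.
have := is_deriveM D (is_derive_cst P (0 : R) (1 : R)).
have -> : (hermite (s i) (a i) \o (fun h : R => h + x 0 i)) * cst P =
    (fun h : R => gauss s a (h *: 'e_i + x)).
  by apply/funext => h; rewrite line.
move=> D'; apply: is_derive_eq D' _.
have -> : gauss s (incr_index a i) x = hermite (s i) (a i).+1 (x 0 i) * P.
  rewrite /gauss (bigD1 i)//= /incr_index eqxx addn1; congr (_ * _).
  by apply: eq_bigr => j ji; rewrite (negbTE ji) addn0.
rewrite scaler0 add0r mulr1 add0r /=.
exact: mulrC.
Qed.

Lemma is_Ck_gauss k s a : is_Ck k (gauss s a).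
Proof.
elim: k a => [|k IH] a; first exact: continuous_gauss.
split; first exact: continuous_gauss.
move=> i; split=> [x|]; first by have [] := is_derive_gauss s a x i.
rewrite (_ : (fun x => _) = gauss s (incr_index a i)) ?IH//.
by apply/funext => x; have [] := is_derive_gauss s a x i.
Qed.

Lemma is_Ck_cst k (r : R) : is_Ck k (fun _ : V => r).
Proof.
elim: k r => [|k IH] r; first by move=> x; exact: cst_continuous.
split; first by move=> x; exact: cst_continuous.
move=> i; have D (x : V) := is_derive_cst r x ('e_i : V).
split=> [x|]; first by have [] := D x.
rewrite (_ : (fun x : V => 'D_('e_i) (fun _ : V => r) x) = fun=> 0) ?IH//.
by apply/funext => x; have [] := D x.
Qed.

Lemma smooth_cgauss s a : smooth (cgauss s a).
Proof. by move=> k; split; [exact: is_Ck_gauss|exact: is_Ck_cst]. Qed.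

Lemma cpartial_cgauss s a i : cpartial i (cgauss s a) = cgauss s (incr_index a i).
Proof.
apply/funext => x; apply: complex_eqP => /=.
  by have [] := is_derive_gauss s a x i.
by have [] := is_derive_cst (0 : R) x ('e_i : V).
Qed.

Lemma mlength_incr a i : mlength (incr_index a i) = (mlength a).+1.
Proof.
rewrite /mlength /incr_index big_split/= [X in (_ + X)%N](bigD1 i)//= eqxx.
rewrite [X in (_ + (_ + X))%N]big1 ?addn0 ?addn1//.
by move=> j /negbTE ->.
Qed.

Lemma cwderiv_cgauss s a W : exists2 b, cwderiv W (cgauss s a) = cgauss s b &
  mlength b = (mlength a + size W)%N.
Proof.
elim: W => [|i W [b bE bl]]; first by exists a; rewrite ?addn0.
exists (incr_index b i); first by rewrite /= bE cpartial_cgauss.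
by rewrite mlength_incr bl addnS.
Qed.

Lemma cderiv_cgauss s b : exists2 b', cderiv b (cgauss s (fun=> 0%N)) = cgauss s b' &
  mlength b' = mlength b.
Proof.
rewrite cderiv_word; have [b' -> bl] := cwderiv_cgauss s (fun=> 0%N) (multi_word (enum 'I_d) b).
by exists b' => //; rewrite bl mlength0 size_multi_word.
Qed.

Lemma prod_factorial_le a : (\prod_i (a i)`! <= (mlength a)`!)%N.
Proof.
rewrite /mlength; elim/big_rec2: _ => // i n m _ mn.
rewrite -(bin_fact (leq_addr n (a i))) addKn.
rewrite (leq_trans _ (leq_pmull _ _)) ?bin_gt0 ?leq_addr//.
by rewrite leq_mul.
Qed.

Lemma gauss_bound s (e L : R) : (forall i, 0 < s i) -> 0 < e -> 0 <= L ->
  exists2 C : R, 0 < C & forall a x, `|gauss s a x| * expR (L * enorm x) <=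
    C * ((mlength a)`!%:R * e ^+ mlength a).
Proof.
move=> s0 e0 L0.
have hb i : exists C : R, 1 <= C /\ forall n (x : R),
    `|hermite (s i) n x| * expR (L * `|x|) <= C * ((n`!)%:R * e ^+ n).
  by have [C C1 CP] := hermite_bound L (s0 i) e0; exists C.
have [C CP] := choice hb.
have C0 : 0 < \prod_i C i by apply: prodr_gt0 => i _; rewrite (lt_le_trans ltr01)// (CP i).1.
exists (\prod_i C i) => // a x.
apply: (@le_trans _ _ (\prod_i (`|hermite (s i) (a i) (x 0 i)| * expR (L * `|x 0 i|)))).
  rewrite big_split/= -normr_prod ler_wpM2l// -expR_sum ler_expR -mulr_sumr.
  by rewrite ler_wpM2l// enorm_le_sum.
apply: (@le_trans _ _ (\prod_i (C i * ((a i)`!%:R * e ^+ a i)))).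
  apply: ler_prod => i _; rewrite mulr_ge0 ?expR_ge0//=; exact: (CP i).2.
rewrite !big_split/= ler_wpM2l ?(ltW C0)//.
have -> : \prod_(i < d) e ^+ a i = e ^+ mlength a.
  by rewrite /mlength; elim/big_rec2: _ => [|i m n _ ->]; rewrite ?expr0 ?exprD.
rewrite ler_wpM2r ?exprn_ge0 ?(ltW e0)// -natr_prod ler_nat.
exact: prod_factorial_le.
Qed.

Lemma power_le_expR (k : nat) : exists2 C : R, 0 < C &
  forall r : R, 0 <= r -> (1 + r) ^+ k <= C * expR r.
Proof.
exists ((k`!)%:R * expR 1); first by rewrite mulr_gt0 ?expR_gt0// ltr0n fact_gt0.
by move=> r r0; rewrite -mulrA -expRD factorial_power_le// addr_ge0.
Qed.

Lemma gauss_rho s a (L : R) : (forall i, 0 < s i) -> 0 <= L ->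
  exists2 K : R, 0 <= K & forall x, `|gauss s a x| * expR (L * enorm x) <= K * rho x.
Proof.
move=> s0 L0.
(* One extra unit of exponential rate pays for the power of 1 + |x| that [rho] requires. *)
have [C C0 CP] := gauss_bound s0 ltr01 (addr_ge0 L0 ler01).
have [C' C'0 C'P] := power_le_expR (2 * d).
exists (C' * (C * ((mlength a)`!%:R * 1 ^+ mlength a))).
  by rewrite mulr_ge0 ?(ltW C'0)// mulr_ge0 ?(ltW C0)// expr1n mulr1 ler0n.
move=> x; have := rho_power_ge1 x; set E := `|_| * _ => r1.
have E0 : 0 <= E by rewrite mulr_ge0 ?expR_ge0.
apply: (@le_trans _ _ (E * ((1 + enorm x) ^+ (2 * d) * rho x))); first by rewrite ler_peMr.
rewrite [leLHS]mulrA ler_wpM2r ?rho_ge0//.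
rewrite (le_trans (ler_wpM2l E0 (C'P _ (enorm_ge0 x))))//.
rewrite mulrCA ler_wpM2l ?(ltW C'0)//.
rewrite (_ : E * _ = `|gauss s a x| * expR ((L + 1) * enorm x)); first exact: CP.
by rewrite /E -mulrA -expRD mulrDl mul1r.
Qed.

Lemma nrm_cgauss s a x : nrm (cgauss s a x) = `|gauss s a x|.
Proof. exact: nrm_real. Qed.

End gaussians.

(** * Gaussians are test functions of every class *)

Section gaussians_in_space.
Context (R : realType) (d : nat) (c : gs_class R).
Hypothesis adm : gs_admissible c.

Definition exp_type (w : R -> R) := exists C L : R, [/\ 0 < C, 0 <= L &
  forall r, 0 <= r -> w r <= C * expR (L * r)].

Let assoc_exp_type A (h : R) : weight_sequence A -> 0 <= h ->
  exp_type (fun r => expR (assoc_fun A (h * r))).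
Proof.
move=> wA h0; have [C [L [C0 L0 CP]]] := expR_assoc_fun_exp_type wA.
exists C, (L * h); split; [by []|exact: mulr_ge0|move=> r r0].
by rewrite -mulrA CP// mulr_ge0.
Qed.

Let log_exp_type (h : R) : 0 <= h -> exp_type (fun r => expR (log_weight h r)).
Proof.
move=> h0; exists 1, h; split => // r r0.
rewrite mul1r ler_expR /log_weight ler_wpM2l// ger0_norm//.
by rewrite -[leRHS]expRK ler_ln ?posrE ?expR_gt0 ?expR_ge1Dx// ltr_wpDr.
Qed.

Lemma Aweight_exp_type (tau : R) : 0 < tau -> exp_type (fun r => expR (Aweight c tau r)).
Proof.
move=> /ltW t0; case: c adm => [M A [wM wA]|M A [wM wA]|A wA|M wM|_] /=.
- exact: (assoc_exp_type wA t0).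
- exact: (assoc_exp_type wA t0).
- exact: (assoc_exp_type wA t0).
- exact: (log_exp_type t0).
- exact: (log_exp_type t0).
Qed.

Lemma Mweight_exp_type (tau : R) : 0 < tau -> exp_type (fun r => expR (Mweight c tau r)).
Proof.
move=> /ltW t0; case: c adm => [M A [wM wA]|M A [wM wA]|A wA|M wM|_] /=.
- exact: (assoc_exp_type wM t0).
- exact: (assoc_exp_type wM t0).
- exact: (log_exp_type t0).
- exact: (assoc_exp_type wM t0).
- exact: (log_exp_type t0).
Qed.

(** By (M.6) the factors h^n / M_n tolerate n! e^n for e = 1 / (h L0), and the spatial weight is at
    most exponential: exactly what the Gaussian bounds can match. Finite-order factors and
    polynomial weights satisfy the same conditions. *)
Let step_exp_type (s : step R d) : steps c s ->
  (exists2 e : R, 0 < e & exists K : R, forall n, s.1 n * ((n`!)%:R * e ^+ n) <= K) /\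
  exists C L : R, [/\ 0 < C, 0 <= L & forall x, s.2 x <= C * expR (L * enorm x)].
Proof.
have uf M (h : R) : weight_sequence M -> 0 < h -> exists2 e : R, 0 < e &
    exists K : R, forall n, ultra_factor M h n * ((n`!)%:R * e ^+ n) <= K.
  move=> wM h0; have [c0 [L0 [c1 L1 M6]]] := ws_M6 wM.
  have L00 : 0 < L0 by rewrite (lt_le_trans ltr01).
  have hL : 0 < h * L0 by rewrite mulr_gt0.
  have M0 := ws_gt0 wM.
  exists (h * L0)^-1; first by rewrite invr_gt0.
  exists c0 => n; rewrite /ultra_factor.
  have q : 0 <= h ^+ n / M n by rewrite divr_ge0 ?exprn_ge0 ?ltW.
  have p : 0 <= (h * L0)^-1 ^+ n by rewrite exprn_ge0// invr_ge0 ltW.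
  rewrite (le_trans (ler_wpM2l q (ler_wpM2r p (M6 n))))//.
  rewrite le_eqVlt; apply/orP; left; apply/eqP; rewrite exprVn exprMn; field.
  by rewrite ?expf_neq0 ?gt_eqF.
have of_ k : exists2 e : R, 0 < e &
    exists K : R, forall n, order_factor R k n * ((n`!)%:R * e ^+ n) <= K.
  exists 1 => //; exists (k`!)%:R => n; rewrite /order_factor expr1n mulr1.
  case: leqP => nk; last by rewrite mul0r.
  by rewrite mul1r ler_nat leq_fact.
have ew A (h : R) : weight_sequence A -> 0 <= h -> exists C L : R,
    [/\ 0 < C, 0 <= L & forall x, @exp_weight R d A h x <= C * expR (L * enorm x)].
  move=> wA h0; have [C [L [C0 L0 CP]]] := assoc_exp_type wA h0.
  by exists C, L; split => // x; rewrite CP// enorm_ge0.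
have pw k : exists C L : R,
    [/\ 0 < C, 0 <= L & forall x, @power_weight R d k x <= C * expR (L * enorm x)].
  have [C C0 CP] := power_le_expR R k.
  by exists C, 1; split => // x; rewrite mul1r CP// enorm_ge0.
case: c adm => [M A [wM wA]|M A [wM wA]|A wA|M wM|_] /= [h /= h0 <-] /=.
- by split; [exact: uf|apply: ew => //; exact: ltW].
- by split; [exact: uf|apply: ew => //; exact: ltW].
- by split; [exact: of_|exact: ew].
- by split; [apply: uf => //; rewrite ltr0n|exact: pw].
- by split; [exact: of_|exact: pw].
Qed.

Lemma gs_cgauss (s : 'I_d -> R) : (forall i, 0 < s i) -> gs_space c (cgauss s (fun=> 0%N)).
Proof.
move=> s0; apply/(gs_spaceP _ adm); split; first exact: smooth_cgauss.
have key t : steps c t -> exists K, bounded_by t (cgauss s (fun=> 0%N)) K.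
  move=> ct; have [[e e0 [K KP]] [C [L [C0 L0 CP]]]] := step_exp_type ct.
  have [t0 t1] := positive_steps adm ct.
  have [C' C'0 C'P] := gauss_bound s0 e0 L0.
  exists (C * (C' * K)) => a x; have [b -> ba] := cderiv_cgauss s a.
  rewrite nrm_cgauss -ba; set n := mlength b.
  have h : t.2 x * `|gauss s b x| <= C * (C' * ((n`!)%:R * e ^+ n)).
    rewrite (le_trans (ler_wpM2r (normr_ge0 _) (CP x)))// -mulrA ler_wpM2l ?(ltW C0)//.
    by rewrite mulrC C'P.
  rewrite (le_trans (ler_wpM2l (t0 n) h))// mulrCA ler_wpM2l ?(ltW C0)//.
  by rewrite mulrCA ler_wpM2l ?(ltW C'0).
case: ifP => [rc|_]; last exact: key.
have [t ct] : exists t : step R d, steps c t.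
  by case: c rc => // M A _; exists (ultra_factor M 1, @exp_weight R d A 1); exists 1 => /=.
by exists t => //; exact: key.
Qed.

End gaussians_in_space.

(** * Fourier transform *)

Section integration_by_parts.
Context (R : realType) (d : nat).
Local Notation V := 'rV[R]_d.
Implicit Types (f : Cfun R d) (x y xi : V) (i : 'I_d).

Lemma line_is_derive_at (f : V -> R) x (v : V) (h : R) : derivable f (h *: v + x) v ->
  is_derive h 1 (fun k : R => f (k *: v + x)) ('D_v f (h *: v + x)).
Proof.
move=> dv.
have E : (fun k : R => k^-1 *: (((fun k : R => f (k *: v + x)) \o shift h) (k *: (1 : R))
     - f (h *: v + x))) =
     (fun k : R => k^-1 *: ((f \o shift (h *: v + x)) (k *: v) - f (h *: v + x))).
  by apply/funext => k; rewrite /= scaler1 scalerDl addrA.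
by split; rewrite /derivable /derive E.
Qed.

Lemma increment_le (f : V -> R) x i (t K : R) : 0 < t ->
  (forall y, derivable f y 'e_i) ->
  (forall h, 0 <= h <= t -> `|'D_('e_i) f (h *: 'e_i + x)| <= K) ->
  `|f (t *: 'e_i + x) - f x| <= t * K.
Proof.
move=> t0 df fK; pose g (h : R) := f (h *: 'e_i + x).
have Dg (h : R) : is_derive h 1 g ('D_('e_i) f (h *: 'e_i + x)).
  exact: line_is_derive_at.
have cg : {within `[0, t], continuous g}.
  apply: continuous_subspaceT => h; apply: differentiable_continuous.
  by apply/derivable1_diffP; have [] := Dg h.
have [h ht gE] := MVT t0 (fun h _ => Dg h) cg.
have -> : f (t *: 'e_i + x) - f x = g t - g 0 by rewrite /g scale0r add0r.
rewrite gE subr0 normrM (ger0_norm (ltW t0)) mulrC ler_wpM2l ?(ltW t0)// fK//.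
by move: ht; rewrite in_itv/= => /andP[/ltW -> /ltW ->].
Qed.

Lemma MVT_le (g dg : R -> R) (a M : R) : 0 <= a ->
  (forall x : R, is_derive x (1 : R) g (dg x)) -> (forall x : R, 0 <= x <= a -> `|dg x| <= M) ->
  `|g a - g 0| <= a * M.
Proof.
rewrite le_eqVlt => /predU1P[<- _ _|a0 Dg gM]; first by rewrite subrr normr0 mul0r.
have cg : {within `[0, a], continuous g}.
  apply: continuous_subspaceT => h; apply: differentiable_continuous.
  by apply/derivable1_diffP; have [] := Dg h.
have [h ha ->] := MVT a0 (fun h _ => Dg h) cg.
rewrite subr0 normrM (ger0_norm (ltW a0)) mulrC ler_wpM2l ?(ltW a0)// gM//.
by move: ha; rewrite in_itv/= => /andP[/ltW -> /ltW ->].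
Qed.

Lemma sin_le_norm (a : R) : `|sin a| <= `|a|.
Proof.
wlog a0 : a / 0 <= a.
  move=> H; have [/H//|/ltW a0] := leP 0 a.
  by rewrite -normrN -sinN -[leRHS]normrN H// oppr_ge0.
have := @MVT_le sin cos a 1 a0 (fun r => is_derive_sin r) (fun r _ => cos_max r).
by rewrite sin0 subr0 mulr1 (ger0_norm a0).
Qed.

Lemma cos_sub1_le (a : R) : `|cos a - 1| <= a ^+ 2 /\ `|cos a - 1| <= `|a|.
Proof.
wlog a0 : a / 0 <= a.
  move=> H; have [/H//|/ltW a0] := leP 0 a.
  by rewrite -cosN -sqrrN -[`|a|]normrN; apply: H; rewrite oppr_ge0.
have h M : (forall x : R, 0 <= x <= a -> `|- sin x| <= M) -> `|cos a - 1| <= a * M.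
  by move=> /(MVT_le a0 (fun r => is_derive_cos r)); rewrite cos0.
split.
  rewrite expr2; apply: h => x /andP[x0 xa].
  by rewrite normrN (le_trans (sin_le_norm _))// ger0_norm.
rewrite (ger0_norm a0) -[leRHS]mulr1; apply: h => x _.
by rewrite normrN sin_max.
Qed.

Lemma sin_sub_le (a : R) : `|sin a - a| <= a ^+ 2.
Proof.
wlog a0 : a / 0 <= a.
  move=> H; have [/H//|/ltW a0] := leP 0 a.
  rewrite -normrN opprD -sinN -sqrrN; apply: H; by rewrite oppr_ge0.
have D (x : R) : is_derive x (1 : R) (sin - id) (cos x - 1).
  exact: is_deriveB (is_derive_sin x) (is_derive_id x 1).
have := @MVT_le (sin - id) (fun r => cos r - 1) a a a0 D.
rewrite [X in `|X|](_ : _ = sin a - a); last by rewrite !fctE sin0 !subr0.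
rewrite -expr2; apply => x /andP[x0 xa].
by rewrite (le_trans (cos_sub1_le _).2)// ger0_norm.
Qed.

Lemma cis_quadratic (a : R) : nrm (cis a - 1 - (0 +i* a)%C) <= 2 * a ^+ 2.
Proof.
rewrite (le_trans (nrm_le_ReIm _))//= oppr0 !addr0.
by rewrite mulr2n mulrDl mul1r lerD ?(cos_sub1_le a).1 ?sin_sub_le.
Qed.

Lemma cis_quotient (a u : R) : u != 0 ->
  nrm ((u^-1)%:C%C * (cis (a * u) - 1) - (0 +i* a)%C) <= 2 * a ^+ 2 * `|u|.
Proof.
move=> u0.
have -> : (u^-1)%:C%C * (cis (a * u) - 1) - (0 +i* a)%C =
    (u^-1)%:C%C * (cis (a * u) - 1 - (0 +i* (a * u))%C).
  rewrite [RHS]mulrBr; congr (_ - _).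
  by apply: complex_eqP; rewrite !ReImE/= !mul0r ?mulr0 ?subr0 ?add0r ?addr0// mulrCA mulVf ?mulr1.
rewrite nrmM nrm_real normfV mulrC ler_pdivrMr ?normr_gt0//.
rewrite (le_trans (cis_quadratic _))//.
by rewrite exprMn -[u ^+ 2]real_normK ?num_real// expr2 !mulrA.
Qed.

Lemma nrm_cpartial_increment f x i (t K : R) : 0 < t -> smooth f ->
  (forall h, 0 <= h <= t -> nrm (cpartial i f (h *: 'e_i + x)) <= K) ->
  nrm (f (t *: 'e_i + x) - f x) <= t * (2 * K).
Proof.
move=> t0 sf fK; rewrite (le_trans (nrm_le_ReIm _))// !ReImE.
rewrite mulr2n mulrDl mul1r mulrDr lerD//.
  apply: (increment_le (f := fun y => complex.Re (f y))) => // [y|h /fK].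
    by have [] := smooth_derivable i y sf.
  by apply: le_trans; exact: (normr_Re_le (cpartial i f _)).
apply: (increment_le (f := fun y => complex.Im (f y))) => // [y|h /fK].
  by have [] := smooth_derivable i y sf.
by apply: le_trans; exact: (normr_Im_le (cpartial i f _)).
Qed.

Lemma cpartial_quotient_cvg f x i (u : nat -> R) : smooth f ->
  (forall n, u n != 0) -> u n @[n --> \oo] --> 0 ->
  nrm (((u n)^-1)%:C%C * (f (u n *: 'e_i + x) - f x) - cpartial i f x) @[n --> \oo] --> 0.
Proof.
move=> sf u0 uc.
have key (g : V -> R) : derivable g x 'e_i ->
    `|(u n)^-1 * (g (u n *: 'e_i + x) - g x) - 'D_('e_i) g x| @[n --> \oo] --> 0.
  move=> dg; apply/norm_cvg0P/subr_cvg0.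
  have /cvgr_dnbhsP := dg.
  by move=> /(_ u); apply.
have [dr dj] := smooth_derivable i x sf.
apply: (@squeeze_cvgr _ _ _ _ (fun=> 0) (fun n =>
  `|(u n)^-1 * (complex.Re (f (u n *: 'e_i + x)) - complex.Re (f x))
     - 'D_('e_i) (fun y => complex.Re (f y)) x| +
  `|(u n)^-1 * (complex.Im (f (u n *: 'e_i + x)) - complex.Im (f x))
     - 'D_('e_i) (fun y => complex.Im (f y)) x|)).
- apply: nearW => n; rewrite nrm_ge0/= (le_trans (nrm_le_ReIm _))//.
  by rewrite !ReImE /= !mul0r subr0 addr0.
- exact: cvg_cst.
- rewrite -[X in _ --> X]addr0; apply: cvgD.
    exact: (key (fun y => complex.Re (f y)) dr).
  exact: (key (fun y => complex.Im (f y)) dj).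
Qed.

Definition fourier_kernel xi x : R[i] := cis (- (2 * pi * dotv x xi)).

Lemma dotvC x y : dotv x y = dotv y x.
Proof. by apply: eq_bigr => i _; rewrite mulrC. Qed.

Lemma cmeasurable_kernel xi : cmeasurable (fourier_kernel xi).
Proof.
have c : continuous (fun x : V => - (2 * pi * dotv x xi)).
  move=> x; apply: (@continuousN _ _ _ (fun x : V => 2 * pi * dotv x xi)).
  apply: (@continuousM _ _ (cst (2 * pi)) (fun x => dotv x xi)).
    exact: cst_continuous.
  rewrite (_ : (fun x => _) = dotv xi); last by apply/funext => y; rewrite dotvC.
  exact: continuous_dotv.
apply: cmeasurable_continuous => x /=.
  by apply: (@continuous_comp _ _ _ (fun x : V => - (2 * pi * dotv x xi)) cos);
    [exact: c|exact: continuous_cos].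
by apply: (@continuous_comp _ _ _ (fun x : V => - (2 * pi * dotv x xi)) sin);
    [exact: c|exact: continuous_sin].
Qed.

Lemma cintegrable_kernel xi f : cintegrable f ->
  cintegrable (fun x => fourier_kernel xi x * f x).
Proof.
move=> If; apply: (cintegrableM_bounded (K := 1)) => //; first exact: cmeasurable_kernel.
by move=> x; rewrite nrm_cis.
Qed.

Lemma nrm_fourier_le xi f (g : V -> R) : cintegrable f ->
  (lebesgue R d).-integrable setT (fun t => (g (vec_of_tuple t))%:E) ->
  (forall x, nrm (f x) <= g x) ->
  nrm (fourier f xi) <= Rintegral (lebesgue R d) setT (fun t => g (vec_of_tuple t)).
Proof.
move=> If ig fg; apply: nrm_cintegral_dominated => //; first exact: cintegrable_kernel.
by move=> x; rewrite nrmM nrm_cis mul1r.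
Qed.

(** Integration by parts without boundary terms: translation invariance computes the transform of
    the difference quotients in direction [i] exactly. As the increment tends to 0 it converges to
    the right-hand side, and by dominated convergence to the left-hand side. *)
Lemma fourier_cpartial f i xi (K : R) : 0 <= K -> smooth f ->
  (forall y, nrm (f y) <= K * rho y) ->
  (forall y, (1 + enorm y) ^+ (2 * d) * nrm (cpartial i f y) <= K) ->
  fourier (cpartial i f) xi = (0 +i* (2 * pi * xi 0 i))%C * fourier f xi.
Proof.
move=> K0 sf fK dfK.
have If : cintegrable f.
  exact: cintegrable_dominated (smooth_cmeasurable sf) (integrable_rhoZ d K) fK.
(* A shift from x to z by at most 1 satisfies 1 + |x| <= 3 (1 + |z|), which transfers the majorant
   of the derivative from the intermediate point z to x. *)
pose K' := K * 3 ^+ (2 * d).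
have K'0 : 0 <= K' by rewrite mulr_ge0 ?exprn_ge0.
have dK x h : 0 <= h <= 1 -> nrm (cpartial i f (h *: 'e_i + x)) <= K' * rho x.
  move=> /andP[h0 h1]; set z := _ + x.
  have zx : 1 + enorm x <= 3 * (1 + enorm z).
    have e1 : enorm (h *: 'e_i : V) <= 1.
      rewrite -(ler_pXn2r (_ : (0 < 2)%N)) ?nnegrE ?enorm_ge0// sqr_enorm expr1n.
      rewrite /dotv (bigD1 i)//= big1 ?addr0; last first.
        by move=> j ji; rewrite !mxE (negbTE ji)/= !mulr0.
      by rewrite !mxE !eqxx/= mulr1 mulr_ile1.
    have := enorm_le_max z x; rewrite [x - z](_ : _ = - (h *: 'e_i)); last first.
      by rewrite /z opprD addrCA subrr addr0.
    rewrite enormN.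
    have : Num.max (enorm (h *: 'e_i : V)) (enorm z) <= 1 + enorm z.
      by rewrite ge_max lerDr ler01 andbT (le_trans e1)// lerDl enorm_ge0.
    have := enorm_ge0 z; lra.
  have r1 := rho_power_ge1 x; have r0 := rho_ge0 x.
  have D0 := nrm_ge0 (cpartial i f z).
  apply: (@le_trans _ _ (nrm (cpartial i f z) * ((1 + enorm x) ^+ (2 * d) * rho x))).
    by rewrite ler_peMr.
  rewrite mulrA ler_wpM2r// /K'.
  apply: (@le_trans _ _ (nrm (cpartial i f z) * ((3 * (1 + enorm z)) ^+ (2 * d)))).
    by rewrite ler_wpM2l// lerXn2r ?nnegrE ?mulr_ge0 ?addr_ge0 ?enorm_ge0.
  rewrite exprMn mulrA mulrAC ler_wpM2r ?exprn_ge0// mulrC.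
  exact: dfK.
have mD : cmeasurable (cpartial i f) := smooth_cmeasurable (smooth_cpartial i sf).
pose u n : R := n.+1%:R^-1.
have u0 n : 0 < u n by rewrite invr_gt0.
have u1 n : u n <= 1 by rewrite invf_le1// ler1n.
have un n : u n != 0 by rewrite gt_eqF.
have uc : u n @[n --> \oo] --> 0 by exact: cvg_harmonic.
pose e := fourier_kernel xi.
pose q n := cintegral setT (fun x => e x * (((u n)^-1)%:C%C * (f (u n *: 'e_i + x) - f x))).
have Ih := cintegrable_kernel xi If.
have qE n : q n = ((u n)^-1)%:C%C * (cis (2 * pi * xi 0 i * u n) - 1) * fourier f xi.
  have -> : q n = ((u n)^-1)%:C%C * (cis (2 * pi * xi 0 i * u n) *
      cintegral setT (fun x => e (x + u n *: 'e_i) * f (x + u n *: 'e_i)) -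
      cintegral setT (fun x => e x * f x)).
    rewrite -cintegralZ//; last exact: (cintegrable_shift _ Ih).
    rewrite -cintegralB//; last first.
      by apply: cintegrableZ; exact: (cintegrable_shift _ Ih).
    rewrite -cintegralZ//; last first.
      have := cintegrable_lin (-1) Ih (cintegrableZ (cis (2 * pi * xi 0 i * u n)) (cintegrable_shift (u n *: 'e_i) Ih)).
      by congr cintegrable; apply/funext => x; rewrite mulN1r addrC.
    apply: eq_cintegral => x.
    rewrite mulrCA mulrBr mulrA; congr (_ * (_ * _ - _)); last by rewrite addrC.
    rewrite -cisD; congr cis.
    rewrite [dotv (x + _) xi]dotvC [x + _]addrC dotv_line [dotv xi x]dotvC.
    by ring.
  by rewrite (cintegral_shift _ Ih) -[RHS]mulrA mulrBl mul1r.
have q1 : nrm (q n - fourier (cpartial i f) xi) @[n --> \oo] --> 0.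
  (* The factor 2 arises because the real and imaginary parts of the increment are estimated
     separately. *)
  apply: (cintegral_dominated_cvg (g := fun x => 2 * (K' * rho x)) measurableT).
  - move=> n; apply: cmeasurableM; first exact: cmeasurable_kernel.
    apply: cmeasurableM; first exact: cmeasurable_cst.
    have := cmeasurableD (cmeasurable_affine 1 (u n *: 'e_i) (smooth_cmeasurable sf))
      (cmeasurableM (cmeasurable_cst d (-1)) (smooth_cmeasurable sf)).
    by congr cmeasurable; apply/funext => x; rewrite scale1r mulN1r [x + _]addrC.
  - by apply: cmeasurableM mD; exact: cmeasurable_kernel.
  - by under eq_fun do rewrite mulrA; exact: integrable_rhoZ.
  - move=> n x; rewrite nrmM nrm_cis mul1r nrmM nrm_real ger0_norm ?invr_ge0 ?(ltW (u0 n))//.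
    rewrite ler_pdivrMl//; apply: nrm_cpartial_increment => // h /andP[h0 hu].
    by apply: dK; rewrite h0 (le_trans hu).
  - move=> x; rewrite nrmM nrm_cis mul1r.
    have := dK x 0; rewrite lexx ler01 scale0r add0r => /(_ isT) h.
    by rewrite (le_trans h)// ler_peMl ?mulr_ge0 ?rho_ge0// ler1n.
  - move=> x; under eq_fun do rewrite -mulrBr nrmM nrm_cis mul1r.
    exact: cpartial_quotient_cvg.
have q2 : nrm (q n - (0 +i* (2 * pi * xi 0 i))%C * fourier f xi) @[n --> \oo] --> 0.
  apply: (@squeeze_cvgr _ _ _ _ (fun=> 0)
    (fun n => 2 * (2 * pi * xi 0 i) ^+ 2 * nrm (fourier f xi) * u n)).
  - apply: nearW => n; rewrite nrm_ge0/= qE -mulrBl nrmM [leRHS]mulrAC ler_wpM2r ?nrm_ge0//.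
    by rewrite (le_trans (cis_quotient _ (un n)))// ger0_norm// ?ltW.
  - exact: cvg_cst.
  - rewrite -[X in _ --> X](mulr0 (2 * (2 * pi * xi 0 i) ^+ 2 * nrm (fourier f xi))).
    by apply: cvgM => //; exact: cvg_cst.
have : nrm (fourier (cpartial i f) xi - (0 +i* (2 * pi * xi 0 i))%C * fourier f xi) <= 0.
  have /= := cvgD q1 q2; rewrite addr0 => /(_ _) q3.
  set D := nrm _; have : cst D n @[n --> \oo] --> D by exact: cvg_cst.
  move=> /ler_cvg_to /(_ q3); apply.
  by apply: nearW => n; rewrite (le_trans (nrm_dist_triangle (q n) _ _))// [X in X + _]nrm_distC.
rewrite le_eqVlt ltNge nrm_ge0 orbF => /eqP/nrm0_eq0/eqP.
by rewrite subr_eq0 => /eqP.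
Qed.

End integration_by_parts.

(** * Decay of the Fourier transform of a test function *)

Section fourier_decay.
Context (R : realType) (d : nat) (c : gs_class R).
Hypothesis adm : gs_admissible c.
Local Notation V := 'rV[R]_d.
Implicit Types (f : Cfun R d) (x y xi : V) (i : 'I_d).

Lemma cderiv_nseq f i n : cwderiv (nseq n i) f = cderiv (fun j => if j == i then n else 0%N) f.
Proof.
set a := fun j => _; rewrite cderiv_word; congr (cwderiv _ f); apply/esym.
have sa : size (multi_word (enum 'I_d) a) = n.
  rewrite size_multi_word /mlength (bigD1 i)//= /a eqxx big1 ?addn0// => j /negbTE.
  by move=> ->.
rewrite -[in RHS]sa; apply/all_pred1P/allP => j /flatten_mapP[k _].
by rewrite mem_nseq /= /a => /andP[+ /eqP ->]; case: eqP.
Qed.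

Lemma fourier_cwderiv f i n xi : gs_space c f ->
  fourier (cwderiv (nseq n i) f) xi = (0 +i* (2 * pi * xi 0 i))%C ^+ n * fourier f xi.
Proof.
move=> Sf; elim: n => [|n IH]; first by rewrite expr0 mul1r.
have [K K0 KP] := gs_rho adm (fun j => if j == i then n else 0%N) Sf.
have [K' K'P] := gs_decay adm (fun j => if j == i then n.+1 else 0%N) (2 * d) Sf.
rewrite -cderiv_nseq in KP; rewrite -cderiv_nseq in K'P.
rewrite /= (@fourier_cpartial _ _ _ i xi (Num.max K K')) ?IH ?exprS ?mulrA//.
- by rewrite le_max K0.
- by apply: smooth_cwderiv; exact: gs_smooth Sf.
- by move=> y; rewrite (le_trans (KP y))// ler_wpM2r ?rho_ge0// le_max lexx.
- by move=> y; rewrite (le_trans (K'P y))// le_max lexx orbT.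
Qed.

(** Pure derivatives in a single coordinate suffice: the n-th one multiplies the transform by (2 pi
    i xi_i)^n, and its L^1 norm is controlled by the step with one constant for all n. *)
Lemma fourier_step_bound f (s : step R d) (C K : R) : gs_space c f -> positive_step s ->
  0 <= C -> (forall y, (1 + enorm y) ^+ (2 * d) <= C * s.2 y) -> bounded_by s f K ->
  exists K', forall n i xi, s.1 n * ((2 * pi * `|xi 0 i|) ^+ n * nrm (fourier f xi)) <= K'.
Proof.
move=> Sf [s0 s1] C0 CP bf.
have K0 : 0 <= K.
  by apply: le_trans (bf (fun=> 0%N) 0); rewrite mulr_ge0// mulr_ge0 ?nrm_ge0// (le_trans _ (s1 _)).
pose I := Rintegral (lebesgue R d) setT (fun t => rho (vec_of_tuple t)).
have I0 : 0 <= I by apply: Rintegral_ge0 => t _; exact: rho_ge0.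
exists (K * C * I) => n i xi.
have -> : (2 * pi * `|xi 0 i|) ^+ n * nrm (fourier f xi) = nrm (fourier (cwderiv (nseq n i) f) xi).
  rewrite fourier_cwderiv// nrmM; congr (_ * _).
  elim: n => [|n IH]; first by rewrite !expr0 nrm_real normr1.
  by rewrite !exprS nrmM nrm_i normrM IH ger0_norm// mulr_ge0// pi_ge0.
(* The coefficient vanishes for the high orders of a finite-order step. *)
have [sn|sn] := eqVneq (s.1 n) 0; first by rewrite sn mul0r !mulr_ge0.
have spos : 0 < s.1 n by rewrite lt_def sn s0.
rewrite cderiv_nseq; set a := fun j => _.
have an : mlength a = n.
  rewrite /mlength (bigD1 i)//= /a eqxx big1 ?addn0// => j /negbTE.
  by move=> ->.
have fa y : nrm (cderiv a f y) <= (K * C / s.1 n) * rho y.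
  have := bf a y; rewrite an; set D := nrm _ => h.
  have D0 : 0 <= D by exact: nrm_ge0.
  have r0 := rho_ge0 y.
  rewrite mulrAC ler_pdivlMr// mulrC.
  apply: (@le_trans _ _ (s.1 n * D * ((1 + enorm y) ^+ (2 * d) * rho y))).
    by rewrite ler_peMr ?mulr_ge0// rho_power_ge1.
  rewrite mulrA ler_wpM2r//.
  rewrite (le_trans (ler_wpM2l (mulr_ge0 (s0 n) D0) (CP y)))//.
  rewrite (_ : _ * _ * (C * _) = (s.1 n * (s.2 y * D)) * C); last by ring.
  by rewrite ler_wpM2r.
have ma : cmeasurable (cderiv a f).
  by apply: smooth_cmeasurable; rewrite cderiv_word; apply: smooth_cwderiv; exact: gs_smooth Sf.
have Ia := cintegrable_dominated ma (integrable_rhoZ d (K * C / s.1 n)) fa.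
have := nrm_fourier_le xi Ia (integrable_rhoZ d (K * C / s.1 n)) fa.
rewrite RintegralZl//; last exact: integrable_rho.
move=> /(ler_wpM2l (s0 n))/le_trans; apply.
by rewrite le_eqVlt; apply/orP; left; apply/eqP; rewrite /I; field.
Qed.

(** Some coordinate attains the sup norm, which costs the factor [d] against the Euclidean norm; the
    first alternative covers the zero vector and with it dimension 0. *)
Let norm_attained xi : enorm xi = 0 \/ exists i, enorm xi <= d%:R * `|xi 0 i|.
Proof.
have [n0|/mx_norm_neq0[[j i] /= E]] := eqVneq (mx_norm xi) 0.
  left; apply/eqP; rewrite eq_le enorm_ge0 andbT.
  by rewrite (le_trans (enorm_le_norm xi))// [X in _ * X]n0 mulr0.
right; exists i; rewrite (le_trans (enorm_le_norm xi))// ler_wpM2l//.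
by rewrite -[leLHS]/(mx_norm xi) E ord1.
Qed.

(** The weight is the supremum over n of (tau |xi|)^n / M_n, and h >= d tau gives tau |xi| <= h
    |xi_i| for a suitable coordinate. *)
Let assoc_decay f M (tau h K : R) : weight_sequence M -> 0 < tau -> d%:R * tau <= h ->
  (forall n i xi, ultra_factor M h n * ((2 * pi * `|xi 0 i|) ^+ n * nrm (fourier f xi)) <= K) ->
  exists K', forall xi, nrm (fourier f xi) * expR (assoc_fun M (tau * enorm xi)) <= K'.
Proof.
move=> wM t0 th fK.
have M0 := ws_gt0 wM.
have pi1 : 1 <= 2 * pi :> R by have := pi_ge2 R; lra.
exists (Num.max K (nrm (fourier f 0))) => xi.
have [->|F0] := eqVneq (nrm (fourier f xi)) 0.
  by rewrite mul0r le_max nrm_ge0 orbT.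
have Fp : 0 < nrm (fourier f xi) by rewrite lt_def F0 nrm_ge0.
rewrite mulrC -ler_pdivlMr//.
apply: expR_assoc_fun_le => //; first by rewrite mulr_ge0 ?enorm_ge0// ltW.
move=> n; rewrite ler_pdivlMr//.
have [x0|[i xi_i]] := norm_attained xi.
  have -> : xi = 0.
    apply/rowP => j; rewrite mxE; apply/normr0_eq0/eqP; rewrite eq_le normr_ge0 andbT.
    by rewrite -x0 normr_le_enorm.
  have -> : enorm (0 : V) = 0.
    by rewrite /enorm /dotv big1 ?sqrtr0// => j _; rewrite mxE mul0r.
  rewrite mulr0 expr0n; case: n => [|n]; last by rewrite !mul0r le_max nrm_ge0 orbT.
  by rewrite (ws_0 wM) divr1 mul1r le_max lexx orbT.
rewrite (le_trans _ (_ : K <= _))//; last by rewrite le_max lexx.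
apply: le_trans (fK n i xi); rewrite /ultra_factor mulrA ler_wpM2r ?nrm_ge0//.
rewrite mulrAC ler_pM2r ?invr_gt0// -exprMn.
have d0 : 0 <= d%:R :> R by exact: ler0n.
have a0 : 0 <= `|xi 0 i| by [].
have h0 : 0 <= h by rewrite (le_trans _ th)// mulr_ge0// ltW.
rewrite lerXn2r ?nnegrE ?mulr_ge0 ?enorm_ge0 ?pi_ge0 ?(ltW t0)//.
rewrite (le_trans (ler_wpM2l (ltW t0) xi_i))//.
rewrite mulrA [tau * _]mulrC (le_trans (ler_wpM2r a0 th))//.
by rewrite ler_wpM2l// ler_peMl.
Qed.

(** Here the weight is (1 + |xi|)^tau, so the orders 0 and [n] suffice. *)
Let order_decay f (tau K : R) n : 0 < tau -> tau <= n%:R ->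
  (forall i xi, (2 * pi * `|xi 0 i|) ^+ n * nrm (fourier f xi) <= K) ->
  (forall xi, nrm (fourier f xi) <= K) ->
  exists K', forall xi, nrm (fourier f xi) * expR (log_weight tau (enorm xi)) <= K'.
Proof.
move=> t0 tn fK fK0.
have pi1 : 1 <= 2 * pi :> R by have := pi_ge2 R; lra.
exists (2 ^+ n * (K + d%:R ^+ n * K)) => xi.
have F0 := nrm_ge0 (fourier f xi).
have x0 := enorm_ge0 xi.
have K0 : 0 <= K by exact: le_trans (fK0 xi).
have -> : log_weight tau (enorm xi) = tau * ln (1 + enorm xi).
  by rewrite /log_weight ger0_norm.
have l1 : 1 + enorm xi \is Num.pos by rewrite posrE ltr_wpDr.
have e1 : expR (tau * ln (1 + enorm xi)) <= (1 + enorm xi) ^+ n.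
  rewrite -[in leRHS](lnK l1) -expRM_natl ler_expR ler_wpM2r//.
  by rewrite ln_ge0// lerDl.
rewrite (le_trans (ler_wpM2l F0 e1))//.
have e2 : (1 + enorm xi) ^+ n <= 2 ^+ n * (1 + enorm xi ^+ n).
  have [y1|y1] := leP (enorm xi) 1.
    apply: (@le_trans _ _ (2 ^+ n)).
      by rewrite lerXn2r ?nnegrE ?addr_ge0//; lra.
    by rewrite ler_peMr ?exprn_ge0// lerDl exprn_ge0.
  apply: (@le_trans _ _ ((2 * enorm xi) ^+ n)).
    by rewrite lerXn2r ?nnegrE ?addr_ge0 ?mulr_ge0//; lra.
  by rewrite exprMn ler_wpM2l ?exprn_ge0// lerDr.
rewrite (le_trans (ler_wpM2l F0 e2))// mulrCA ler_wpM2l ?exprn_ge0//.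
rewrite mulrDr mulr1 lerD//.
have [->|[i xi_i]] := norm_attained xi.
  rewrite expr0n; case: (n) => [|m].
    by rewrite mulr1 expr0 mul1r.
  by rewrite mulr0 mulr_ge0 ?exprn_ge0.
have d0 : 0 <= d%:R :> R by exact: ler0n.
apply: le_trans (ler_wpM2l (exprn_ge0 n d0) (fK i xi)).
rewrite mulrA mulrC ler_wpM2r// -exprMn lerXn2r ?nnegrE ?mulr_ge0 ?pi_ge0//.
by rewrite (le_trans xi_i)// ler_wpM2l// ler_peMl.
Qed.

(** The quantifier over tau is opposite to the one in the growth condition on the weight of
    modulations, so a common tau can always be found. *)
Lemma fourier_decay f : gs_space c f ->
  let decays tau := exists K, forall xi,
    nrm (fourier f xi) * expR (Mweight c tau (enorm xi)) <= K in
  if is_roumieu c then exists2 tau : R, 0 < tau & decays tau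
  else forall tau : R, 0 < tau -> decays tau.
Proof.
move=> Sf; have /gs_spaceP - /(_ adm)[sf h] := Sf.
have stp := fun s cs => @positive_steps R d c s adm cs.
have bnd (x : R) : exists2 n : nat, (0 < n)%N & x <= n%:R.
  exists (Num.bound `|x|).+1 => //; rewrite (le_trans (ler_norm _))//.
  by rewrite (le_trans (ltW (archi_boundP (normr_ge0 x))))// ler_nat.
move: stp h; have Sf' := Sf; move: Sf'; have adm' := adm; move: adm'.
rewrite /Mweight; case: (c) => [M A|M A|A|M|] /=.
- move=> [wM wA] Sf' stp h tau t0.
  (* The summand 1 keeps the parameter positive when d = 0. *)
  pose k := d%:R * tau + 1.
  have k0 : 0 < k by rewrite ltr_wpDl// mulr_ge0// ltW.
  have cs : steps (GSBeurling M A) (ultra_factor M k, @exp_weight R d A k) by exists k.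
  have [K bK] := h _ cs.
  have [C C0 CP] := power_le_exp d (2 * d) wA k0.
  have [K' K'P] := fourier_step_bound Sf (stp _ cs) (ltW C0) CP bK.
  by apply: (assoc_decay wM t0 (h := k) (K := K')) => //; rewrite lerDl.
- move=> [wM wA] Sf' stp [_ [k /= k0 <-] [K bK]].
  have cs : steps (GSRoumieu M A) (ultra_factor M k, @exp_weight R d A k) by exists k.
  have [C C0 CP] := power_le_exp d (2 * d) wA k0.
  have [K' K'P] := fourier_step_bound Sf (stp _ cs) (ltW C0) CP bK.
  have t0 : 0 < k / (d%:R + 1) by rewrite divr_gt0// ltr_wpDl.
  exists (k / (d%:R + 1)) => //.
  apply: (assoc_decay wM t0 (h := k) (K := K')) => //.
  by rewrite mulrCA ler_piMr ?(ltW k0)// ler_pdivrMr ?ltr_wpDl// mul1r lerDl.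
- move=> wA Sf' stp h tau t0.
  have [n n0 tn] := bnd tau.
  have cs : steps (GSSmoothBeurling A) (order_factor R n, @exp_weight R d A n%:R) by exists n.
  have [K bK] := h _ cs.
  have k0 : 0 < n%:R :> R by rewrite ltr0n.
  have [C C0 CP] := power_le_exp d (2 * d) wA k0.
  have [K' K'P] := fourier_step_bound Sf (stp _ cs) (ltW C0) CP bK.
  have [K2 K20 K2P] := gs_rho adm (fun=> 0%N) Sf.
  have If := gs_cintegrable adm Sf.
  rewrite cderiv0 in K2P.
  have F0 xi := nrm_fourier_le xi If (integrable_rhoZ d K2) K2P.
  set J := Rintegral _ _ _ in F0.
  apply: (order_decay (K := Num.max K' J) t0 tn) => [i xi|xi].
    by have := K'P n i xi; rewrite /= /order_factor leqnn mul1r le_max => ->.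
  by rewrite le_max F0 orbT.
- move=> wM Sf' stp h tau t0.
  have [n n0 tn] := bnd (d%:R * tau + (2 * d)%:R).
  have dn : (2 * d <= n)%N.
    by rewrite -(ler_nat R) (le_trans _ tn)// lerDr mulr_ge0// ltW.
  have cs : steps (GSBeurlingTempered M) (ultra_factor M n%:R, @power_weight R d n) by exists n.
  have [K bK] := h _ cs.
  have CP y : (1 + enorm y) ^+ (2 * d) <= 1 * @power_weight R d n y.
    by rewrite mul1r ler_weXn2l// lerDl enorm_ge0.
  have [K' K'P] := fourier_step_bound Sf (stp _ cs) ler01 CP bK.
  apply: (assoc_decay wM t0 (h := n%:R) (K := K')) => //.
  by rewrite (le_trans _ tn)// lerDl.
- move=> _ Sf' stp h tau t0.
  have [n n0 tn] := bnd (tau + (2 * d)%:R).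
  have dn : (2 * d <= n)%N.
    by rewrite -(ler_nat R) (le_trans _ tn)// lerDr ltW.
  have cs : steps (@GSSchwartz R) (order_factor R n, @power_weight R d n) by exists n.
  have [K bK] := h _ cs.
  have CP y : (1 + enorm y) ^+ (2 * d) <= 1 * @power_weight R d n y.
    by rewrite mul1r ler_weXn2l// lerDl enorm_ge0.
  have [K' K'P] := fourier_step_bound Sf (stp _ cs) ler01 CP bK.
  have [K2 K20 K2P] := gs_rho adm (fun=> 0%N) Sf.
  have If := gs_cintegrable adm Sf.
  rewrite cderiv0 in K2P.
  have F0 xi := nrm_fourier_le xi If (integrable_rhoZ d K2) K2P.
  set J := Rintegral _ _ _ in F0.
  have tn' : tau <= n%:R by rewrite (le_trans _ tn)// lerDl.
  apply: (order_decay (K := Num.max K' J) t0 tn') => [i xi|xi].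
    by have := K'P n i xi; rewrite /= /order_factor leqnn mul1r le_max => ->.
  by rewrite le_max F0 orbT.
Qed.

End fourier_decay.

(** * The Fourier transform of a Gaussian *)

Section gaussian_fourier.
Context (R : realType) (d : nat).
Local Notation V := 'rV[R]_d.
Implicit Types (f : Cfun R d) (x y xi : V) (i : 'I_d).

Lemma is_derive_quadratic (r : R -> R) (a C : R) :
  (forall u, `|r u - r 0 - u * a| <= C * u ^+ 2) -> is_derive (0 : R) (1 : R) r a.
Proof.
move=> rC.
have cv : (fun h : R => h^-1 *: ((r \o shift (0 : R)) (h *: (1 : R)) - r 0)) @ (0 : R)^' --> a.
  apply/cvgr_dnbhsP => u [u0 uc].
  apply/subr_cvg0/norm_cvg0P.
  apply: (@squeeze_cvgr _ _ _ _ (fun=> 0) (fun n => C * `|u n|)).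
  - apply: nearW => n; rewrite normr_ge0/= addr0 scaler1.
    rewrite (_ : _ - a = (u n)^-1 * (r (u n) - r 0 - u n * a)); last first.
      by rewrite mulrBr mulKf.
    rewrite normrM normfV mulrC ler_pdivrMr ?normr_gt0// (le_trans (rC _))//.
    by rewrite -mulrA -expr2 real_normK ?num_real.
  - exact: cvg_cst.
  - rewrite -[X in _ --> X](mulr0 C); apply: cvgM; first exact: cvg_cst.
    by apply/norm_cvg0P.
by split; [apply/cvg_ex; exists a|apply/cvg_lim].
Qed.

Lemma partials0_const (k : V -> R) :
  (forall x i, is_derive x 'e_i k 0) -> forall x, k x = k 0.
Proof.
move=> dk.
have shift1 x i (h : R) : k (h *: 'e_i + x) = k x.
  have D (u : R) : is_derive u (1 : R) (fun u => k (u *: 'e_i + x)) 0.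
    by have [dx dx0] := dk (u *: 'e_i + x) i; rewrite -dx0; exact: line_is_derive_at.
  by have := is_derive_0_is_cst h 0 D; rewrite scale0r add0r.
move=> x; rewrite [X in k X = _]row_sum_delta.
elim: (index_enum _) => [|i r IH]; first by rewrite big_nil.
by rewrite big_cons shift1.
Qed.

Variable s : 'I_d -> R.
Hypothesis s0 : forall i, 0 < s i.

Let z0 : 'I_d -> nat := fun=> 0%N.
Let G := gauss s z0.
Let cG := cgauss s z0.
Let Gh := fourier cG.
Let s' i := pi ^+ 2 / s i.

Let cG_rho a : exists2 K : R, 0 <= K & forall x, nrm (cgauss s a x) <= K * rho x.
Proof.
have [K K0 KP] := gauss_rho a s0 (lexx 0); exists K => // x.
by rewrite nrm_cgauss; have := KP x; rewrite mul0r expR0 mulr1.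
Qed.

Let cG_int a : cintegrable (cgauss s a).
Proof.
have [K K0 KP] := cG_rho a.
exact: cintegrable_dominated (smooth_cmeasurable (@smooth_cgauss R d s a)) (integrable_rhoZ d K) KP.
Qed.

Let gauss1 a i x : a i = 0%N -> gauss s (incr_index a i) x = - (2 * s i * x 0 i) * gauss s a x.
Proof.
move=> ai; rewrite /gauss (bigD1 i)//= [in RHS](bigD1 i)//= /incr_index eqxx ai add0n.
have -> z : hermite (s i) 1 z = - (2 * s i * z) * hermite (s i) 0 z by rewrite /= subr0.
rewrite -[LHS]mulrA; congr (_ * (_ * _)).
by apply: eq_bigr => j /negbTE ->; rewrite addn0.
Qed.

Let xG i : cintegrable (fun x => (x 0 i)%:C%C * cG x).
Proof.
have := cintegrableZ (- (2 * s i)^-1)%:C%C (cG_int (incr_index z0 i)).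
congr cintegrable; apply/funext => x; rewrite /cG /cgauss gauss1// -!rmorphM/=; congr (_%:C%C).
by field; rewrite gt_eqF.
Qed.

(** As x_i G is a multiple of the partial derivative of G, its transform is a multiple of xi_i times
    that of G. *)
Let fourier_xG i xi : fourier (fun x => (x 0 i)%:C%C * cG x) xi =
  (0 +i* (- (pi * xi 0 i / s i)))%C * Gh xi.
Proof.
have E : (fun x : V => (x 0 i)%:C%C * cG x) =
    (fun x => (- (2 * s i)^-1)%:C%C * cpartial i cG x).
  apply/funext => x; rewrite cpartial_cgauss /cG /cgauss gauss1// -!rmorphM/=; congr (_%:C%C).
  by field; rewrite gt_eqF.
have [K K0 KP] := cG_rho z0.
have [K' K'0 K'P] := gauss_rho (incr_index z0 i) s0 ler01.
have [C C0 CP] := power_le_expR R (2 * d).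
have FE : fourier (cpartial i cG) xi = (0 +i* (2 * pi * xi 0 i))%C * Gh xi.
  apply: (@fourier_cpartial _ _ _ i xi (Num.max K (C * K'))).
  - by rewrite le_max K0.
  - exact: smooth_cgauss.
  - by move=> y; rewrite (le_trans (KP y))// ler_wpM2r ?rho_ge0// le_max lexx.
  - move=> y; rewrite cpartial_cgauss nrm_cgauss le_max; apply/orP; right.
    rewrite (le_trans (ler_wpM2r (normr_ge0 _) (CP _ (enorm_ge0 y))))//.
    have := K'P y; rewrite mul1r => K'y.
    rewrite -mulrA ler_wpM2l ?(ltW C0)// mulrC (le_trans K'y)// ler_piMr// /rho.
    elim/big_rec: _ => // j u _ u1; rewrite mulrC.
    have p : 0 < 1 + y 0 j ^+ 2 by rewrite ltr_wpDr// sqr_ge0.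
    by rewrite ler_pdivrMr// mul1r (le_trans u1)// lerDl sqr_ge0.
have I1 : cintegrable (fun x => fourier_kernel xi x * cpartial i cG x).
  by apply: cintegrable_kernel; rewrite cpartial_cgauss.
rewrite E /fourier.
rewrite (_ : (fun x => _) = (fun x => (- (2 * s i)^-1)%:C%C * (fourier_kernel xi x * cpartial i cG x))).
  rewrite cintegralZ// -[cintegral _ _]/(fourier (cpartial i cG) xi) FE mulrA; congr (_ * _).
  by apply: complex_eqP; rewrite !ReImE/=; field; rewrite gt_eqF.
by apply/funext => x; rewrite mulrCA.
Qed.

(** Differentiation under the integral sign in quantitative form: the remainder of the character
    after its linear term is at most quadratic in u x_i, and x_i^2 G is integrable. *)
Let quad_bound i xi : exists C, forall u : R,
  nrm (Gh (u *: 'e_i + xi) - Gh xi - u%:C%C * ((0 +i* (- (2 * pi)))%C *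
    fourier (fun x => (x 0 i)%:C%C * cG x) xi)) <= C * u ^+ 2.
Proof.
have [C1 C10 C1P] := power_le_expR R 2.
have [K K0 KP] := gauss_rho z0 s0 ler01.
pose I := Rintegral (lebesgue R d) setT (fun t => rho (vec_of_tuple t)).
exists (2 * (2 * pi) ^+ 2 * (C1 * K) * I) => u.
have Ik xi' := cintegrable_kernel xi' (cG_int z0).
have Ix := cintegrable_kernel xi (xG i).
pose h x := fourier_kernel (u *: 'e_i + xi) x * cG x - fourier_kernel xi x * cG x -
   (u%:C%C * (0 +i* (- (2 * pi)))%C) * (fourier_kernel xi x * ((x 0 i)%:C%C * cG x)).
have Ih1 : cintegrable (fun x => fourier_kernel (u *: 'e_i + xi) x * cG x - fourier_kernel xi x * cG x).
  have := cintegrable_lin (-1) (Ik xi) (Ik (u *: 'e_i + xi)).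
  by congr cintegrable; apply/funext => x; rewrite mulN1r addrC.
have Ih2 := cintegrableZ (u%:C%C * (0 +i* (- (2 * pi)))%C) Ix.
have Ih : cintegrable h.
  have := cintegrable_lin (-1) Ih2 Ih1.
  by congr cintegrable; apply/funext => x; rewrite mulN1r addrC.
have -> : Gh (u *: 'e_i + xi) - Gh xi - u%:C%C * ((0 +i* (- (2 * pi)))%C *
    fourier (fun x => (x 0 i)%:C%C * cG x) xi) = cintegral setT h.
  rewrite /h cintegralB// cintegralB//.
  by rewrite cintegralZ// mulrA.
have hb x : nrm (h x) <= (2 * (2 * pi) ^+ 2 * (C1 * K) * u ^+ 2) * rho x.
  pose b : R := - (2 * pi * (u * x 0 i)).
  have -> : h x = fourier_kernel xi x * (cis b - 1 - (0 +i* b)%C) * cG x.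
    rewrite /h [fourier_kernel (_ + xi) x](_ : _ = fourier_kernel xi x * cis b); last first.
      by rewrite -cisD; congr cis; rewrite dotv_line /b [dotv x xi]dotvC; ring.
    rewrite [(0 +i* b)%C](_ : _ = u%:C%C * (0 +i* (- (2 * pi)))%C * (x 0 i)%:C%C).
      by ring.
    by apply: complex_eqP; rewrite !ReImE/= /b; ring.
  rewrite !nrmM nrm_cis mul1r nrm_cgauss.
  rewrite (le_trans (ler_wpM2r (normr_ge0 _) (cis_quadratic b)))//.
  have -> : 2 * b ^+ 2 = 2 * (2 * pi) ^+ 2 * u ^+ 2 * x 0 i ^+ 2 by rewrite /b; ring.
  have q : 0 <= 2 * (2 * pi) ^+ 2 * u ^+ 2 :> R.
    by rewrite mulr_ge0 ?sqr_ge0// mulr_ge0 ?sqr_ge0.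
  rewrite -[leLHS]mulrA (_ : _ * (C1 * K) * _ * _ = 2 * (2 * pi) ^+ 2 * u ^+ 2 * (C1 * (K * rho x))); last by ring.
  rewrite ler_wpM2l//.
  apply: (@le_trans _ _ ((1 + enorm x) ^+ 2 * `|G x|)).
    rewrite ler_wpM2r// -real_normK ?num_real// lerXn2r ?nnegrE ?addr_ge0 ?enorm_ge0//.
    by rewrite (le_trans (normr_le_enorm x i))// lerDr.
  rewrite (le_trans (ler_wpM2r (normr_ge0 _) (C1P _ (enorm_ge0 x))))// -mulrA.
  have := KP x; rewrite mul1r => Kx.
  by rewrite ler_wpM2l ?(ltW C10)// mulrC.
rewrite (le_trans (nrm_cintegral_dominated measurableT Ih (integrable_rhoZ d _) hb))//.
rewrite RintegralZl//; last exact: integrable_rho.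
by rewrite le_eqVlt; apply/orP; left; apply/eqP; rewrite /I; ring.
Qed.

(** The transform satisfies the differential equations of a Gaussian with parameters pi^2 / s_i. *)
Let derive_Gh i xi :
  is_derive xi 'e_i (fun y => complex.Re (Gh y)) (- (2 * s' i * xi 0 i) * complex.Re (Gh xi)) /\
  is_derive xi 'e_i (fun y => complex.Im (Gh y)) (- (2 * s' i * xi 0 i) * complex.Im (Gh xi)).
Proof.
have [C CP] := quad_bound i xi; rewrite fourier_xG in CP.
have E : (0 +i* (- (2 * pi)))%C * ((0 +i* (- (pi * xi 0 i / s i)))%C * Gh xi) =
    (- (2 * s' i * xi 0 i))%:C%C * Gh xi.
  by rewrite mulrA; congr (_ * _); apply: complex_eqP; rewrite !ReImE/= /s'; ring.
rewrite E in CP; split; apply: is_derive_line; apply: (@is_derive_quadratic _ _ C) => u.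
  rewrite scale0r add0r; apply: le_trans (CP u); rewrite -[X in _ <= X]/(nrm _).
  apply: le_trans (normr_Re_le _); rewrite !ReImE/=.
  by rewrite le_eqVlt; apply/orP; left; apply/eqP; congr (`|_|); ring.
rewrite scale0r add0r; apply: le_trans (CP u).
apply: le_trans (normr_Im_le _); rewrite !ReImE/=.
by rewrite le_eqVlt; apply/orP; left; apply/eqP; congr (`|_|); ring.
Qed.

Let inverse_gauss xi : gauss (fun i => - s' i) z0 xi * gauss s' z0 xi = 1.
Proof.
rewrite /gauss -big_split/= big1// => i _.
by rewrite -expRD mulNr opprK subrr expR0.
Qed.

(** Multiplication by the reciprocal Gaussian, with parameters of the opposite sign, yields a
    function with vanishing partial derivatives. *)
Let gaussian_ode (k : V -> R) :
  (forall x i, is_derive x 'e_i k (- (2 * s' i * x 0 i) * k x)) ->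
  forall xi, k xi = k 0 * gauss s' z0 xi.
Proof.
move=> dk xi; pose H := gauss (fun i => - s' i) z0.
have dH x i : is_derive x 'e_i H (2 * s' i * x 0 i * H x).
  have := is_derive_gauss (fun i => - s' i) z0 x i.
  have -> : gauss (fun i => - s' i) (incr_index z0 i) x = 2 * s' i * x 0 i * H x.
    rewrite /H /gauss (bigD1 i)//= [in RHS](bigD1 i)//= /incr_index eqxx.
    have -> z : hermite (- s' i) 1 z = 2 * s' i * z * hermite (- s' i) 0 z.
      by rewrite /= subr0; congr (_ * _); ring.
    rewrite -[LHS]mulrA; congr (_ * (_ * _)).
    by apply: eq_bigr => j /negbTE ->; rewrite addn0.
  exact.
have dKH x i : is_derive x 'e_i (k * H) 0.
  have := is_deriveM (dk x i) (dH x i).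
  move=> D; apply: is_derive_eq D _.
  rewrite -[X in X + _]/(k x * (2 * s' i * x 0 i * H x)) -[X in _ + X]/(H x * (- (2 * s' i * x 0 i) * k x)).
  by ring.
have KH := partials0_const dKH xi.
have H0 : H 0 = 1.
  by rewrite /H /gauss big1// => i _; rewrite /= mxE expr0n/= mulr0 oppr0 expR0.
have {KH} KH : k xi * H xi = k 0 by have := KH; rewrite !fctE H0 mulr1.
by rewrite -KH -mulrA inverse_gauss mulr1.
Qed.

(** The value at 0, the Gaussian integral, is left unevaluated: it only matters that the transform
    is a multiple of a Gaussian. *)
Lemma fourier_cgauss xi :
  fourier (cgauss s (fun=> 0%N)) xi =
  fourier (cgauss s (fun=> 0%N)) 0 * cgauss (fun i => pi ^+ 2 / s i) (fun=> 0%N) xi.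
Proof.
have r := gaussian_ode (fun x i => (derive_Gh i x).1) xi.
have j := gaussian_ode (fun x i => (derive_Gh i x).2) xi.
by apply: complex_eqP; rewrite !ReImE/= mulr0 ?subr0 ?add0r; [exact: r|exact: j].
Qed.

End gaussian_fourier.

(** * Density of the Gaussians in weighted spaces of integrable functions *)

Section threshold.
Context (R : realType).

(** With w the square root of z, Bernoulli's inequality bounds n w^n, and the other factor w^n tends
    to 0. *)
Lemma cvg_natmul_expr (z : R) : 0 <= z < 1 -> n%:R * z ^+ n @[n --> \oo] --> 0.
Proof.
move=> /andP[z0 z1].
have [->|zn0] := eqVneq z 0.
  apply: (@cvg_trans _ (cst 0 n @[n --> \oo])); last exact: cvg_cst.
  by apply: near_eq_cvg; apply: nearW => -[|n]; rewrite ?mul0r// expr0n mulr0.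
have zp : 0 < z by rewrite lt_def zn0.
pose w := Num.sqrt z.
have w0 : 0 < w by rewrite sqrtr_gt0.
have w1 : w < 1 by rewrite -sqrtr1 ltr_sqrt.
have zw : z = w * w by rewrite -expr2 sqr_sqrtr.
pose x := w^-1 - 1.
have x0 : 0 < x by rewrite subr_gt0 invf_gt1.
have bern n : n%:R * w ^+ n <= x^-1.
  have h : 1 + n%:R * x <= (w ^+ n)^-1.
    rewrite -exprVn (_ : w^-1 = 1 + x); last by rewrite /x addrC subrK.
    elim: n => [|n IH]; first by rewrite mul0r addr0 expr0.
    have x1 : 0 <= 1 + x by rewrite addr_ge0// ltW.
    rewrite exprS (le_trans _ (ler_wpM2l x1 IH))//.
    have := ler0n R n; rewrite -natr1; nra.
  have wn : 0 < w ^+ n by rewrite exprn_gt0.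
  have := ler_wpM2r (ltW wn) h; rewrite mulVf ?gt_eqF// => h2.
  by rewrite -[leRHS]mul1r ler_pdivlMr//; nra.
apply: (@squeeze_cvgr _ _ _ _ (fun=> 0) (fun n => x^-1 * w ^+ n)).
- apply: nearW => n; rewrite mulr_ge0 ?exprn_ge0//=.
  by rewrite zw exprMn mulrA ler_wpM2r ?exprn_ge0 ?(ltW w0).
- exact: cvg_cst.
- rewrite -[X in _ --> X](mulr0 x^-1); apply: cvgM; first exact: cvg_cst.
  by apply: cvg_expr; rewrite ger0_norm// ltW.
Qed.

Lemma bernoulli_lower (u : R) N : 0 <= u <= 1 -> 1 - N%:R * u <= (1 - u) ^+ N.
Proof.
move=> /andP[u0 u1]; elim: N => [|N IH]; first by rewrite mul0r subr0 expr0.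
have v0 : 0 <= 1 - u by rewrite subr_ge0.
rewrite exprS (le_trans _ (ler_wpM2l v0 IH))//.
have := ler0n R N; rewrite -natr1; nra.
Qed.

Lemma bernoulli_upper (u : R) N : 0 <= u <= 1 -> (1 - u) ^+ N * (1 + N%:R * u) <= 1.
Proof.
move=> /andP[u0 u1]; have v0 : 0 <= 1 - u by rewrite subr_ge0.
elim: N => [|N IH]; first by rewrite expr0 mul0r addr0 mulr1.
apply: le_trans IH; rewrite exprSr -mulrA ler_wpM2l ?exprn_ge0//.
have := ler0n R N; rewrite -natr1; nra.
Qed.

(** With N = n 2^n one has N y^n = n (2 y)^n, which tends to 0 for y < 1/2 and is at least n
    otherwise; the two Bernoulli inequalities give the limits. *)
Lemma threshold_cvg (y : R) : 0 <= y <= 1 ->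
  (1 - y ^+ n) ^+ (n * 2 ^ n) @[n --> \oo] --> (if y < 1 / 2 then 1 else 0 : R).
Proof.
move=> /andP[y0 y1].
have yn n : 0 <= y ^+ n <= 1 by rewrite exprn_ge0//= exprn_ile1.
have NE n : (n * 2 ^ n)%:R * y ^+ n = n%:R * (2 * y) ^+ n :> R.
  by rewrite natrM natrX exprMn mulrA.
case: ifPn => [y2|]; last rewrite -leNgt => y2.
  apply: (@squeeze_cvgr _ _ _ _ (fun n => 1 - n%:R * (2 * y) ^+ n) (fun=> 1)).
  - apply: nearW => n; rewrite -NE bernoulli_lower//=.
    by have /andP[a b] := yn n; rewrite exprn_ile1 ?subr_ge0// gerBl.
  - rewrite -[X in _ --> X]subr0; apply: cvgB; first exact: cvg_cst.
    by apply: cvg_natmul_expr; rewrite mulr_ge0//=; lra.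
  - exact: cvg_cst.
apply: (@squeeze_cvgr _ _ _ _ (fun=> 0) (fun n => n.+1%:R^-1)).
- apply: nearW => n; have /andP[a b] := yn n.
  rewrite exprn_ge0 ?subr_ge0//= -[leRHS]mul1r ler_pdivlMr ?ltr0n//.
  rewrite (le_trans _ (bernoulli_upper (n * 2 ^ n) (yn n)))// NE.
  rewrite ler_wpM2l ?exprn_ge0 ?subr_ge0// -natr1 addrC lerD2l.
  by rewrite ler_peMr// exprn_ege1//; lra.
- exact: cvg_cst.
- exact: cvg_harmonic.
Qed.

End threshold.

Import HBSimple HBNNSimple.

(** * Functionals on weighted L^1 that vanish on the Gaussians *)

Section density.
Context (R : realType) (d : nat).
Local Notation V := 'rV[R]_d.
Local Notation T := (Rtuple R d).
Local Notation mu := (lebesgue R d).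
Local Notation vec := (@vec_of_tuple R d).
Implicit Types (g : Cfun R d) (x y : V) (i : 'I_d) (s b : 'I_d -> R).

Definition weighted_L1 (W : V -> R) g :=
  cmeasurable g /\ mu.-integrable setT (fun t => (nrm (g (vec t)) * W (vec t))%:E).

Variables (W : V -> R) (D : Cfun R d -> R[i]) (K C L : R).
Hypothesis W0 : forall x, 0 <= W x.
Hypothesis mW : measurable_fun setT (W \o vec).
Hypothesis L0 : 0 <= L.
Hypothesis WL : forall x, W x <= C * expR (L * enorm x).
Hypothesis D_lin : forall (a : R[i]) g1 g2, weighted_L1 W g1 -> weighted_L1 W g2 ->
  D (fun x => a * g1 x + g2 x) = a * D g1 + D g2.
Hypothesis D_bound : forall g, weighted_L1 W g ->
  nrm (D g) <= K * Rintegral mu setT (fun t => nrm (g (vec t)) * W (vec t)).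
Hypothesis D_gauss : forall s a, (forall i, 0 < s i) ->
  D (translate a (cgauss s (fun=> 0%N))) = 0.

Let weighted_dominated g (k : V -> R) : cmeasurable g ->
  mu.-integrable setT (fun t => (k (vec t) * W (vec t))%:E) ->
  (forall x, nrm (g x) <= k x) -> weighted_L1 W g.
Proof.
move=> mg ik gk; split => //; apply: le_integrable ik => //=.
  by apply/measurable_EFinP; apply: measurable_funM => //; exact: measurable_nrm.
move=> t _; rewrite lee_fin ger0_norm ?mulr_ge0 ?nrm_ge0// (le_trans _ (ler_norm _))//.
by rewrite ler_wpM2r.
Qed.

Let weighted_lin a g1 g2 : weighted_L1 W g1 -> weighted_L1 W g2 ->
  weighted_L1 W (fun x => a * g1 x + g2 x).
Proof.
move=> [m1 i1] [m2 i2].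
apply: (weighted_dominated (k := fun x => nrm a * nrm (g1 x) + nrm (g2 x))).
- by apply: cmeasurableD m2; apply: cmeasurableM m1; exact: cmeasurable_cst.
- have := integrableD measurableT (integrableZl measurableT (nrm a) i1) i2.
  by congr (integrable _ _ _); apply/funext => t /=; rewrite -EFinM -EFinD mulrDl mulrA.
- by move=> x; rewrite -nrmM nrm_triangle.
Qed.

Let D0 : D (fun=> 0) = 0.
Proof.
have w0 : weighted_L1 W (fun=> 0).
  apply: (weighted_dominated (k := fun=> 0)) => [||x]; first exact: cmeasurable_cst.
    by under eq_fun do rewrite mul0r; exact: integrable0.
  by rewrite nrm0.
have := D_lin 1 w0 w0; rewrite (_ : (fun x => _) = (fun=> 0)); last first.
  by apply/funext => x; rewrite mul1r addr0.
by rewrite mul1r => /eqP; rewrite -[X in X == _]addr0 (inj_eq (addrI _)) eq_sym => /eqP.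
Qed.

Let D_scale a g : weighted_L1 W g -> D g = 0 -> D (fun x => a * g x) = 0.
Proof.
move=> wg Dg.
have w0 : weighted_L1 W (fun=> 0).
  apply: (weighted_dominated (k := fun=> 0)) => [||x]; first exact: cmeasurable_cst.
    by under eq_fun do rewrite mul0r; exact: integrable0.
  by rewrite nrm0.
have := D_lin a wg w0; rewrite Dg D0 mulr0 addr0.
by rewrite (_ : (fun x => _ + 0) = (fun x => a * g x))//; apply/funext => x; rewrite addr0.
Qed.

(** Dominated convergence in the weighted space combined with the continuity of [D]; limits are
    taken below only in this form. *)
Let D_closed (g_ : nat -> Cfun R d) g (k : V -> R) :
  (forall n, cmeasurable (g_ n)) -> cmeasurable g ->
  mu.-integrable setT (fun t => (k (vec t) * W (vec t))%:E) ->
  (forall n x, nrm (g_ n x) <= k x) -> (forall x, nrm (g x) <= k x) ->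
  (forall x, nrm (g_ n x - g x) @[n --> \oo] --> 0) ->
  (forall n, D (g_ n) = 0) -> D g = 0.
Proof.
move=> mg_ mg ik g_k gk cg Dg_.
have wg := weighted_dominated mg ik gk.
have wg_ n := weighted_dominated (mg_ n) ik (g_k n).
have wd n : weighted_L1 W (fun x => (-1) * g_ n x + g x) by exact: weighted_lin.
have Dd n : D (fun x => (-1) * g_ n x + g x) = D g.
  by rewrite D_lin// Dg_ mulr0 add0r.
pose r n t := nrm ((-1) * g_ n (vec t) + g (vec t)) * W (vec t).
have rcv : Rintegral mu setT (r n) @[n --> \oo] --> (0 : R).
  apply: (Rintegral_dominated_cvg0 (g := fun t => k (vec t) * W (vec t) + k (vec t) * W (vec t))).
  - move=> n; apply: measurable_funM => //; exact: (measurable_nrm (wd n).1).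
  - exact: (integrableD measurableT ik ik).
  - move=> n t; rewrite mulr_ge0 ?nrm_ge0//= -mulrDl ler_wpM2r//.
    rewrite (le_trans (nrm_triangle _ _))// mulN1r nrmN lerD//.
  - move=> t; rewrite -[X in _ --> X](mul0r (W (vec t))); apply: cvgM; last exact: cvg_cst.
    by under eq_fun do rewrite mulN1r addrC nrm_distC; exact: cg.
have : nrm (D g) <= 0.
  have : K * Rintegral mu setT (r n) @[n --> \oo] --> 0.
    by rewrite -[X in _ --> X](mulr0 K); apply: cvgM => //; exact: cvg_cst.
  have : cst (nrm (D g)) n @[n --> \oo] --> nrm (D g) by exact: cvg_cst.
  move=> c1 c2; apply: (ler_cvg_to c1 c2); apply: nearW => n /=.
  by rewrite -(Dd n) D_bound.
by rewrite le_eqVlt ltNge nrm_ge0 orbF => /eqP/nrm0_eq0.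
Qed.

(** The linear term is kept explicit so that the product with a one-dimensional Gaussian only
    changes [s], [b] and a constant; completing the square leads back to translated Gaussians. *)
Definition egauss s b x : R := expR (\sum_i (b i * x 0 i - s i * x 0 i ^+ 2)).

Let egauss_translate s b : (forall i, 0 < s i) ->
  exists2 c : R, 0 < c & forall x, egauss s b x =
    c * gauss s (fun=> 0%N) (x - \row_i (b i / (2 * s i))).
Proof.
move=> s0; exists (expR (\sum_i (b i ^+ 2 / (4 * s i)))); first exact: expR_gt0.
move=> x; rewrite /egauss /gauss -expR_sum -expRD -big_split/=; congr expR.
apply: eq_bigr => i _; rewrite !mxE; field.
by rewrite gt_eqF.
Qed.

Let measurable_egauss s b : measurable_fun setT (egauss s b \o vec).
Proof.
apply: measurableT_comp => //; apply: measurable_sum => i.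
have m : measurable_fun setT (fun t : T => (vec t) 0 i).
  by under eq_fun do rewrite mxE; exact: measurable_tnth.
by apply: measurable_funB; apply: measurable_funM => //; exact: measurable_funX.
Qed.

Let egauss_weight s b : (forall i, 0 < s i) ->
  mu.-integrable setT (fun t => (egauss s b (vec t) * W (vec t))%:E).
Proof.
move=> s0; have [c c0 cE] := egauss_translate b s0.
set a := (\row_i _) in cE.
have [K' K'0 K'P] := gauss_rho (fun=> 0%N) s0 (mulr_ge0 (ler0n R 2) L0).
have C0 : 0 <= C.
  by have := le_trans (W0 0) (WL 0); rewrite pmulr_lge0 ?expR_gt0.
pose M := c * (C * expR (L * (2 * enorm a))) * K'.
have M0 : 0 <= M by rewrite !mulr_ge0 ?expR_ge0 ?(ltW c0).
have ir : mu.-integrable setT (fun t => (M * rho (vec t - a))%:E).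
  have := integrable_affine (- a) (or_introl erefl) (integrable_rhoZ d M).
  by under eq_fun do rewrite affine_tupleE scale1r.
apply: le_integrable ir => //=.
  by apply/measurable_EFinP; exact: (measurable_funM (measurable_egauss s b) mW).
move=> t _; rewrite lee_fin; set x := vec t.
rewrite ger0_norm ?mulr_ge0 ?expR_ge0// (le_trans _ (ler_norm _))//.
have xa : enorm x <= 2 * enorm (x - a) + 2 * enorm a.
  rewrite (le_trans (enorm_le_max a x))// -mulrDr ler_wpM2l// ge_max.
  by rewrite lerDl lerDr !enorm_ge0.
have Wx : W x <= C * expR (L * (2 * enorm a)) * expR (2 * L * enorm (x - a)).
  rewrite (le_trans (WL x))// -mulrA ler_wpM2l// -expRD ler_expR.
  by rewrite (le_trans (ler_wpM2l L0 xa))// le_eqVlt; apply/orP; left; apply/eqP; ring.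
have e0 : 0 <= egauss s b x by exact: expR_ge0.
rewrite (le_trans (ler_wpM2l e0 Wx))// cE.
have g0 := ler_norm (gauss s (fun=> 0%N) (x - a)).
have q : 0 <= c * (C * expR (L * (2 * enorm a))) by rewrite !mulr_ge0 ?expR_ge0 ?(ltW c0).
rewrite [leLHS](_ : _ = c * (C * expR (L * (2 * enorm a))) *
  (gauss s (fun=> 0%N) (x - a) * expR (2 * L * enorm (x - a)))); last by ring.
rewrite /M -[leRHS]mulrA ler_wpM2l// (le_trans _ (K'P _))// ler_wpM2r ?expR_ge0//.
Qed.

Let D_egauss s b : (forall i, 0 < s i) -> D (fun x => ((egauss s b x)%:C)%C) = 0.
Proof.
move=> s0; have [c c0 cE] := egauss_translate b s0; set a := (\row_i _) in cE.
have wt : weighted_L1 W (translate a (cgauss s (fun=> 0%N))).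
  apply: (weighted_dominated (k := fun x => c^-1 * egauss s b x)).
  - by apply: smooth_cmeasurable; apply: smooth_translate; exact: smooth_cgauss.
  - have := integrableZl measurableT c^-1 (egauss_weight b s0).
    by congr (integrable _ _ _); apply/funext => t; rewrite /= -EFinM mulrA.
  - move=> x; rewrite /translate nrm_cgauss cE mulKf ?gt_eqF// ger0_norm//.
    by apply: prodr_ge0 => i _; exact: expR_ge0.
have := D_scale (c%:C)%C wt (D_gauss a s0); rewrite (_ : (fun x => _) = (fun x => ((egauss s b x)%:C)%C))//.
by apply/funext => x; rewrite cE rmorphM.
Qed.

(* The functions of this class are stable under multiplication by
   one-dimensional Gaussians and under bounded limits, hence under
   multiplication by indicators of measurable sets. *)
Let annihilated (h : V -> R) := [/\ measurable_fun setT (h \o vec),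
  exists M, forall x, `|h x| <= M &
  forall s b, (forall i, 0 < s i) -> D (fun x => ((h x * egauss s b x)%:C)%C) = 0].

Let annihilated_weighted h s b : annihilated h -> (forall i, 0 < s i) ->
  weighted_L1 W (fun x => ((h x * egauss s b x)%:C)%C).
Proof.
move=> [mh [M hM] _] s0.
apply: (weighted_dominated (k := fun x => M * egauss s b x)).
- exact: cmeasurable_real (measurable_funM mh (measurable_egauss s b)).
- have := integrableZl measurableT M (egauss_weight b s0).
  by congr (integrable _ _ _); apply/funext => t; rewrite /= -EFinM mulrA.
- by move=> x; rewrite nrm_real normrM [X in _ * X]ger0_norm ?expR_ge0// ler_wpM2r ?expR_ge0.
Qed.

Let annihilated1 : annihilated (fun=> 1).
Proof.
split; first exact: measurable_cst.
  by exists 1 => x; rewrite normr1.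
by move=> s b s0; under eq_fun do rewrite mul1r; exact: D_egauss.
Qed.

Let annihilated_lin (a : R) h1 h2 : annihilated h1 -> annihilated h2 ->
  annihilated (fun x => a * h1 x + h2 x).
Proof.
move=> H1 H2; have [m1 [M1 b1] D1] := H1; have [m2 [M2 b2] D2] := H2.
split.
- exact: (measurable_funD (measurable_funM (measurable_cst a) m1) m2).
- exists (`|a| * M1 + M2) => x; rewrite (le_trans (ler_normD _ _))// normrM lerD//.
  by rewrite ler_wpM2l.
- move=> s b s0.
  have := D_lin (a%:C)%C (annihilated_weighted b H1 s0) (annihilated_weighted b H2 s0).
  rewrite D1// D2// mulr0 addr0 => <-; congr D; apply/funext => x.
  by rewrite -rmorphM -rmorphD/=; congr (_%:C)%C; ring.
Qed.

Let annihilated_limit (h_ : nat -> V -> R) (h : V -> R) M : (forall n, annihilated (h_ n)) ->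
  measurable_fun setT (h \o vec) -> (forall n x, `|h_ n x| <= M) -> (forall x, `|h x| <= M) ->
  (forall x, h_ n x @[n --> \oo] --> h x) -> annihilated h.
Proof.
move=> H_ mh h_M hM ch; split => //; first by exists M.
move=> s b s0.
apply: (D_closed (g_ := fun n x => ((h_ n x * egauss s b x)%:C)%C) (k := fun x => M * egauss s b x)).
- move=> n; have [mhn _ _] := H_ n.
  exact: cmeasurable_real (measurable_funM mhn (measurable_egauss s b)).
- exact: cmeasurable_real (measurable_funM mh (measurable_egauss s b)).
- have := integrableZl measurableT M (egauss_weight b s0).
  by congr (integrable _ _ _); apply/funext => t; rewrite /= -EFinM mulrA.
- by move=> n x; rewrite nrm_real normrM [X in _ * X]ger0_norm ?expR_ge0// ler_wpM2r ?expR_ge0.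
- by move=> x; rewrite nrm_real normrM [X in _ * X]ger0_norm ?expR_ge0// ler_wpM2r ?expR_ge0.
- move=> x; under eq_fun do rewrite -rmorphB nrm_real -mulrBl.
  apply/norm_cvg0P; rewrite -[X in _ --> X](mul0r (egauss s b x)); apply: cvgM; last exact: cvg_cst.
  by apply/subr_cvg0; exact: ch.
- by move=> n; have [_ _ ->] := H_ n.
Qed.

Let bump i (sg a : R) x : R := expR (- (sg * (x 0 i - a) ^+ 2)).

Let bump01 i sg a x : 0 < sg -> 0 <= bump i sg a x <= 1.
Proof.
move=> sg0; rewrite expR_ge0/= -expR0 ler_expR oppr_le0 mulr_ge0 ?sqr_ge0//.
exact: ltW.
Qed.

Let measurable_bump i sg a : measurable_fun setT (bump i sg a \o vec).
Proof.
apply: measurableT_comp => //; apply: measurable_funN; apply: measurable_funM => //.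
apply: measurable_funX; apply: measurable_funB => //.
by under eq_fun do rewrite mxE; exact: measurable_tnth.
Qed.

Let annihilated_bump h i sg a : 0 < sg -> annihilated h ->
  annihilated (fun x => h x * bump i sg a x).
Proof.
move=> sg0 H; have [mh [M hM] DH] := H; split.
- by apply: measurable_funM => //; exact: measurable_bump.
- exists M => x; rewrite normrM (le_trans _ (hM x))// ler_piMr//.
  by have /andP[b0 b1] := bump01 i a x sg0; rewrite ger0_norm.
- move=> s b s0.
  (* The bump adds sg to one quadratic coefficient and 2 sg a to the linear one; the constant e^(-
     sg a^2) remains outside. *)
  pose s' j := s j + (if j == i then sg else 0).
  pose b' j := b j + (if j == i then 2 * sg * a else 0).
  have s'0 j : 0 < s' j by rewrite /s'; case: ifP => _; rewrite ?addr0// addr_gt0.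
  have E x : h x * bump i sg a x * egauss s b x = expR (- (sg * a ^+ 2)) * (h x * egauss s' b' x).
    rewrite mulrCA -mulrA; congr (_ * _).
    rewrite /bump /egauss -!expRD; congr expR.
    rewrite (bigD1 i)//= [in RHS](bigD1 i)//= /s' /b' eqxx.
    rewrite [in RHS](eq_bigr (fun j => b j * x 0 j - s j * x 0 j ^+ 2)); last first.
      by move=> j /negbTE ->; rewrite !addr0.
    by ring.
  have := D_scale (expR (- (sg * a ^+ 2)))%:C%C (annihilated_weighted b' H s'0) (DH s' b' s'0).
  by move=> <-; congr D; apply/funext => x; rewrite E rmorphM.
Qed.

Let annihilated_threshold h i sg a : 0 < sg -> annihilated h ->
  annihilated (fun x => h x * (if bump i sg a x < 1 / 2 then 1 else 0)).
Proof.
move=> sg0 H; have [mh [M hM] DH] := H.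
have pw n k : annihilated k -> annihilated (fun x => k x * bump i sg a x ^+ n).
  elim: n k => [|n IH] k Hk.
    by under eq_fun do rewrite expr0 mulr1.
  by under eq_fun do rewrite exprS mulrA; apply: IH; exact: annihilated_bump.
have one_pw n k : annihilated k -> annihilated (fun x => k x * (1 - bump i sg a x ^+ n)).
  move=> Hk; have := annihilated_lin (-1) (pw n k Hk) Hk.
  by congr annihilated; apply/funext => x; ring.
have pp n m k : annihilated k -> annihilated (fun x => k x * (1 - bump i sg a x ^+ n) ^+ m).
  elim: m k => [|m IH] k Hk.
    by under eq_fun do rewrite expr0 mulr1.
  by under eq_fun do rewrite exprS mulrA; apply: IH; exact: one_pw.
apply: (annihilated_limit (h_ := fun n x => h x * (1 - bump i sg a x ^+ n) ^+ (n * 2 ^ n)) (M := M)).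
- by move=> n; exact: pp.
- apply: measurable_funM => //; apply: measurable_fun_ifT => //=.
  apply: measurable_fun_ltr => //; exact: measurable_bump.
- move=> n x; rewrite normrM (le_trans _ (hM x))// ler_piMr//.
  have /andP[b0 b1] := bump01 i a x sg0.
  have p0 : 0 <= bump i sg a x ^+ n by rewrite exprn_ge0.
  have p1 : bump i sg a x ^+ n <= 1 by rewrite exprn_ile1.
  by rewrite normrX exprn_ile1// ger0_norm ?subr_ge0// gerBl.
- move=> x; rewrite normrM (le_trans _ (hM x))// ler_piMr//.
  by case: ifP; rewrite ?normr1 ?normr0.
- move=> x; apply: cvgM; first exact: cvg_cst.
  exact: threshold_cvg (bump01 i a x sg0).
Qed.

(** Stability under multiplication by the indicator is required, rather than that the indicator
    itself be annihilated: this makes the class closed under intersections, so that a full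
    sigma-algebra results. *)
Let annihilating (A : set T) := measurable A /\ forall h, annihilated h ->
  annihilated (fun x => h x * \1_A (tuple_of_vec x)).

Let measurable_mul_indic (h : V -> R) (A : set T) : measurable_fun setT (h \o vec) ->
  measurable A -> measurable_fun setT ((fun x => h x * \1_A (tuple_of_vec x)) \o vec).
Proof.
move=> mh mA; have := measurable_funM mh (@measurable_indic _ _ R setT A mA).
by congr (measurable_fun _ _); apply/funext => t; rewrite /= vec_of_tupleK.
Qed.

Let sigma_algebra_annihilating : sigma_algebra setT annihilating.
Proof.
split.
- split=> // h H; have := annihilated_lin (-1) H H.
  by congr annihilated; apply/funext => x; rewrite indicE in_set0 mulr0 mulN1r addNr.
- move=> A [mA HA]; rewrite setTD; split; first exact: measurableC.
  move=> h H; have := annihilated_lin (-1) (HA h H) H.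
  congr annihilated; apply/funext => x; rewrite !indicE in_setC.
  by case: (_ \in _) => /=; ring.
- move=> A HA; split; first by apply: bigcupT_measurable => k; have [] := HA k.
  move=> h H; have [mh [M hM] _] := H.
  (* The indicator of the complement of the union is the bounded limit of the finite products of the
     indicators of the complements. *)
  pose c n x : R := \prod_(k < n) (1 - \1_(A k) (tuple_of_vec x)).
  have c01 n x : `|c n x| <= 1.
    rewrite normr_prod prodr_ile1// => k _; rewrite normr_ge0/= indicE.
    by case: (_ \in _) => /=; rewrite ?subrr ?subr0 ?normr0 ?normr1.
  have Hc n : annihilated (fun x => h x * c n x).
    elim: n => [|n IH].
      by move: H; congr annihilated; apply/funext => x; rewrite /c big_ord0 mulr1.
    have [_ /(_ _ IH) H1] := HA n.
    have := annihilated_lin (-1) H1 IH.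
    by congr annihilated; apply/funext => x; rewrite /c big_ord_recr/=; ring.
  have mU : measurable (\bigcup_k A k) by apply: bigcupT_measurable => k; have [] := HA k.
  have HC : annihilated (fun x => h x * \1_(~` \bigcup_k A k) (tuple_of_vec x)).
    apply: (annihilated_limit (h_ := fun n x => h x * c n x) (M := M)) => //.
    + exact: measurable_mul_indic (measurableC mU).
    + by move=> n x; rewrite normrM (le_trans _ (hM x))// ler_piMr.
    + move=> x; rewrite normrM (le_trans _ (hM x))// ler_piMr// indicE.
      by case: (_ \in _); rewrite ?normr0 ?normr1.
    + move=> x; apply: cvgM; first exact: cvg_cst.
      rewrite indicE in_setC; case: (boolP (_ \in _)) => [|xU].
        rewrite inE => -[k _ Akx].
        apply: (@cvg_trans _ (cst 0 n @[n --> \oo])); last exact: cvg_cst.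
        apply: near_eq_cvg; exists k.+1 => // n /= kn.
        rewrite /c (bigD1 (Ordinal kn))//= indicE.
        by rewrite (_ : _ \in _ = true) ?subrr ?mul0r//; exact/mem_set.
      apply: (@cvg_trans _ (cst 1 n @[n --> \oo])); last exact: cvg_cst.
      apply: near_eq_cvg; apply: nearW => n; rewrite /c big1//= => k _.
      rewrite indicE (_ : _ \in _ = false) ?subr0//; apply/negbTE/negP.
      rewrite inE => Ak; move: xU; rewrite notin_setE; apply.
      by exists (val k).
  have := annihilated_lin (-1) HC H.
  congr annihilated; apply/funext => x; rewrite !indicE in_setC.
  by case: (_ \in _) => /=; ring.
Qed.

Let annihilating_ball i (a r : R) : 0 < r ->
  annihilating [set t | r < `|tnth t i - a|].
Proof.
move=> r0; split.
  rewrite (_ : [set t | _] = (fun t : T => `|tnth t i - a|) @^-1` `]r, +oo[); last first.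
    by apply/seteqP; split => t /=; rewrite in_itv/= andbT.
  rewrite -[X in measurable X]setTI.
  apply: (measurableT_comp (@normr_measurable R setT)) => //.
  by apply: measurable_funB => //; exact: measurable_tnth.
move=> h H; have l2 : 0 < ln 2 :> R by rewrite ln_gt0// ltr1n.
(* With this parameter the bump has the value 1/2 exactly at distance r from a. *)
have sg0 : 0 < ln 2 / r ^+ 2 by rewrite divr_gt0// exprn_gt0.
have := annihilated_threshold i a sg0 H.
congr annihilated; apply/funext => x; congr (_ * _); rewrite indicE.
have -> : (tuple_of_vec x \in [set t | r < `|tnth t i - a|]) = (r < `|x 0 i - a|).
  by apply/idP/idP; rewrite inE/= tnth_mktuple.
have -> : (bump i (ln 2 / r ^+ 2) a x < 1 / 2) = (r < `|x 0 i - a|).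
  rewrite /bump div1r -[X in _ < X^-1]lnK ?posrE// -expRN ltr_expR ltrN2.
  rewrite mulrAC ltr_pdivlMr ?exprn_gt0// ltr_pM2l// -[X in _ < X]real_normK ?num_real//.
  by rewrite ltr_pXn2r// nnegrE ltW.
by case: ifP.
Qed.

Let annihilating_halfline i (a : R) : annihilating [set t | a < tnth t i].
Proof.
have [_ sC sU] := sigma_algebra_annihilating.
(* The closed intervals with centre a + n + 1 and this radius are
   [a + 1/(n+2), a + 2(n+1) - 1/(n+2)]; they exhaust the half-line. *)
pose r n : R := n.+1%:R - n.+2%:R^-1.
have r0 n : 0 < r n.
  by rewrite subr_gt0 (@lt_le_trans _ _ 1) ?ler1n// invf_lt1// ltr1n.
rewrite (_ : [set t | _] = \bigcup_n (setT `\` [set t | r n < `|tnth t i - (a + n.+1%:R)|])).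
  by apply: sU => n; apply: sC; exact: annihilating_ball.
apply/seteqP; split => [t /= at_|t [n _ [_ /=]]].
  have : 0 < tnth t i - a by rewrite subr_gt0.
  move yE : (tnth t i - a) => y y0.
  have [n yn] : exists n, y^-1 + y < n.+1%:R.
    by exists (Num.truncn (y^-1 + y)); exact: truncnS_gt.
  have y'0 : 0 < y^-1 by rewrite invr_gt0.
  exists n => //; split => //=; apply/negP; rewrite -leNgt.
  rewrite opprD addrA yE ler_norml /r.
  have nn : n.+1%:R <= n.+2%:R :> R by rewrite ler_nat.
  have n1 : n.+2%:R^-1 <= 1 :> R by rewrite invf_le1// ler1n.
  have n0 : 0 < n.+2%:R :> R by [].
  have : n.+2%:R^-1 <= y.
    have yn2 : y^-1 <= n.+2%:R.
      by apply: le_trans nn; apply: ltW; apply: le_lt_trans yn; rewrite lerDl ltW.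
    by rewrite -[leRHS]invrK lef_pV2.
  have : 1 <= n.+1%:R :> R by rewrite ler1n.
  move: n1 yn y'0; move: n.+2%:R^-1 n.+1%:R y^-1 => *.
  by apply/andP; split; lra.
move/negP; rewrite -leNgt ler_norml => /andP[+ _].
have : 0 < n.+2%:R^-1 :> R by rewrite invr_gt0.
by rewrite /r; move: n.+2%:R^-1 n.+1%:R (tnth t i) => *; lra.
Qed.

Let annihilating_measurable (A : set T) : measurable A -> annihilating A.
Proof.
move: A; apply: smallest_sub; first exact: sigma_algebra_annihilating.
apply: (big_ind (fun S => S `<=` annihilating)) => [A []|S1 S2 h1 h2|i _]; first by rewrite subUset.
- move=> A; rewrite RGenOInfty.measurableE -g_sigma_preimageE; move: A.
  apply: smallest_sub; first exact: sigma_algebra_annihilating.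
  move=> _ [_ [a ->] <-]; rewrite setTI.
  rewrite (_ : _ @^-1` _ = [set t | a < tnth t i]); first exact: annihilating_halfline.
  by apply/seteqP; split => t /=; rewrite in_itv/= andbT.
Qed.

Let annihilated_simple (f : {nnsfun T >-> R}) : annihilated (fun x => f (tuple_of_vec x)).
Proof.
have sumP I (s : seq I) (h : I -> V -> R) : (forall k, annihilated (h k)) ->
    annihilated (fun x => \sum_(k <- s) h k x).
  move=> H; elim: s => [|k s IH].
    have := annihilated_lin (-1) annihilated1 annihilated1.
    by congr annihilated; apply/funext => x; rewrite big_nil mulr1 addNr.
  have := annihilated_lin 1 (H k) IH.
  by congr annihilated; apply/funext => x; rewrite big_cons mul1r.
have H (y : R) : annihilated (fun x => y * \1_(f @^-1` [set y]) (tuple_of_vec x)).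
  have [_ /(_ _ annihilated1) H1] :=
    annihilating_measurable (measurable_funPTI f (measurable_set1 y)).
  have := annihilated_lin (y - 1) H1 H1.
  by congr annihilated; apply/funext => x; ring.
have := sumP R (finmap.enum_fset (fset_set (range f))) _ H.
by congr annihilated; apply/funext => x; rewrite fimfunE fsbig_finite.
Qed.

(** Write k = (k / G) G with a fixed Gaussian G: simple functions increasing to k / G, multiplied by
    G, are sent to 0 by [D] and are dominated by k itself. *)
Let D_nonneg (k : V -> R) : (forall x, 0 <= k x) ->
  weighted_L1 W (fun x => ((k x)%:C)%C) -> D (fun x => ((k x)%:C)%C) = 0.
Proof.
move=> k0 [mk ik].
pose G := egauss (fun=> 1) (fun=> 0).
have G0 x : 0 < G x by exact: expR_gt0.
have mk' : measurable_fun setT (k \o vec) by exact: mk.1.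
have mG : measurable_fun setT (fun t => (G (vec t))^-1).
  have := measurable_egauss (fun=> -1) (fun=> 0).
  congr (measurable_fun _ _); apply/funext => t.
  rewrite /G /egauss /= -expRN -sumrN; congr expR.
  by apply: eq_bigr => i _; rewrite !mul0r !sub0r mulN1r mul1r.
pose f t : \bar R := (k (vec t) / G (vec t))%:E.
have mf : measurable_fun setT f.
  by apply/measurable_EFinP; exact: (measurable_funM mk' mG).
have f0 t : setT t -> (0 <= f t)%E.
  by move=> _; rewrite lee_fin divr_ge0 ?(ltW (G0 _)).
pose s n := nnsfun_approx measurableT mf n.
have sf n x : s n (tuple_of_vec x) * G x <= k x.
  have := le_approx n f0 (Logic.I : setT (tuple_of_vec x)).
  by rewrite -(nnsfun_approxE measurableT mf) lee_fin tuple_of_vecK ler_pdivlMr.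
apply: (D_closed (g_ := fun n x => ((s n (tuple_of_vec x) * G x)%:C)%C) (k := k)).
- move=> n; have [ms _ _] := annihilated_simple (s n).
  exact: cmeasurable_real (measurable_funM ms (measurable_egauss _ _)).
- exact: mk.
- by move: ik; congr (integrable _ _ _); apply/funext => t; rewrite nrm_real ger0_norm.
- by move=> n x; rewrite nrm_real ger0_norm ?mulr_ge0 ?(ltW (G0 _)).
- by move=> x; rewrite nrm_real ger0_norm.
- move=> x; under eq_fun do rewrite -rmorphB nrm_real.
  apply/norm_cvg0P/subr_cvg0.
  have -> : k x = k x / G x * G x by rewrite divfK// gt_eqF.
  apply: cvgM; last exact: cvg_cst.
  have := cvg_nnsfun_approx measurableT mf f0 (Logic.I : setT (tuple_of_vec x)).
  by rewrite /f tuple_of_vecK => /fine_cvgP[].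
- by move=> n; have [_ _ ->] := annihilated_simple (s n).
Qed.

Let D_real (k : V -> R) : weighted_L1 W (fun x => ((k x)%:C)%C) -> D (fun x => ((k x)%:C)%C) = 0.
Proof.
move=> wk; have [mk ik] := wk.
have mk' : measurable_fun setT (k \o vec) by exact: mk.1.
have part (sg : R) : `|sg| <= 1 ->
    weighted_L1 W (fun x => ((2^-1 * (`|k x| + sg * k x))%:C)%C).
  move=> sg1; apply: (weighted_dominated (k := fun x => nrm ((k x)%:C)%C)) ik _.
    apply: cmeasurable_real; apply: measurable_funM => //; apply: measurable_funD.
      exact: measurableT_comp.
    exact: measurable_funM.
  move=> x; rewrite !nrm_real normrM (ger0_norm (x := 2^-1))//.
  rewrite ler_pdivrMl// (le_trans (ler_normD _ _))// normr_id normrM.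
  by have := ler_wpM2r (normr_ge0 (k x)) sg1; rewrite mul1r; lra.
have w1 := part 1 ltac:(by rewrite normr1).
have w2 := part (-1) ltac:(by rewrite normrN normr1).
have n1 : forall x, 0 <= 2^-1 * (`|k x| + 1 * k x).
  by move=> x; rewrite mulr_ge0// mul1r; have := ler_norm (- k x); rewrite normrN; lra.
have n2 : forall x, 0 <= 2^-1 * (`|k x| + -1 * k x).
  by move=> x; rewrite mulr_ge0// mulN1r subr_ge0 ler_norm.
have := D_lin (-1) w2 w1; rewrite (D_nonneg n2 w2) (D_nonneg n1 w1) mulr0 addr0 => <-.
congr D; apply/funext => x; rewrite mulN1r -rmorphN -rmorphD; congr (_%:C)%C.
by rewrite /= ; lra.
Qed.

Lemma weighted_L1_eq0 g : weighted_L1 W g -> D g = 0.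
Proof.
move=> [mg ig].
have w1 : weighted_L1 W (fun x => ((complex.Re (g x))%:C)%C).
  apply: (weighted_dominated (k := fun x => nrm (g x))) ig _.
    by apply: cmeasurable_real; exact: mg.1.
  by move=> x; rewrite nrm_real normr_Re_le.
have w2 : weighted_L1 W (fun x => ((complex.Im (g x))%:C)%C).
  apply: (weighted_dominated (k := fun x => nrm (g x))) ig _.
    by apply: cmeasurable_real; exact: mg.2.
  by move=> x; rewrite nrm_real normr_Im_le.
have := D_lin ('i)%C w2 w1; rewrite (D_real w2) (D_real w1) mulr0 addr0 => <-.
by congr D; apply/funext => x; rewrite addrC; exact: complexE.
Qed.

End density.

(** * Weak integrals and dual norms *)

Section complex_banach.
Context (R : realType) (F : completeNormedModType R[i]).
Implicit Types (u v w : F) (f : F -> R[i]).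

Definition bounded_linear f := (forall (a : R[i]) u w, f (a *: u + w) = a * f u + f w) /\
  exists K, forall u, nrm (f u) <= K * nrm u.

Lemma bounded_linearB f u w : bounded_linear f -> f (u - w) = f u - f w.
Proof. by move=> [l _]; rewrite -scaleN1r addrC l mulN1r addrC. Qed.

Lemma bounded_linear0 f : bounded_linear f -> f 0 = 0.
Proof. by move=> bf; rewrite -(subrr 0) (bounded_linearB _ _ bf) subrr. Qed.

Lemma bounded_linear_bound f : bounded_linear f ->
  exists2 K, 0 <= K & forall u, nrm (f u) <= K * nrm u.
Proof.
move=> [_ [K hK]]; exists `|K| => // u; rewrite (le_trans (hK u))//.
by rewrite ler_wpM2r ?nrm_ge0 ?ler_norm.
Qed.

Lemma norming_functional v : exists2 f, bounded_linear f &
  (forall u, nrm (f u) <= nrm u) /\ nrm (f v) = nrm v.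
Proof.
have [f [l b e]] := hahn_banach v; exists f.
  by split=> //; exists 1 => u; rewrite mul1r.
by split=> //; rewrite e nrm_real ger0_norm ?nrm_ge0.
Qed.

Lemma ball_nrm u v (e : R) : nrm (u - v) < e -> ball u ((e%:C)%C : R[i]) v.
Proof. by move=> h; rewrite -ball_normE /ball_/= nrmE ltcR. Qed.

Lemma nrm_cauchy_cvg (s : nat -> F) :
  (forall e : R, 0 < e -> exists N, forall n, (N <= n)%N -> nrm (s N - s n) < e) ->
  exists l, nrm (s n - l) @[n --> \oo] --> (0 : R).
Proof.
move=> cs; have : cauchy (s n @[n --> \oo]).
  apply: cauchy_exP => eps eps0.
  (* A positive element of [R[i]] is real, so the given radius is a real number. *)
  case: eps eps0 => a b; rewrite ltcE /= => /andP[/eqP -> a0].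
  have [N hN] := cs a a0; exists (s N); exists N => // n /= Nn.
  exact/ball_nrm/hN.
move=> /cauchy_cvg/cvg_ex[l sl]; exists l; apply/cvgrPdist_lt => e e0.
move/cvgrPdist_lt : sl => /(_ (e%:C)%C).
rewrite ltcR => /(_ e0); apply: filterS => n.
rewrite nrmE ltcR sub0r normrN => h.
by rewrite ger0_norm ?nrm_ge0// nrm_distC.
Qed.

End complex_banach.

(** * Weak integrals of continuous vector-valued functions *)

Section weak_integral.
Context (R : realType) (d : nat) (F : completeNormedModType R[i]).
Local Notation V := 'rV[R]_d.
Local Notation T := (Rtuple R d).
Local Notation mu := (lebesgue R d).
Local Notation vec := (@vec_of_tuple R d).
Implicit Types (phi psi : Cfun R d) (Phi : V -> F) (f : F -> R[i]) (x y : V).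

Definition nrm_continuous Phi := forall x0 (e : R), 0 < e ->
  \forall x \near x0, nrm (Phi x - Phi x0) <= e.

Lemma nrm_continuousP Phi (v : F) : nrm_continuous Phi -> continuous (fun x => nrm (Phi x - v)).
Proof.
move=> cP x0; apply/(@cvgrPdist_le _ _ _ (nbhs x0) (nbhs_filter x0)) => e e0.
move: (cP x0 e e0); apply: (@filterS _ (nbhs x0) (nbhs_filter x0)) => x h.
apply: le_trans h; rewrite ler_norml; apply/andP; split.
  by have := nrm_dist_triangle (Phi x0) (Phi x) v; lra.
by have := nrm_dist_triangle (Phi x) (Phi x0) v; rewrite (nrm_distC (Phi x0) (Phi x)); lra.
Qed.

Lemma cmeasurable_functional f Phi : bounded_linear f -> nrm_continuous Phi ->
  cmeasurable (fun x => f (Phi x)).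
Proof.
move=> bf cP; have [K K0 hK] := bounded_linear_bound bf.
have near_f x0 (e : R) : 0 < e -> \forall x \near x0, nrm (f (Phi x) - f (Phi x0)) <= e.
  move=> e0; have eK : 0 < e / (K + 1) by rewrite divr_gt0// ltr_wpDl.
  move: (cP x0 _ eK); apply: (@filterS _ (nbhs x0) (nbhs_filter x0)) => x; rewrite ler_pdivlMr ?ltr_wpDl// => h.
  rewrite -bounded_linearB// (le_trans (hK _))//.
  have := nrm_ge0 (Phi x - Phi x0); nra.
apply: cmeasurable_continuous => x0;
  apply/(@cvgrPdist_le _ _ _ (nbhs x0) (nbhs_filter x0)) => e e0;
  move: (near_f x0 e e0); apply: (@filterS _ (nbhs x0) (nbhs_filter x0)) => x h; rewrite -normrN opprB.
- by rewrite -raddfB (le_trans (normr_Re_le _)).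
- by rewrite -raddfB (le_trans (normr_Im_le _)).
Qed.

Lemma dense_rational x (e : R) : 0 < e -> exists q : 'rV[rat]_d, `|map_mx ratr q - x| < e.
Proof.
move=> e0; have P i : exists q : rat, `|ratr q - x 0 i| < e.
  have [|q] := @rat_in_itvoo R (x 0 i - e) (x 0 i + e); first by lra.
  by rewrite in_itv/= => h; exists q; rewrite ltr_distl.
have [q hq] := choice P; exists (\row_i q i).
by apply: norm_lt_coord => // i; rewrite !mxE.
Qed.

Let rational_point (k : nat) : option 'rV[rat]_d := unpickle k.

Let sample Phi k : F := if rational_point k is Some q then Phi (map_mx ratr q) else 0.

Let sample_dense Phi x (e : R) : nrm_continuous Phi -> 0 < e ->
  exists k, nrm (Phi x - sample Phi k) <= e.
Proof.
move=> cP e0; have /nbhs_ballP[r /= r0 hr] := cP x e e0.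
have [q qx] := dense_rational x r0; exists (pickle q).
rewrite /sample /rational_point pickleK nrm_distC; apply: hr.
by rewrite -ball_normE /ball_/= distrC.
Qed.

(* The element closest to Phi x among 0 and the first n samples of Phi: the
   functions [nearest Phi n] are simple and converge to Phi pointwise. *)
Fixpoint nearest Phi (n : nat) x : F :=
  if n is m.+1 then
    if nrm (Phi x - sample Phi m) < nrm (Phi x - nearest Phi m x) then sample Phi m
    else nearest Phi m x
  else 0.

Let nearest_le Phi n x : nrm (Phi x - nearest Phi n x) <= nrm (Phi x).
Proof.
elim: n => [|n IH] /=; first by rewrite subr0.
by case: ifP => // /ltW/le_trans; apply.
Qed.

Let nearest_cvg Phi x : nrm_continuous Phi ->
  nrm (Phi x - nearest Phi n x) @[n --> \oo] --> (0 : R).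
Proof.
move=> cP; apply/cvgrPdist_le => e e0; have [k hk] := sample_dense x cP e0.
exists k.+1 => // n /= kn; rewrite sub0r normrN ger0_norm ?nrm_ge0//.
rewrite -(subnKC kn); elim: (n - k.+1)%N => [|m IH].
  rewrite addn0 /=; case: ifPn => // ; rewrite -leNgt => h; exact: le_trans hk.
rewrite addnS /=; case: ifP => // h; exact: le_trans (ltW h) IH.
Qed.

Let measurable_nearest Phi n : nrm_continuous Phi ->
  measurable_fun setT (fun t : T => nrm (Phi (vec t) - nearest Phi n (vec t))).
Proof.
move=> cP; have m v : measurable_fun setT (fun t : T => nrm (Phi (vec t) - v)).
  exact: (@measurable_vec_continuous R d (fun x => nrm (Phi x - v)) (@nrm_continuousP Phi v cP)).
elim: n => [|n IH]; first exact: m.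
have := measurable_minr (m (sample Phi n)) IH.
congr (measurable_fun _ _); apply/funext => t /=.
by rewrite /Order.min; case: ifP.
Qed.

(** A general density [psi] is needed for the induction: on the set where the new sample is nearer,
    the density contributes a multiple of that sample, and the rest of [psi] goes into the induction
    hypothesis. *)
Let simple_integral Phi n psi : nrm_continuous Phi -> cintegrable psi ->
  (forall f, bounded_linear f -> cintegrable (fun x => psi x * f (nearest Phi n x))) /\
  exists I : F, forall f, bounded_linear f ->
    f I = cintegral setT (fun x => psi x * f (nearest Phi n x)).
Proof.
move=> cP; elim: n psi => [|n IH] psi ipsi.
  split=> [f bf|].
    have := cintegrableZ 0 ipsi; congr cintegrable; apply/funext => x /=.
    by rewrite (bounded_linear0 bf) mulr0 mul0r.
  exists 0 => f bf; rewrite (bounded_linear0 bf).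
  rewrite (_ : (fun x => _) = (fun=> 0)); first by rewrite cintegral0.
  by apply/funext => x; rewrite mulr0.
pose b x := nrm (Phi x - sample Phi n) < nrm (Phi x - nearest Phi n x).
pose c x : R[i] := (((b x)%:R : R)%:C)%C.
have mb : cmeasurable c.
  apply: cmeasurable_real; apply: (measurableT_comp (f := fun z : bool => z%:R : R)) => //.
  apply: measurable_fun_ltr; last exact: measurable_nearest.
  exact: (@measurable_vec_continuous R d (fun x => nrm (Phi x - sample Phi n)) (@nrm_continuousP Phi _ cP)).
have c1 x : nrm (c x) <= 1.
  by rewrite nrm_real; case: (b x); rewrite ?normr1 ?normr0.
have i1 : cintegrable (fun x => c x * psi x) := cintegrableM_bounded ipsi mb c1.
have i2 : cintegrable (fun x => (-1) * (c x * psi x) + psi x) := cintegrable_lin (-1) i1 ipsi.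
have [j2 [I2 hI2]] := IH _ i2.
have E f x : f (sample Phi n) * (c x * psi x) + ((-1) * (c x * psi x) + psi x) * f (nearest Phi n x)
    = psi x * f (nearest Phi n.+1 x).
  by rewrite /c /= -/(b x); case: (b x) => /=; rewrite ?rmorph1 ?rmorph0; ring.
split=> [f bf|].
  have := cintegrable_lin (f (sample Phi n)) i1 (j2 f bf).
  by congr cintegrable; apply/funext => x; exact: E.
exists (cintegral setT (fun x => c x * psi x) *: sample Phi n + I2) => f bf.
rewrite bf.1 hI2// mulrC -cintegral_lin//; last exact: j2.
by apply: eq_cintegral => x; exact: E.
Qed.

(** A norming functional reduces the distance between two simple integrals to scalar integrals,
    bounded by the L^1 errors [a n] of the approximations. Hence the simple integrals converge in
    norm, and the limit pairs correctly with every bounded functional. *)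
Lemma weak_integral phi Phi : cintegrable phi -> nrm_continuous Phi ->
  mu.-integrable setT (fun t => (nrm (phi (vec t)) * nrm (Phi (vec t)))%:E) ->
  exists I : F, forall f, bounded_linear f ->
    cintegrable (fun x => phi x * f (Phi x)) /\
    f I = cintegral setT (fun x => phi x * f (Phi x)).
Proof.
move=> iphi cP iP.
have iPhi f : bounded_linear f -> cintegrable (fun x => phi x * f (Phi x)).
  move=> bf; have [K K0 hK] := bounded_linear_bound bf.
  apply: (cintegrable_dominated (g := fun x => K * (nrm (phi x) * nrm (Phi x)))).
  - apply: cmeasurableM; first exact: cintegrable_measurable.
    exact: cmeasurable_functional.
  - have := integrableZl measurableT K iP; congr (integrable _ _ _).
  - by move=> x; rewrite nrmM mulrCA ler_wpM2l ?nrm_ge0.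
have jn n := (simple_integral n cP iphi).1.
have [I hI] := choice (fun n => (simple_integral n cP iphi).2).
pose r n (t : T) := nrm (phi (vec t)) * nrm (Phi (vec t) - nearest Phi n (vec t)).
have mr n : measurable_fun setT (r n).
  apply: measurable_funM; last exact: measurable_nearest.
  exact: (measurable_nrm (cintegrable_measurable iphi)).
have ri n : mu.-integrable setT (EFin \o r n).
  apply: (le_integrable measurableT _ _ iP); first exact/measurable_EFinP.
  move=> t _; rewrite lee_fin !ger0_norm ?mulr_ge0 ?nrm_ge0//.
  by rewrite ler_wpM2l ?nrm_ge0.
pose a n := Rintegral mu setT (r n).
have a0 : a n @[n --> \oo] --> (0 : R).
  apply: (Rintegral_dominated_cvg0 mr iP) => [n t|t].
    by rewrite mulr_ge0 ?nrm_ge0//= ler_wpM2l ?nrm_ge0.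
  rewrite -[X in _ --> X](mulr0 (nrm (phi (vec t)))).
  by apply: cvgM; [exact: cvg_cst|exact: nearest_cvg].
have fI n f K : bounded_linear f -> (forall u, nrm (f u) <= K * nrm u) ->
    nrm (f (I n) - cintegral setT (fun x => phi x * f (Phi x))) <= K * a n.
  move=> bf b1; rewrite -(RintegralZl K measurableT (ri n)).
  rewrite hI// -cintegralB//; [|exact: jn|exact: iPhi].
  apply: (nrm_cintegral_dominated
    (g := fun x => K * (nrm (phi x) * nrm (Phi x - nearest Phi n x))) measurableT).
  - have := cintegrable_lin (-1) (iPhi f bf) (jn n f bf).
    by congr cintegrable; apply/funext => x; ring.
  - exact: (integrableZl measurableT K (ri n)).
  - move=> x; rewrite -mulrBr nrmM mulrCA ler_wpM2l ?nrm_ge0// -bounded_linearB//.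
    by rewrite nrm_distC.
have IB n m : nrm (I n - I m) <= a n + a m.
  have [f bf [b1 e1]] := norming_functional (I n - I m); rewrite -e1 bounded_linearB//.
  rewrite (le_trans (nrm_dist_triangle (cintegral setT (fun x => phi x * f (Phi x))) _ _))//.
  have b1' u : nrm (f u) <= 1 * nrm u by rewrite mul1r.
  by rewrite -[a n]mul1r -[a m]mul1r lerD ?fI// nrm_distC fI.
have [l cl] : exists l, nrm (I n - l) @[n --> \oo] --> (0 : R).
  apply: nrm_cauchy_cvg => e e0.
  have e2 : 0 < e / 3 by rewrite divr_gt0.
  move/cvgrPdist_lt : a0 => /(_ _ e2)[N _ hN]; exists N => n Nn.
  apply: le_lt_trans (IB _ _) _.
  have h1 := hN N (leqnn N); have h2 := hN n Nn.
  have g1 := ler_norm (- (0 - a N)); have g2 := ler_norm (- (0 - a n)).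
  by rewrite !normrN in g1 g2; lra.
exists l => f bf; split; first exact: iPhi.
have [K K0 hK] := bounded_linear_bound bf.
apply/eqP; rewrite -subr_eq0; apply/eqP/nrm0_eq0/eqP.
rewrite eq_le nrm_ge0 andbT.
have c1 : cst (nrm (f l - cintegral setT (fun x => phi x * f (Phi x)))) n @[n --> \oo] -->
  nrm (f l - cintegral setT (fun x => phi x * f (Phi x))) by exact: cvg_cst.
have c2 : K * nrm (I n - l) + K * a n @[n --> \oo] --> (0 : R).
  rewrite (_ : 0 = K * 0 + K * 0); last by rewrite mulr0 addr0.
  by apply: cvgD; [exact: cvgM (cvg_cst _) cl|exact: cvgM (cvg_cst _) a0].
apply: (ler_cvg_to c1 c2); apply: nearW => n /=.
rewrite (le_trans (nrm_dist_triangle (f (I n)) _ _))// lerD ?fI//.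
by rewrite nrm_distC -bounded_linearB.
Qed.

End weak_integral.

(** * Dual norms and adjoints *)

Section dual.
Context (R : realType) (F : completeNormedModType R[i]).
Implicit Types (u v w : F) (f : F -> R[i]) (A : F -> F).

Lemma homogeneous_le (q : F -> R) (K : R) :
  (forall (a : R[i]) v, q (a *: v) = nrm a * q v) ->
  (forall v, nrm v <= 1 -> q v <= K) -> forall v, q v <= K * nrm v.
Proof.
move=> hq h v; have [v0|v0] := eqVneq (nrm v) 0.
  by rewrite v0 mulr0 (nrm0_eq0 v0) -(scale0r 0) hq nrm0 mul0r.
have vp : 0 < nrm v by rewrite lt_def v0 nrm_ge0.
have := h ((((nrm v)^-1)%:C)%C *: v); rewrite nrmZ hq nrm_real ger0_norm ?invr_ge0 ?nrm_ge0//.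
by rewrite mulVf// => /(_ (lexx _)); rewrite mulrC ler_pdivrMr.
Qed.

Lemma bounded_linear_scale f (a : R[i]) v : bounded_linear f -> f (a *: v) = a * f v.
Proof.
by move=> bf; rewrite -[a *: v]addr0 bf.1 (bounded_linear0 bf) addr0.
Qed.

Lemma dual_norm_ge0 f : (0 <= dual_norm (f : F -> R[i]^o))%E.
Proof.
apply: (@le_trans _ _ (nrm (f 0))%:E); first by rewrite lee_fin nrm_ge0.
by apply: ereal_sup_ubound; exists 0 => //=; rewrite nrm0 ler01.
Qed.

Lemma dual_norm_le f (K : R) : 0 <= K -> (forall v, nrm (f v) <= K * nrm v) ->
  (dual_norm (f : F -> R[i]^o) <= K%:E)%E.
Proof.
move=> K0 h; apply: ge_ereal_sup => _ [v /= v1 <-]; rewrite lee_fin.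
by rewrite (le_trans (h v))// ler_piMr.
Qed.

Lemma dual_norm_fin_num f : bounded_linear f -> dual_norm (f : F -> R[i]^o) \is a fin_num.
Proof.
move=> /bounded_linear_bound[K K0 hK]; rewrite ge0_fin_numE ?dual_norm_ge0//.
exact: le_lt_trans (dual_norm_le K0 hK) (ltry _).
Qed.

Lemma nrm_le_dual_norm f v : bounded_linear f ->
  nrm (f v) <= fine (dual_norm (f : F -> R[i]^o)) * nrm v.
Proof.
move=> bf; apply: (homogeneous_le (q := fun v => nrm (f v))) => [a w|w w1].
  by rewrite bounded_linear_scale// nrmM.
by rewrite -lee_fin fineK ?dual_norm_fin_num//; apply: ereal_sup_ubound; exists w.
Qed.

Lemma dual_spaceP f : dual_space (f : F -> R[i]^o) <-> bounded_linear f.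
Proof.
split=> [[l c]|[l [K hK]]].
  have f0 : f 0 = 0 by have := l (-1) 0 0; rewrite !scaleN1r !addNr.
  split=> //; have := c 0.
  move=> /cvgrPdist_lt/(_ 1 ltr01)/nbhs_ballP[e /= e0].
  case: e e0 => a b; rewrite ltcE /= => /andP[/eqP -> a0] hr.
  have b1 v : nrm v < a -> nrm (f v) <= 1.
    move=> va; have := hr v; rewrite /= f0 sub0r normrN => /(_ _)/wrap[].
      by apply: ball_nrm; rewrite sub0r nrmN.
    by rewrite nrmE => /ltW; rewrite lecR.
  have lZ k v : f (k *: v) = k * f v by have := l k v 0; rewrite !addr0 f0 addr0.
  (* Continuity at 0 controls an open ball of radius a; the unit ball rescaled to radius a / 2 stays
     inside it. *)
  exists (2 / a) => v.
  apply: (homogeneous_le (q := fun v => nrm (f v))) => [k w|w w1].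
    by rewrite lZ nrmM.
  have a20 : 0 <= a / 2 by rewrite divr_ge0// ltW.
  have := b1 (((a / 2)%:C)%C *: w); rewrite nrmZ lZ nrmM nrm_real ger0_norm//.
  have a2 : a / 2 * nrm w < a by have := nrm_ge0 w; nra.
  move=> /(_ a2); rewrite ler_pdivlMr//; lra.
have bf : bounded_linear f by split=> //; exists K.
split=> // v; apply/cvgrPdist_lt => -[e b]; rewrite ltcE /= => /andP[/eqP -> e0].
have [M M0 hM] := bounded_linear_bound bf.
have M1 : 0 < M + 1 by rewrite ltr_wpDl.
have eM : 0 < e / (M + 1) by rewrite divr_gt0.
apply/nbhs_ballP; exists (((e / (M + 1))%:C)%C) => /=; first by rewrite ltcR.
move=> w; rewrite -ball_normE /ball_/= nrmE ltcR ltr_pdivlMr// => h.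
rewrite nrmE ltcR -bounded_linearB// (le_lt_trans (hM _))//.
have := nrm_ge0 (v - w); lra.
Qed.

Definition linear_map A := forall (a : R[i]) u w, A (a *: u + w) = a *: A u + A w.

Lemma linear_map0 A : linear_map A -> A 0 = 0.
Proof. by move=> l; have := l (-1) 0 0; rewrite !scaleN1r !addNr. Qed.

Lemma linear_mapZ A (a : R[i]) v : linear_map A -> A (a *: v) = a *: A v.
Proof. by move=> l; have := l a v 0; rewrite !addr0 linear_map0// addr0. Qed.

Lemma linear_mapB A u v : linear_map A -> A (u - v) = A u - A v.
Proof. by move=> l; rewrite -scaleN1r addrC l scaleN1r addrC. Qed.

Lemma opnorm_ge0 A : (0 <= opnorm A)%E.
Proof.
apply: (@le_trans _ _ (nrm (A 0))%:E); first by rewrite lee_fin nrm_ge0.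
by apply: ereal_sup_ubound; exists 0 => //=; rewrite nrm0 ler01.
Qed.

Lemma nrm_le_opnorm A v : linear_map A -> (opnorm A < +oo)%E ->
  nrm (A v) <= fine (opnorm A) * nrm v.
Proof.
move=> l Aoo; apply: (homogeneous_le (q := fun v => nrm (A v))) => [a w|w w1].
  by rewrite linear_mapZ// nrmZ.
by rewrite -lee_fin fineK ?ge0_fin_numE ?opnorm_ge0//; apply: ereal_sup_ubound; exists w.
Qed.

(** The lower bound rests on a norming functional. Through this identity the weights of the dual
    space become operator norms on [F]. *)
Lemma dual_opnorm_adjoint A : linear_map A -> (opnorm A < +oo)%E ->
  dual_opnorm (fun (f : F -> R[i]^o) v => f (A v)) = opnorm A.
Proof.
move=> l Aoo; apply/eqP; rewrite eq_le; apply/andP; split.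
  apply: ge_ereal_sup => _ [f /= [/dual_spaceP bf f1] <-].
  rewrite -[leRHS]fineK ?ge0_fin_numE ?opnorm_ge0//.
  apply: dual_norm_le; first by rewrite fine_ge0 ?opnorm_ge0.
  move=> v; rewrite (le_trans _ (nrm_le_opnorm v l Aoo))//.
  rewrite (le_trans (nrm_le_dual_norm _ bf))// ler_piMl ?nrm_ge0//.
  by rewrite -lee_fin fineK ?dual_norm_fin_num.
apply: ge_ereal_sup => _ [v /= v1 <-].
have [f bf [f1 fv]] := norming_functional (A v); rewrite -fv.
apply: (@le_trans _ _ (dual_norm ((fun v => f (A v)) : F -> R[i]^o))).
  by apply: ereal_sup_ubound; exists v.
apply: ereal_sup_ubound; exists f => //=; split; first exact/dual_spaceP.
by apply: dual_norm_le => // u; rewrite mul1r.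
Qed.

End dual.

(** * Integrable families of operators *)

Section action.
Context (R : realType) (d : nat) (F : completeNormedModType R[i]).
Local Notation V := 'rV[R]_d.
Local Notation T := (Rtuple R d).
Local Notation mu := (lebesgue R d).
Local Notation vec := (@vec_of_tuple R d).
Implicit Types (g : Cfun R d) (f : F -> R[i]) (x y : V) (u v : F).

Lemma near_enorm_le y0 : \forall y \near y0, enorm y <= d%:R * (`|y0| + 1).
Proof.
near=> x; rewrite (le_trans (enorm_le_norm x))// ler_wpM2l//.
have : `|x - y0| < 1.
  by near: x; apply: (@cvgr_distC_lt _ _ _ (nbhs y0) _ id y0) => //; exact: cvg_id.
have := ler_normD (x - y0) y0; rewrite subrK; lra.
Unshelve. all: by end_near.
Qed.

(** The setting shared by the two module operations. [S] stands for the image of the Gelfand-Shilov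
    space, and [act_gauss] is the only link between [act] and [U]. *)
Variables (U : V -> F -> F) (act : Cfun R d -> F -> F) (S : set F) (C L : R).
Local Notation eta := (fun y => opnorm (U y)).
Hypothesis U_linear : forall y, linear_map (U y).
Hypothesis L0 : 0 <= L.
Hypothesis U_growth : forall y, (eta y <= (C * expR (L * enorm y))%:E)%E.
Hypothesis S_dense : forall v (e : R), 0 < e -> exists2 w, S w & nrm (v - w) <= e.
Hypothesis S_continuous : forall w, S w -> nrm_continuous (fun y => U y w).
Hypothesis act_linearl : forall (a : R[i]) g1 g2 v, L1space eta g1 -> L1space eta g2 ->
  act (fun x => a * g1 x + g2 x) v = a *: act g1 v + act g2 v.
Hypothesis act_linearr : forall g, L1space eta g -> linear_map (act g).
Hypothesis act_continuous : exists K : R, forall g v, L1space eta g ->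
  ((nrm (act g v))%:E <= K%:E * L1norm eta g * (nrm v)%:E)%E.
Hypothesis act_gauss : forall s a w f, (forall i, 0 < s i) -> S w -> bounded_linear f ->
  f (act (translate a (cgauss s (fun=> 0%N))) w) =
  cintegral setT (fun y => translate a (cgauss s (fun=> 0%N)) y * f (U y w)).

Let eta_oo y : (eta y < +oo)%E.
Proof. exact: le_lt_trans (U_growth y) (ltry _). Qed.

Let W y := fine (eta y).

Let W0 y : 0 <= W y.
Proof. by rewrite fine_ge0 ?opnorm_ge0. Qed.

Let etaE y : eta y = (W y)%:E.
Proof. by rewrite fineK ?ge0_fin_numE ?opnorm_ge0. Qed.

Let WL y : W y <= C * expR (L * enorm y).
Proof. by rewrite -lee_fin -etaE. Qed.

Let nrmU y v : nrm (U y v) <= W y * nrm v.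
Proof. exact: nrm_le_opnorm. Qed.

Let C0 : 0 <= C.
Proof. by have := le_trans (W0 0) (WL 0); rewrite pmulr_lge0 ?expR_gt0. Qed.

(** Approximation of [v] by elements of [S], uniform near each point because the exponential growth
    bounds the operator norms locally. *)
Lemma action_continuous v : nrm_continuous (fun y => U y v).
Proof.
move=> y0 e e0; pose b := d%:R * (`|y0| + 1).
pose B := C * expR (L * b) + 1.
have B0 : 0 < B by rewrite ltr_wpDl// mulr_ge0 ?expR_ge0.
have [w Sw vw] := S_dense v (divr_gt0 e0 (mulr_gt0 (ltr0n R 3) B0)).
have e3 : 0 < e / 3 by rewrite divr_gt0.
have bd y : enorm y <= b -> nrm (U y v - U y w) <= e / 3.
  move=> yb; rewrite -linear_mapB// (le_trans (nrmU _ _))//.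
  have WB : W y <= B.
    rewrite (le_trans (WL y))// (@le_trans _ _ (C * expR (L * b)))//.
      by rewrite ler_wpM2l// ler_expR ler_wpM2l.
    by rewrite lerDl.
  apply: (@le_trans _ _ (B * (e / (3 * B)))); first by rewrite ler_pM ?nrm_ge0.
  by rewrite le_eqVlt (_ : _ * _ = e / 3) ?eqxx//; field; rewrite gt_eqF.
near=> y.
have h1 : nrm (U y v - U y w) <= e / 3 by apply: bd; near: y; exact: near_enorm_le.
have h2 : nrm (U y0 v - U y0 w) <= e / 3.
  by apply: bd; exact: nbhs_singleton (near_enorm_le y0).
have h3 : nrm (U y w - U y0 w) <= e / 3 by near: y; exact: S_continuous.
have t1 := nrm_dist_triangle (U y w) (U y v) (U y0 v).
have t2 := nrm_dist_triangle (U y0 w) (U y w) (U y0 v).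
rewrite (nrm_distC (U y0 w)) in t2; lra.
Unshelve. all: by end_near.
Qed.

(** A supremum of the continuous functions sending y to the norm of U_y v is lower
    semicontinuous. *)
Lemma measurable_action_norm : measurable_fun setT (eta \o vec).
Proof.
apply: measurable_vec_lower => a; rewrite openE => y /= /ereal_sup_gt[_ [v /= v1 <-]].
rewrite lte_fin => av; rewrite /interior.
have av2 : 0 < (nrm (U y v) - a) / 2 by rewrite divr_gt0// subr_gt0.
near=> z; apply: (@lt_le_trans _ _ (nrm (U z v))%:E); last first.
  by apply: ereal_sup_ubound; exists v.
rewrite lte_fin.
have : nrm (U z v - U y v) <= (nrm (U y v) - a) / 2.
  by near: z; exact: action_continuous.
have := nrm_le_dist (U y v) (U z v); rewrite nrm_distC; lra.
Unshelve. all: by end_near.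
Qed.

Let mW : measurable_fun setT (W \o vec).
Proof. exact: (measurableT_comp (fine_measurable measurableT) measurable_action_norm). Qed.

Let L1normE g : L1norm eta g = (\int[mu]_t (nrm (g (vec t)) * W (vec t))%:E)%E.
Proof. by apply: eq_integral => t _; rewrite etaE -EFinM. Qed.

Let L1space_weighted g : L1space eta g <-> weighted_L1 W g.
Proof.
rewrite /L1space /weighted_L1 /= L1normE.
have mgW : cmeasurable g -> measurable_fun setT (fun t => (nrm (g (vec t)) * W (vec t))%:E).
  by move=> mg; apply/measurable_EFinP; exact: (measurable_funM (measurable_nrm mg) mW).
have E : (\int[mu]_t `|(nrm (g (vec t)) * W (vec t))%:E| =
    \int[mu]_t (nrm (g (vec t)) * W (vec t))%:E)%E.
  by apply: eq_integral => t _; rewrite /= ger0_norm// mulr_ge0 ?nrm_ge0.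
split=> -[mg ig]; split=> //.
  by apply/integrableP; split; [exact: mgW|rewrite E].
by move/integrableP : ig => []; rewrite E.
Qed.

Let L1norm_fin g : L1space eta g ->
  L1norm eta g = (Rintegral mu setT (fun t => nrm (g (vec t)) * W (vec t)))%:E.
Proof.
move=> [mg ig]; rewrite -[LHS]fineK ?L1normE// ge0_fin_numE -?L1normE//.
by apply: integral_ge0 => t _; rewrite mule_ge0 ?lee_fin ?nrm_ge0 ?opnorm_ge0.
Qed.

Lemma action_cintegrable g f v : L1space eta g -> bounded_linear f ->
  cintegrable (fun y => g y * f (U y v)).
Proof.
move=> /L1space_weighted[mg ig] bf; have [M M0 hM] := bounded_linear_bound bf.
apply: (cintegrable_dominated (g := fun y => M * nrm v * (nrm (g y) * W y))).
- apply: cmeasurableM => //; apply: cmeasurable_functional => //.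
  exact: action_continuous.
- exact: (integrableZl measurableT (M * nrm v) ig).
- move=> y; rewrite nrmM mulrCA ler_wpM2l ?nrm_ge0// (le_trans (hM _))//.
  by rewrite -mulrA ler_wpM2l// mulrC.
Qed.

Lemma nrm_action_cintegral (A : set T) g f v (M : R) : measurable A -> L1space eta g ->
  bounded_linear f -> 0 <= M -> (forall u, nrm (f u) <= M * nrm u) ->
  ((nrm (cintegral A (fun y => g y * f (U y v))))%:E <= (M * nrm v)%:E * L1norm eta g)%E.
Proof.
move=> mA Lg bf M0 hM; rewrite L1norm_fin// -EFinM lee_fin.
have [mg ig] := (L1space_weighted g).1 Lg.
rewrite -(RintegralZl (M * nrm v) measurableT ig).
apply: (nrm_cintegral_dominated (g := fun y => M * nrm v * (nrm (g y) * W y))) => //.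
- exact: action_cintegrable.
- exact: (integrableZl measurableT (M * nrm v) ig).
- move=> y; rewrite nrmM mulrCA ler_wpM2l ?nrm_ge0// (le_trans (hM _))//.
  by rewrite -mulrA ler_wpM2l// mulrC.
Qed.

Lemma action_representation g f v : L1space eta g -> bounded_linear f ->
  f (act g v) = cintegral setT (fun y => g y * f (U y v)).
Proof.
move=> Lg bf; have [M M0 hM] := bounded_linear_bound bf.
have [Ka hKa] := act_continuous; pose K := `|Ka|.
have K0 : 0 <= K by exact: normr_ge0.
have hK h u : L1space eta h -> nrm (act h u) <= K * fine (L1norm eta h) * nrm u.
  move=> Lh; have := hKa h u Lh; rewrite L1norm_fin//= -!EFinM lee_fin => le.
  apply: le_trans le _; rewrite ler_wpM2r ?nrm_ge0// ler_wpM2r ?ler_norm//.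
  by apply: Rintegral_ge0 => t _; rewrite mulr_ge0 ?nrm_ge0.
pose D h u := f (act h u) - cintegral setT (fun y => h y * f (U y u)).
have D_le h u : L1space eta h -> nrm (D h u) <= (M * K + M) * nrm u * fine (L1norm eta h).
  move=> Lh; rewrite (le_trans (nrm_triangle _ _))// nrmN.
  have h1 := le_trans (hM (act h u)) (ler_wpM2l M0 (hK h u Lh)).
  have := nrm_action_cintegral u measurableT Lh bf M0 hM.
  rewrite -[X in (_ * X)%E]fineK; last by rewrite L1norm_fin.
  rewrite -EFinM lee_fin => h2; rewrite (le_trans (lerD h1 h2))//.
  rewrite [leRHS](_ : _ = M * (K * fine (L1norm eta h) * nrm u) +
    M * nrm u * fine (L1norm eta h))//.
  by move: (fine _) => I; ring.
have D_S h w : L1space eta h -> S w -> D h w = 0.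
  move=> Lh Sw; apply: (@weighted_L1_eq0 R d W (D ^~ w) ((M * K + M) * nrm w) C L) => //.
  - move=> a g1 g2 /L1space_weighted L1 /L1space_weighted L2.
    rewrite /D act_linearl// bf.1.
    rewrite (_ : cintegral setT (fun y => (a * g1 y + g2 y) * f (U y w)) =
      a * cintegral setT (fun y => g1 y * f (U y w)) +
      cintegral setT (fun y => g2 y * f (U y w))); first by ring.
    rewrite -cintegral_lin//; [|exact: action_cintegrable..].
    by apply: eq_cintegral => y; ring.
  - move=> k /L1space_weighted Lk; rewrite (le_trans (D_le k w Lk))//.
    by rewrite L1norm_fin.
  - by move=> s a s0; rewrite /D act_gauss// subrr.
  - exact/L1space_weighted.
apply/eqP; rewrite -subr_eq0 -/(D g v); apply/eqP/nrm0_eq0/eqP.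
rewrite eq_le nrm_ge0 andbT; apply/ler_addgt0Pr => e e0; rewrite add0r.
pose B := (M * K + M) * fine (L1norm eta g) + 1.
have I0 : 0 <= fine (L1norm eta g).
  by rewrite L1norm_fin//=; apply: Rintegral_ge0 => t _; rewrite mulr_ge0 ?nrm_ge0.
have B0 : 0 < B by rewrite ltr_wpDl// mulr_ge0// addr_ge0// mulr_ge0.
have [w Sw vw] := S_dense v (divr_gt0 e0 B0).
have <- : D g (v - w) = D g v.
  have cB : cintegral setT (fun y => g y * f (U y (v - w))) =
      cintegral setT (fun y => g y * f (U y v)) - cintegral setT (fun y => g y * f (U y w)).
    rewrite -cintegralB//; [|exact: action_cintegrable..].
    by apply: eq_cintegral => y; rewrite linear_mapB// bounded_linearB// mulrBr.
  rewrite /D cB linear_mapB ?bounded_linearB//; last exact: act_linearr.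
  have := D_S g w Lg Sw; rewrite /D => /eqP; rewrite subr_eq0 => /eqP ->.
  by ring.
rewrite (le_trans (D_le g _ Lg))//.
have vw' : nrm (v - w) * B <= e by rewrite -ler_pdivlMr.
apply: le_trans vw'; rewrite mulrAC mulrC ler_wpM2l ?nrm_ge0//.
by rewrite lerDl.
Qed.

(** The unspecified constant of [act_continuous] has disappeared: the bound is read off the integral
    formula. *)
Lemma dual_norm_action g f : L1space eta g -> bounded_linear f ->
  (dual_norm ((fun v => f (act g v)) : F -> R[i]^o)
     <= L1norm eta g * dual_norm (f : F -> R[i]^o))%E.
Proof.
move=> Lg bf; have ff := dual_norm_fin_num bf.
rewrite L1norm_fin// -(fineK ff) -EFinM; apply: dual_norm_le.
  apply: mulr_ge0; last by rewrite fine_ge0// dual_norm_ge0.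
  by apply: Rintegral_ge0 => t _; rewrite mulr_ge0 ?nrm_ge0.
move=> v; rewrite action_representation//.
have := nrm_action_cintegral v measurableT Lg bf.
move=> /(_ _ _ (fun u => nrm_le_dual_norm u bf)); rewrite fine_ge0 ?dual_norm_ge0// => /(_ isT).
by rewrite L1norm_fin// -EFinM lee_fin [X in _ <= X -> _]mulrC mulrA.
Qed.

(** The integrals over measurable subsets satisfy the same estimate as the full one, hence define
    elements of the dual as well. *)
Lemma action_pettis g f : L1space eta g -> bounded_linear f ->
  weakstar_pettis_integral (fun y v => (g y * f (U y v) : R[i]^o))
    (fun v => f (act g v)).
Proof.
move=> Lg bf; split.
- by move=> v; exact: action_cintegrable.
- move=> A mA; exists (fun v => cintegral A (fun y => g y * f (U y v))) => //.
  have [M M0 hM] := bounded_linear_bound bf.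
  apply/dual_spaceP; split.
    move=> a u w; rewrite -cintegral_lin//; [|exact: action_cintegrable..].
    by apply: eq_cintegral => y; rewrite U_linear bf.1; ring.
  exists (M * fine (L1norm eta g)) => u.
  have := nrm_action_cintegral u mA Lg bf M0 hM.
  by rewrite L1norm_fin// -EFinM lee_fin /= mulrAC.
- apply/dual_spaceP; split.
    by move=> a u w; rewrite act_linearr// bf.1.
  have [M M0 hM] := bounded_linear_bound bf.
  exists (M * fine (L1norm eta g)) => u; rewrite action_representation//.
  have := nrm_action_cintegral u measurableT Lg bf M0 hM.
  by rewrite L1norm_fin// -EFinM lee_fin /= mulrAC.
- by move=> v; exact: action_representation.
Qed.

End action.

(** * Translation-modulation invariant spaces *)

Section tmib.
Context (R : realType) (d : nat) (c : gs_class R).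
Context (F : completeNormedModType R[i]) (j : F -> Cfun R d -> R[i]).
Hypotheses (adm : gs_admissible c) (FT : is_TMIB c j).
Local Notation V := 'rV[R]_d.
Local Notation mu := (lebesgue R d).
Local Notation vec := (@vec_of_tuple R d).
Local Notation emb := (tmib_embed c j).
Local Notation tr := (tmib_translate c j).
Local Notation md := (tmib_modulate c j).
Implicit Types (phi psi chi : Cfun R d) (x y xi : V) (u v w : F).

Lemma tmib_embedP phi : gs_space c phi -> gs_eq c (j (emb phi)) (dist_of_fun phi).
Proof. by move=> /(tmib_sub FT)/(xgetPex 0). Qed.

Lemma tmib_embed_unique phi v : gs_eq c (j v) (dist_of_fun phi) -> emb phi = v.
Proof.
move=> h; apply: (tmib_inj FT) => chi Schi; rewrite h//.
have : exists w, gs_eq c (j w) (dist_of_fun phi) by exists v.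
by move/(xgetPex 0) => ->.
Qed.

Lemma tmib_translateP x v : gs_eq c (j (tr x v)) (dist_translate x (j v)).
Proof. by move: (tmib_translate_stable FT x v) => /(xgetPex 0). Qed.

Lemma tmib_modulateP xi v : gs_eq c (j (md xi v)) (dist_modulate xi (j v)).
Proof. by move: (tmib_modulate_stable FT xi v) => /(xgetPex 0). Qed.

Lemma gs_translate x phi : gs_space c phi -> gs_space c (translate x phi).
Proof. exact: (gs_family adm _ (@translate_family R d)). Qed.

Lemma gs_modulate xi phi : gs_space c phi -> gs_space c (modulate xi phi).
Proof. exact: (gs_family adm _ (@modulate_family R d)). Qed.

Lemma tmib_translate_linear x : linear_map (tr x).
Proof.
move=> a u w; apply: (tmib_inj FT) => chi Schi; have Sx := gs_translate (- x) Schi.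
by rewrite (tmib_linear FT)// !tmib_translateP// /dist_translate (tmib_linear FT).
Qed.

Lemma tmib_modulate_linear xi : linear_map (md xi).
Proof.
move=> a u w; apply: (tmib_inj FT) => chi Schi; have Sx := gs_modulate xi Schi.
by rewrite (tmib_linear FT)// !tmib_modulateP// /dist_modulate (tmib_linear FT).
Qed.

Lemma gs_mulf_cintegrable phi chi : gs_space c phi -> gs_space c chi ->
  cintegrable (Defs.mulf phi chi).
Proof.
move=> Sphi Schi; have [K hK] := gs_bounded_fun adm Sphi.
have [sphi _] := Sphi.
exact: (cintegrableM_bounded (gs_cintegrable adm Schi) (smooth_cmeasurable sphi) hK).
Qed.

Lemma tmib_embed_translate x phi : gs_space c phi -> emb (translate x phi) = tr x (emb phi).
Proof.
move=> Sphi; apply: tmib_embed_unique => chi Schi.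
have Sx := gs_translate (- x) Schi.
rewrite tmib_translateP// /dist_translate tmib_embedP// /dist_of_fun.
rewrite -(cintegral_shift (- x)); last exact: gs_mulf_cintegrable.
by apply: eq_cintegral => y; rewrite /Defs.mulf /translate opprK subrK.
Qed.

Lemma tmib_embed_modulate xi phi : gs_space c phi -> emb (modulate xi phi) = md xi (emb phi).
Proof.
move=> Sphi; apply: tmib_embed_unique => chi Schi.
have Sx := gs_modulate xi Schi.
rewrite tmib_modulateP// /dist_modulate tmib_embedP// /dist_of_fun.
by apply: eq_cintegral => y; rewrite /Defs.mulf /modulate; ring.
Qed.

Lemma tmib_embedB phi psi : gs_space c phi -> gs_space c psi ->
  emb (fun x => phi x - psi x) = emb phi - emb psi.
Proof.
move=> Sphi Spsi; apply: tmib_embed_unique => chi Schi.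
rewrite -scaleN1r addrC (tmib_linear FT)// !tmib_embedP// mulN1r addrC.
rewrite /dist_of_fun -cintegralB//; [|exact: gs_mulf_cintegrable..].
by apply: eq_cintegral => y; rewrite /Defs.mulf; ring.
Qed.

Lemma tmib_family_continuous (U : V -> Cfun R d -> Cfun R d) phi : admissible_family U ->
  gs_space c phi -> nrm_continuous (fun x => emb (U x phi)).
Proof.
move=> aU Sphi x0 e e0.
have := gs_family_continuous adm x0 aU Sphi (tmib_sub_continuous FT) e0.
apply: (@filterS _ (nbhs x0) (nbhs_filter x0)) => x.
by rewrite tmib_embedB//; exact: gs_family.
Qed.

Lemma tmib_dense v (e : R) : 0 < e -> exists2 w, (emb @` gs_space c) w & nrm (v - w) <= e.
Proof.
move=> e0; have e0' : 0 < ((e%:C)%C : R[i]) by rewrite ltcR.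
have nb : nbhs v (ball v ((e%:C)%C : R[i])) by exact: nbhsx_ballx.
have [w [/interior_subset bw Sw]] := tmib_sub_dense FT
  (ex_intro _ v (nb : (ball v ((e%:C)%C : R[i]))^° v)) (open_interior _).
exists w => //; move: bw; rewrite -ball_normE /ball_/= nrmE ltcR; exact: ltW.
Qed.

Lemma tmib_exp_growth : exists C L : R, [/\ 0 <= L,
  forall x, (omega_F c j x <= (C * expR (L * enorm x))%:E)%E &
  forall xi, (nu_F c j xi <= (C * expR (L * enorm xi))%:E)%E].
Proof.
have [tau [C [t0 C0 [gA gM]]]] : exists tau C : R, [/\ 0 < tau, 0 < C & growth_bound c j tau C].
  (* In the Roumieu case every tau is allowed, and 1 is taken. *)
  have := tmib_growth FT; case: ifP => // _ /(_ 1 ltr01)[C C0 h].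
  by exists 1, C.
have [CA [LA [CA0 LA0 hA]]] := Aweight_exp_type adm t0.
have [CM [LM [CM0 LM0 hM]]] := Mweight_exp_type adm t0.
have key (C1 L1 : R) (r : R) (w : R -> R) : 0 < C1 -> 0 <= L1 -> 0 <= r -> 
    C1 <= CA + CM -> L1 <= LA + LM -> w r <= C1 * expR (L1 * r) ->
    C * w r <= C * (CA + CM) * expR ((LA + LM) * r).
  move=> C10 L10 r0 c1 l1 h; rewrite -mulrA ler_wpM2l ?(ltW C0)// (le_trans h)//.
  rewrite ler_pM ?expR_ge0 ?(ltW C10)// ler_expR.
  exact: ler_wpM2r.
exists (C * (CA + CM)), (LA + LM); split; first exact: addr_ge0.
- move=> x; apply: le_trans (gA x) _; rewrite lee_fin.
  apply: (key CA LA _ (fun r => expR (Aweight c tau r))) => //.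
  + exact: enorm_ge0.
  + by rewrite lerDl ltW.
  + by rewrite lerDl.
  + by apply: hA; exact: enorm_ge0.
- move=> x; apply: le_trans (gM x) _; rewrite lee_fin.
  apply: (key CM LM _ (fun r => expR (Mweight c tau r))) => //.
  + exact: enorm_ge0.
  + by rewrite lerDr ltW.
  + by rewrite lerDr.
  + by apply: hM; exact: enorm_ge0.
Qed.

(** A single test function is a bounded set, so continuity of the inclusion gives continuity of the
    evaluation; by injectivity of [j] these functionals separate the points of [F]. *)
Lemma tmib_eval chi : gs_space c chi -> bounded_linear (fun v => j v chi).
Proof.
move=> Schi; split=> [a u w|]; first exact: (tmib_linear FT).
have [|K hK] := tmib_incl_continuous FT (B := [set chi]).
  split=> [_ ->//|p [_ _]]; exists (p chi) => _ ->; exact: lexx.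
by exists K => v; exact: hK.
Qed.

Lemma translated_gauss_weight (s : 'I_d -> R) a (L : R) : (forall i, 0 < s i) -> 0 <= L ->
  exists2 k : V -> R, mu.-integrable setT (fun t => (k (vec t))%:E) &
    forall y, nrm (translate a (cgauss s (fun=> 0%N)) y) * expR (L * enorm y) <= k y.
Proof.
move=> s0 L0; have [K K0 hK] := gauss_rho (fun=> 0%N) s0 (mulr_ge0 (ler0n R 2) L0).
exists (fun y => expR (2 * L * enorm a) * K * rho (y - a)).
  have := integrable_affine (- a) (or_introl erefl)
    (integrable_rhoZ d (expR (2 * L * enorm a) * K)).
  by under eq_fun do rewrite affine_tupleE scale1r.
move=> y; rewrite /translate nrm_cgauss.
have ya : enorm y <= 2 * enorm (y - a) + 2 * enorm a.
  rewrite (le_trans (enorm_le_max a y))// -mulrDr ler_wpM2l// ge_max.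
  by rewrite lerDl lerDr !enorm_ge0.
have e1 : expR (L * enorm y) <= expR (2 * L * enorm (y - a)) * expR (2 * L * enorm a).
  rewrite -expRD ler_expR (le_trans (ler_wpM2l L0 ya))//.
  by rewrite le_eqVlt; apply/orP; left; apply/eqP; ring.
rewrite (le_trans (ler_wpM2l (normr_ge0 _) e1))// mulrA [leLHS]mulrC -[leRHS]mulrA.
by rewrite ler_wpM2l ?expR_ge0.
Qed.

End tmib.

Section gauss_action.
Context (R : realType) (d : nat) (F : completeNormedModType R[i]).
Local Notation V := 'rV[R]_d.
Local Notation vec := (@vec_of_tuple R d).

Lemma nrm_continuous_opp (Phi : V -> F) :
  nrm_continuous Phi -> nrm_continuous (fun y => Phi (- y)).
Proof.
move=> cP x0 e e0; have := cP (- x0) e e0.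
by move=> h; have := @opp_continuous V x0 _ h.
Qed.

(** The Gaussian beats the exponential growth of the operators, so the integrand has an integrable
    norm. *)
Lemma gauss_weak_integral (U : V -> F -> F) (C L : R) (s : 'I_d -> R) (a : V) (w : F) :
  (forall y, linear_map (U y)) -> 0 <= L ->
  (forall y, (opnorm (U y) <= (C * expR (L * enorm y))%:E)%E) ->
  nrm_continuous (fun y => U y w) -> (forall i, 0 < s i) ->
  exists I : F, forall f, bounded_linear f ->
    f I = cintegral setT (fun y => translate a (cgauss s (fun=> 0%N)) y * f (U y w)).
Proof.
move=> lU L0 gU cU s0; set G := translate a _.
have [k ik hk] := translated_gauss_weight a s0 L0.
have mG : cmeasurable G.
  by apply: smooth_cmeasurable; apply: smooth_translate; exact: smooth_cgauss.
have G1 x : nrm (G x) <= k x.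
  rewrite (le_trans _ (hk x))// ler_peMr ?nrm_ge0// -expR0 ler_expR.
  by rewrite mulr_ge0 ?enorm_ge0.
have [|I hI] := weak_integral (cintegrable_dominated mG ik G1) cU; last first.
  by exists I => f bf; have [] := hI f bf.
have iC := integrableZl measurableT (C * nrm w) ik.
apply: (le_integrable measurableT _ _ iC).
  apply/measurable_EFinP; apply: measurable_funM; first exact: measurable_nrm.
  have := @measurable_vec_continuous R d _ (@nrm_continuousP _ _ _ _ 0 cU).
  by congr (measurable_fun _ _); apply/funext => t; rewrite /= subr0.
move=> t _; rewrite lee_fin ger0_norm ?mulr_ge0 ?nrm_ge0//= (le_trans _ (ler_norm _))//.
have Uoo : (opnorm (U (vec t)) < +oo)%E := le_lt_trans (gU _) (ltry _).
have h1 : nrm (U (vec t) w) <= C * expR (L * enorm (vec t)) * nrm w.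
  rewrite (le_trans (nrm_le_opnorm w (lU _) Uoo))// ler_wpM2r ?nrm_ge0//.
  by rewrite -lee_fin fineK// ge0_fin_numE ?opnorm_ge0.
have C0 : 0 <= C.
  by have := le_trans (opnorm_ge0 _) (gU 0); rewrite lee_fin pmulr_lge0 ?expR_gt0.
rewrite (le_trans (ler_wpM2l (nrm_ge0 _) h1))//.
rewrite [leLHS](_ : _ = C * nrm w * (nrm (G (vec t)) * expR (L * enorm (vec t)))).
  by rewrite ler_wpM2l ?mulr_ge0 ?nrm_ge0.
by move: (nrm (G _)) (expR _) => p q; ring.
Qed.

End gauss_action.

(** * Convolution *)

Section convolution_action.
Context (R : realType) (d : nat) (c : gs_class R).
Context (F : completeNormedModType R[i]) (j : F -> Cfun R d -> R[i]).
Context (conv : Cfun R d -> F -> F).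
Hypotheses (adm : gs_admissible c) (FT : is_TMIB c j) (cv : is_convolution_on c j conv).
Local Notation V := 'rV[R]_d.
Local Notation T := (Rtuple R d).
Local Notation vec := (@vec_of_tuple R d).
Local Notation emb := (tmib_embed c j).
Local Notation tr := (tmib_translate c j).
Implicit Types (phi psi chi : Cfun R d) (x y : V) (u v w : F) (g : Cfun R d).

(** Two elements of [F] are compared through test functions: tested against chi, the weak integral
    becomes a double integral, which Fubini's theorem and a translation turn into the pairing with
    the convolution. *)
Lemma gauss_convolution (s : 'I_d -> R) (a : V) psi (f : F -> R[i]) :
  (forall i, 0 < s i) -> gs_space c psi -> bounded_linear f ->
  f (conv (reflect_fun (translate a (cgauss s (fun=> 0%N)))) (emb psi)) =
  cintegral setT (fun y => translate a (cgauss s (fun=> 0%N)) y * f (tr (- y) (emb psi))).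
Proof.
move=> s0 Spsi bf; set G := translate a _.
have [C [L [L0 gO _]]] := tmib_exp_growth adm FT.
have lU y : linear_map (tr (- y)) := tmib_translate_linear adm FT (- y).
have gU y : (opnorm (tr (- y)) <= (C * expR (L * enorm y))%:E)%E.
  by rewrite -[enorm y]enormN; exact: gO.
have cU : nrm_continuous (fun y => tr (- y) (emb psi)).
  apply: (@nrm_continuous_opp _ _ _ (fun y => tr y (emb psi))).
  have := tmib_family_continuous adm FT (@translate_family R d) Spsi.
  by under eq_fun do rewrite tmib_embed_translate//.
have [I hI] := gauss_weak_integral a lU L0 gU cU s0.
have SG0 : gs_space c (cgauss s (fun=> 0%N)) by exact: gs_cgauss.
have SG : gs_space c G by exact: (gs_translate adm).
(* A Gaussian is even, so the reflection of its translate by a is its translate by -a and remains in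
   the space. *)
have Gr : reflect_fun G = translate (- a) (cgauss s (fun=> 0%N)).
  apply/funext => x; rewrite /reflect_fun /G /translate opprK.
  rewrite /cgauss /gauss; congr (_%:C)%C; apply: eq_bigr => i _.
  by rewrite /= !mxE; congr expR; ring.
have SGr : gs_space c (reflect_fun G) by rewrite Gr; exact: (gs_translate adm).
rewrite (conv_extends cv)// (_ : emb _ = I) ?hI//.
apply: (tmib_embed_unique FT) => chi Schi.
rewrite (hI _ (tmib_eval FT Schi)) -/G.
have [spsi _] := Spsi; have [schi _] := Schi; have [sG _] := SG.
have [M hM] := gs_bounded_fun adm Spsi.
have iG := gs_cintegrable adm SG.
have ichi := gs_cintegrable adm Schi.
rewrite (eq_cintegral setT (g := fun y => cintegral setT
    (fun z => G y * (psi (y + 1 *: z) * chi z)))); last first.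
  move=> y; rewrite -(tmib_embed_translate adm FT)// (tmib_embedP FT)//; last exact: (gs_translate adm).
  rewrite -cintegralZ//; last by apply: (gs_mulf_cintegrable adm) => //; exact: (gs_translate adm).
  by apply: eq_cintegral => z; rewrite /Defs.mulf /translate opprK scale1r (addrC y).
rewrite (cintegral_fubini (g := fun y => nrm (G y)) (h := fun z => M * nrm (chi z))).
- apply: eq_cintegral => z; rewrite /Defs.mulf /convolution mulrC.
  have [MG hMG] := gs_bounded_fun adm SG.
  have iq : cintegrable (fun y => reflect_fun G (z - y) * psi y).
    apply: (cintegrableM_bounded (gs_cintegrable adm Spsi) _ (fun y => hMG _)).
    have := cmeasurable_affine 1 (- z) (smooth_cmeasurable sG).
    by congr cmeasurable; apply/funext => y; rewrite /reflect_fun opprB scale1r.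
  rewrite -cintegralZ// -[RHS](cintegral_shift z); last exact: cintegrableZ.
  apply: eq_cintegral => y; rewrite /reflect_fun opprB addrK scale1r.
  by ring.
- apply: cmeasurable2M; first by apply: cmeasurable2_fst; exact: smooth_cmeasurable.
  apply: cmeasurable2M; first by apply: cmeasurable2_add; exact: smooth_cmeasurable.
  by apply: cmeasurable2_snd; exact: smooth_cmeasurable.
- exact: integrable_nrm.
- exact: (integrableZl measurableT M (integrable_nrm ichi)).
- by move=> y z; rewrite !nrmM ler_wpM2l ?nrm_ge0// ler_wpM2r ?nrm_ge0.
Qed.

Lemma omega_EE : omega_E c j = (fun y => opnorm (tr (- y))).
Proof.
have [C [L [_ gO _]]] := tmib_exp_growth adm FT.
apply/funext => y; rewrite -dual_opnorm_adjoint//; first exact: (tmib_translate_linear adm FT).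
exact: le_lt_trans (gO _) (ltry _).
Qed.

(** The operation on [F] is defined on L^1 with weight [omega_F], while [g] belongs to the reflected
    weight; the reflection in the dual operation is an isometry between the two spaces. *)
Lemma convolution_module g f : L1space (omega_E c j) g -> bounded_linear f ->
  (dual_norm (dual_convolution conv g f) <= L1norm (omega_E c j) g * dual_norm (f : F -> R[i]^o))%E /\
  weakstar_pettis_integral (fun y v => (g y * dual_translate c j y f v : R[i]^o))
    (dual_convolution conv g f).
Proof.
have [C [L [L0 gO _]]] := tmib_exp_growth adm FT.
rewrite omega_EE.
have lU y : linear_map (tr (- y)) := tmib_translate_linear adm FT (- y).
have gU y : (opnorm (tr (- y)) <= (C * expR (L * enorm y))%:E)%E.
  by rewrite -[enorm y]enormN; exact: gO.
have cT w : (emb @` gs_space c) w -> nrm_continuous (fun y => tr y w).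
  move=> [psi Spsi <-]; have := tmib_family_continuous adm FT (@translate_family R d) Spsi.
  by under eq_fun do rewrite tmib_embed_translate//.
have cU w : (emb @` gs_space c) w -> nrm_continuous (fun y => tr (- y) w).
  by move=> /cT h; exact: (@nrm_continuous_opp _ _ _ (fun y => tr y w)).
(* The change of variable in the weighted norm requires the weight to be measurable. *)
have mO : measurable_fun setT (omega_F c j \o vec).
  exact: (measurable_action_norm (tmib_translate_linear adm FT) L0 gO (tmib_dense FT) cT).
have L1E h : cmeasurable h ->
    L1norm (omega_F c j) (reflect_fun h) = L1norm (fun y => opnorm (tr (- y))) h.
  move=> mh; have mr : cmeasurable (reflect_fun h).
    have := cmeasurable_affine (-1) 0 mh.
    by congr cmeasurable; apply/funext => y; rewrite /reflect_fun scaleN1r addr0.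
  have mf : measurable_fun setT (fun t : T =>
      ((nrm (reflect_fun h (vec t)))%:E * omega_F c j (vec t))%E).
    by apply: emeasurable_funM mO; apply/measurable_EFinP; exact: measurable_nrm.
  have p0 t : (0 <= (nrm (reflect_fun h (vec t)))%:E * omega_F c j (vec t))%E.
    by rewrite mule_ge0 ?lee_fin ?nrm_ge0 ?opnorm_ge0.
  have := @ge0_integral_affine R d (-1) 0 _ (or_intror erefl) mf p0.
  move=> /esym; rewrite /L1norm => ->; apply: eq_integral => t _.
  by rewrite affine_tupleE scaleN1r addr0 /reflect_fun opprK.
have L1r h : L1space (fun y => opnorm (tr (- y))) h -> L1space (omega_F c j) (reflect_fun h).
  move=> [mh hoo]; split; last by rewrite L1E.
  have := cmeasurable_affine (-1) 0 mh.
  by congr cmeasurable; apply/funext => y; rewrite /reflect_fun scaleN1r addr0.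
have a1 (a : R[i]) g1 g2 v : L1space (fun y => opnorm (tr (- y))) g1 ->
    L1space (fun y => opnorm (tr (- y))) g2 ->
    conv (reflect_fun (fun x => a * g1 x + g2 x)) v =
    a *: conv (reflect_fun g1) v + conv (reflect_fun g2) v.
  by move=> /L1r L1 /L1r L2; rewrite -(conv_linearl cv).
have a2 h : L1space (fun y => opnorm (tr (- y))) h -> linear_map (conv (reflect_fun h)).
  by move=> /L1r; exact: (conv_linearr cv).
have a3 : exists K : R, forall h v, L1space (fun y => opnorm (tr (- y))) h ->
    ((nrm (conv (reflect_fun h) v))%:E <=
     K%:E * L1norm (fun y => opnorm (tr (- y))) h * (nrm v)%:E)%E.
  have [K hK] := conv_continuous cv; exists K => h v Lh.
  by rewrite -L1E; [exact: hK (L1r _ Lh)|exact: Lh.1].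
have a4 (s : 'I_d -> R) a w (f0 : F -> R[i]) : (forall i, 0 < s i) -> (emb @` gs_space c) w ->
    bounded_linear f0 ->
    f0 (conv (reflect_fun (translate a (cgauss s (fun=> 0%N)))) w) =
    cintegral setT (fun y => translate a (cgauss s (fun=> 0%N)) y * f0 (tr (- y) w)).
  by move=> s0 [psi Spsi <-]; exact: gauss_convolution.
move=> Lg bf; split.
- exact: (dual_norm_action (act := fun h => conv (reflect_fun h)) lU L0 gU (tmib_dense FT) cU a1 a2 a3 a4).
- exact: (action_pettis (act := fun h => conv (reflect_fun h)) lU L0 gU (tmib_dense FT) cU a1 a2 a3 a4).
Qed.

End convolution_action.

(** * Measurability and duality of the Fourier transform *)

Section fourier_duality.
Context (R : realType) (d : nat).
Local Notation T := (Rtuple R d).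
Local Notation vec := (@vec_of_tuple R d).
Implicit Types (f g : Cfun R d).

Let cmeasurable2_kernel f : cmeasurable f ->
  cmeasurable2 (fun xi x => cis (- (2 * pi * dotv x xi)) * f x).
Proof.
move=> mf; apply: cmeasurable2M; last exact: cmeasurable2_snd.
have := @cmeasurable2_cis R d (- (2 * pi)).
congr cmeasurable2; apply/funext => xi; apply/funext => x.
by rewrite dotvC mulNr.
Qed.

(** Fubini's theorem makes the product of the transform with [rho] integrable, in particular
    measurable, and [rho] is then divided out. *)
Lemma cmeasurable_fourier f : cintegrable f -> cmeasurable (fourier f).
Proof.
move=> If; have mf := cintegrable_measurable If.
have mr := cmeasurable_real (@measurable_rho R d).
have := cintegrable_fubini (f := fun xi x => ((rho xi)%:C)%C * (cis (- (2 * pi * dotv x xi)) * f x))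
  (g := @rho R d) (h := fun x => nrm (f x)).
have m2 : cmeasurable2 (fun xi x => ((rho xi)%:C)%C * (cis (- (2 * pi * dotv x xi)) * f x)).
  by apply: cmeasurable2M (cmeasurable2_kernel mf); exact: (cmeasurable2_fst mr).
move=> /(_ m2 (@integrable_rho R d) (integrable_nrm If)) /(_ _)/wrap[xi x|].
  by rewrite !nrmM nrm_cis mul1r nrm_real ger0_norm ?rho_ge0.
move=> /cintegrable_measurable.
rewrite (_ : (fun xi => _) = (fun xi => ((rho xi)%:C)%C * fourier f xi)); last first.
  apply/funext => xi; rewrite cintegralZ//.
  exact: (cintegrable_kernel xi If).
have mp : measurable_fun setT (fun t : T => \prod_i (1 + (vec t) 0 i ^+ 2)).
  apply: measurable_prod => i _; apply: measurable_funD => //; apply: measurable_funX.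
  by under eq_fun do rewrite mxE; exact: measurable_tnth.
have mq := @cmeasurable_real R d (fun x => \prod_i (1 + x 0 i ^+ 2)) mp.
move=> mrf; have := cmeasurableM mq mrf.
congr cmeasurable; apply/funext => xi; rewrite mulrA -rmorphM /rho -big_split/=.
rewrite big1 ?rmorph1 ?mul1r// => i _; rewrite mulfV// gt_eqF//.
by rewrite ltr_wpDr ?sqr_ge0.
Qed.

Lemma fourier_duality f g : cintegrable f -> cintegrable g ->
  cintegral setT (fun xi => fourier f xi * g xi) =
  cintegral setT (fun x => f x * fourier g x).
Proof.
move=> If Ig.
rewrite (eq_cintegral setT (g := fun xi => cintegral setT
    (fun x => g xi * (cis (- (2 * pi * dotv x xi)) * f x)))); last first.
  by move=> xi; rewrite mulrC cintegralZ//; exact: (cintegrable_kernel xi If).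
rewrite (cintegral_fubini (g := fun xi => nrm (g xi)) (h := fun x => nrm (f x))).
- apply: eq_cintegral => x; rewrite -cintegralZ//; last exact: (cintegrable_kernel x Ig).
  by apply: eq_cintegral => xi; rewrite dotvC; ring.
- apply: cmeasurable2M; first by apply: cmeasurable2_fst; exact: cintegrable_measurable.
  by apply: cmeasurable2_kernel; exact: cintegrable_measurable.
- exact: integrable_nrm.
- exact: integrable_nrm.
- by move=> xi x; rewrite !nrmM nrm_cis mul1r.
Qed.

Lemma fourier_translate a f : cintegrable f -> fourier (translate a f) = modulate (- a) (fourier f).
Proof.
move=> If; apply/funext => xi; rewrite /modulate /fourier.
rewrite -cintegralZ//; last exact: (cintegrable_kernel xi If).
rewrite -(cintegral_shift a).
  apply: eq_cintegral => x; rewrite /translate addrK mulrA -cisD; congr (cis _ * _).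
  have -> : dotv (x + a) xi = dotv x xi - dotv (- a) xi.
    by rewrite /dotv -sumrB; apply: eq_bigr => i _; rewrite !mxE; ring.
  by ring.
have := cintegrable_shift (- a) If => /(cintegrable_kernel xi).
exact.
Qed.

End fourier_duality.

Section L1_space.
Context (R : realType) (d : nat).
Local Notation T := (Rtuple R d).
Local Notation vec := (@vec_of_tuple R d).
Variable eta : 'rV[R]_d -> \bar R.
Hypothesis eta0 : forall y, (0 <= eta y)%E.
Implicit Types g : Cfun R d.

Lemma L1norm_ge0 g : (0 <= L1norm eta g)%E.
Proof. by apply: integral_ge0 => t _; rewrite mule_ge0 ?lee_fin ?nrm_ge0. Qed.

Lemma L1space_lin (a : R[i]) g1 g2 : measurable_fun setT (eta \o vec) ->
  L1space eta g1 -> L1space eta g2 -> L1space eta (fun x => a * g1 x + g2 x).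
Proof.
move=> me [m1 i1] [m2 i2].
have m12 : cmeasurable (fun x => a * g1 x + g2 x).
  by apply: cmeasurableD m2; apply: cmeasurableM m1; exact: cmeasurable_cst.
have mg g : cmeasurable g -> measurable_fun setT (fun t : T => ((nrm (g (vec t)))%:E * eta (vec t))%E).
  by move=> /measurable_nrm/measurable_EFinP mg; exact: (emeasurable_funM mg me).
have p0 g t : (0 <= (nrm (g (vec t)))%:E * eta (vec t))%E.
  by rewrite mule_ge0 ?lee_fin ?nrm_ge0.
split=> //; apply: (@le_lt_trans _ _ ((nrm a)%:E * L1norm eta g1 + L1norm eta g2)%E); last first.
  by rewrite lte_add_pinfty// lte_mul_pinfty ?lee_fin ?nrm_ge0.
rewrite /L1norm -ge0_integralZl//; [|exact: mg|by rewrite lee_fin nrm_ge0].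
rewrite -ge0_integralD//; [|by move=> t _; rewrite mule_ge0 ?lee_fin ?nrm_ge0|
  exact: (emeasurable_funM (measurable_cst _) (mg _ m1))|exact: mg].
apply: ge0_le_integral => //.
- by move=> t _; rewrite mule_ge0 ?lee_fin ?nrm_ge0.
- exact: (mg _ m12).
- exact: (emeasurable_funD (emeasurable_funM (measurable_cst _) (mg _ m1)) (mg _ m2)).
- move=> t _; rewrite muleA -EFinM -ge0_muleDl ?lee_fin ?mulr_ge0 ?nrm_ge0//.
  by rewrite lee_wpmul2r// -EFinD lee_fin -nrmM nrm_triangle.
Qed.

End L1_space.

(** * Multiplication *)

Section multiplication_action.
Context (R : realType) (d : nat) (c : gs_class R).
Context (F : completeNormedModType R[i]) (j : F -> Cfun R d -> R[i]).
Context (mult : (Cfun R d -> R[i]) -> F -> F).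
Hypotheses (adm : gs_admissible c) (FT : is_TMIB c j) (mt : is_multiplication_on c j mult).
Local Notation V := 'rV[R]_d.
Local Notation T := (Rtuple R d).
Local Notation mu := (lebesgue R d).
Local Notation vec := (@vec_of_tuple R d).
Local Notation emb := (tmib_embed c j).
Local Notation md := (tmib_modulate c j).
Local Notation nu := (nu_F c j).
Implicit Types (phi psi chi : Cfun R d) (x y xi : V) (v w : F) (u : Cfun R d)
  (h : Cfun R d -> R[i]).

Definition dual_fourier u : Cfun R d -> R[i] := fun phi => dist_of_fun u (fourier phi).

Lemma modulate_action_linear xi : linear_map (md (- xi)).
Proof. exact: (tmib_modulate_linear adm FT). Qed.

Lemma modulate_action_continuous w : (emb @` gs_space c) w -> nrm_continuous (fun xi => md (- xi) w).
Proof.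
move=> [psi Spsi <-]; apply: (@nrm_continuous_opp _ _ _ (fun xi => md xi (emb psi))).
have := tmib_family_continuous adm FT (@modulate_family R d) Spsi.
by under eq_fun do rewrite tmib_embed_modulate//.
Qed.

Lemma measurable_nu_F : measurable_fun setT (nu \o vec).
Proof.
have [C [L [L0 _ gM]]] := tmib_exp_growth adm FT.
exact: (measurable_action_norm modulate_action_linear L0 gM (tmib_dense FT) modulate_action_continuous).
Qed.

Lemma nu_F_lty xi : (nu xi < +oo)%E.
Proof.
by have [C [L [_ _ gM]]] := tmib_exp_growth adm FT; exact: le_lt_trans (gM xi) (ltry _).
Qed.

Lemma nu_F_fine xi : nu xi = (fine (nu xi))%:E.
Proof. by rewrite fineK// ge0_fin_numE ?opnorm_ge0 ?nu_F_lty. Qed.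

Lemma nu_EE : nu_E c j = nu.
Proof. by apply/funext => y; exact: (dual_opnorm_adjoint (modulate_action_linear y) (nu_F_lty y)). Qed.

(** As M_xi M_(-xi) is the identity on a nonzero space, 1 <= nu(-xi) nu(xi), and the growth
    condition bounds nu(-xi). *)
Lemma nu_lower (tau C : R) xi : growth_bound c j tau C -> (exists v : F, v != 0) ->
  expR (- Mweight c tau (enorm xi)) <= C * fine (nu xi).
Proof.
move=> [_ gM] [v v0].
have vE : md xi (md (- xi) v) = v.
  apply: (tmib_inj FT) => chi Schi.
  rewrite (tmib_modulateP FT)// /dist_modulate (tmib_modulateP FT); last exact: gs_modulate.
  rewrite /dist_modulate; congr (j v _); apply/funext => y; rewrite /modulate mulrA -cisD.
  rewrite (_ : _ + _ = 0) ?cis0 ?mul1r// /dotv.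
  rewrite -mulrDr -big_split big1 ?mulr0//= => i _.
  by rewrite !mxE; ring.
have vp : 0 < nrm v.
  by rewrite lt_def nrm_ge0 andbT; apply: contraNneq v0 => /nrm0_eq0 ->.
have n1 := nrm_le_opnorm v (modulate_action_linear xi) (nu_F_lty xi).
have := nrm_le_opnorm (md (- xi) v) (tmib_modulate_linear adm FT xi).
have nN : opnorm (md xi) = nu (- xi) by rewrite /nu_F opprK.
rewrite nN => /(_ (nu_F_lty _)); rewrite vE => n2.
have nb : fine (nu (- xi)) <= C * expR (Mweight c tau (enorm xi)).
  by rewrite -lee_fin -nu_F_fine -[enorm xi]enormN; exact: gM.
have a0 : 0 <= fine (nu (- xi)) by rewrite fine_ge0 ?opnorm_ge0.
have b0 : 0 <= fine (nu xi) by rewrite fine_ge0 ?opnorm_ge0.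
have : nrm v <= C * expR (Mweight c tau (enorm xi)) * fine (nu xi) * nrm v.
  apply: (le_trans n2); rewrite -mulrA.
  by rewrite ler_pM ?nrm_ge0.
rewrite -[leLHS]mul1r ler_pM2r// => le1.
rewrite expRN -[leLHS]mul1r ler_pdivrMr ?expR_gt0//.
by rewrite (le_trans le1)// mulrAC.
Qed.

(** The rates match: tau is prescribed by the growth of nu in the Beurling cases and by the decay of
    the transform in the Roumieu case. *)
Lemma fourier_le_nu chi : gs_space c chi -> (exists v : F, v != 0) ->
  exists K : R, forall xi, nrm (fourier chi xi) <= K * fine (nu xi).
Proof.
move=> Schi Fn0; have [tau [C [K [C0 gb dK]]]] : exists tau C K, [/\ 0 < C, growth_bound c j tau C &
    forall xi, nrm (fourier chi xi) * expR (Mweight c tau (enorm xi)) <= K].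
  have := fourier_decay adm Schi; have := tmib_growth FT; rewrite /=.
  case: ifP => _ gr.
    by move=> [tau t0 [K hK]]; have [C C0 g] := gr tau t0; exists tau, C, K.
  have [tau [C [t0 C0 g]]] := gr.
  by move=> /(_ tau t0)[K hK]; exists tau, C, K.
exists (K * C) => xi; have lo := nu_lower xi gb Fn0.
have K0 : 0 <= K by rewrite (le_trans _ (dK 0))// mulr_ge0 ?nrm_ge0 ?expR_ge0.
have := dK xi; rewrite -ler_pdivlMr ?expR_gt0// -expRN => le1.
by rewrite (le_trans le1)// -mulrA ler_wpM2l.
Qed.

(** Linearity of [cintegral] is established for integrable functions; this provides the linearity of
    [dual_fourier] in [u]. *)
Lemma fourier_pairing_cintegrable u chi : L1space nu u -> gs_space c chi ->
  (exists v : F, v != 0) -> cintegrable (fun xi => u xi * fourier chi xi).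
Proof.
move=> [mu' uoo] Schi Fn0; have [K hK] := fourier_le_nu Schi Fn0.
have mf : cmeasurable (fun xi => u xi * fourier chi xi).
  exact: cmeasurableM mu' (cmeasurable_fourier (gs_cintegrable adm Schi)).
apply/cintegrableP; split=> //.
have mg : measurable_fun setT (fun t : T => ((nrm (u (vec t)))%:E * nu (vec t))%E).
  by apply: emeasurable_funM measurable_nu_F; apply/measurable_EFinP; exact: measurable_nrm.
have p0 t : (0 <= (nrm (u (vec t)))%:E * nu (vec t))%E.
  by rewrite mule_ge0 ?lee_fin ?nrm_ge0 ?opnorm_ge0.
apply: (@le_lt_trans _ _ (\int[mu]_t (`|K|%:E * ((nrm (u (vec t)))%:E * nu (vec t))))%E).
  apply: ge0_le_integral => //.
  - by move=> t _; rewrite lee_fin nrm_ge0.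
  - by apply/measurable_EFinP; exact: (measurable_nrm mf).
  - by apply: emeasurable_funM mg; exact: measurable_cst.
  - move=> t _; rewrite nu_F_fine -!EFinM lee_fin nrmM mulrCA ler_wpM2l ?nrm_ge0//.
    by rewrite (le_trans (hK _))// ler_wpM2r ?ler_norm// fine_ge0 ?opnorm_ge0.
rewrite ge0_integralZl//.
by rewrite lte_mul_pinfty ?lee_fin.
Qed.

(** Settles the case of the zero space apart: the lower bound on nu takes a nonzero vector, but here
    all identities between vectors hold. *)
Lemma trivial_tmib : ~ (exists v : F, v != 0) -> forall v w, v = w.
Proof.
move=> F0 v w; have z (u : F) : u = 0.
  by apply/eqP; apply: contra_notT F0 => u0; exists u.
by rewrite (z v) (z w).
Qed.

Lemma Anorm_ge0 h : (0 <= Anorm c nu h)%E.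
Proof.
by apply: le_ereal_inf_tmp => _ [u _ <-]; apply: L1norm_ge0 => y; exact: opnorm_ge0.
Qed.

Lemma Anorm_le h u : L1space nu u -> is_fourier_of c h u -> (Anorm c nu h <= L1norm nu u)%E.
Proof. by move=> Lu hu; apply: ereal_inf_lbound; exists u. Qed.

Lemma Aspace_dual_fourier u : L1space nu u -> Aspace c nu (dual_fourier u).
Proof. by move=> Lu; exists u. Qed.

(** Trades the infimum in [Anorm] for the norm of any representative. *)
Lemma mult_bound : exists2 K : R, 0 <= K & forall h u v, L1space nu u -> is_fourier_of c h u ->
  ((nrm (mult h v))%:E <= K%:E * L1norm nu u * (nrm v)%:E)%E.
Proof.
have [K hK] := mult_continuous mt; exists `|K| => // h u v Lu hu.
have Ah : Aspace c nu h by exists u.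
apply: le_trans (hK h v Ah) _; rewrite lee_wpmul2r ?lee_fin ?nrm_ge0//.
apply: (@le_trans _ _ (`|K|%:E * Anorm c nu h)%E).
  by rewrite lee_wpmul2r ?Anorm_ge0// lee_fin ler_norm.
by rewrite lee_wpmul2l// Anorm_le.
Qed.

(* The difference is the product with a distribution of norm 0, being the
   Fourier transform of 0. *)
Lemma mult_eq h1 h2 v : Aspace c nu h1 -> Aspace c nu h2 -> gs_eq c h1 h2 ->
  mult h1 v = mult h2 v.
Proof.
move=> A1 A2 e12; have := mult_linearl mt (-1) v A1 A2.
have [K _ hK] := mult_bound.
have L0 : L1norm nu (fun=> 0) = 0%E.
  by rewrite /L1norm integral0_eq// => t _; rewrite nrm0 mul0e.
have Lz : L1space nu (fun=> 0).
  by split; [exact: cmeasurable_cst|rewrite L0].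
have -> : mult (fun phi => -1 * h1 phi + h2 phi) v = 0.
  have := hK (fun phi => -1 * h1 phi + h2 phi) (fun=> 0) v Lz.
  rewrite L0 mule0 mul0e lee_fin => /(_ _)/wrap[phi Sphi|le0].
    rewrite e12// mulN1r addNr /dist_of_fun.
    rewrite (_ : Defs.mulf _ _ = (fun=> 0)) ?cintegral0//.
    by apply/funext => y; rewrite /Defs.mulf mul0r.
  by apply: nrm0_eq0; apply/eqP; rewrite eq_le le0 nrm_ge0.
by move=> /eqP; rewrite scaleN1r eq_sym addrC subr_eq0 => /eqP.
Qed.

End multiplication_action.

Section multiplication_module.
Context (R : realType) (d : nat) (c : gs_class R).
Context (F : completeNormedModType R[i]) (j : F -> Cfun R d -> R[i]).
Context (mult : (Cfun R d -> R[i]) -> F -> F).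
Hypotheses (adm : gs_admissible c) (FT : is_TMIB c j) (mt : is_multiplication_on c j mult).
Local Notation V := 'rV[R]_d.
Local Notation emb := (tmib_embed c j).
Local Notation md := (tmib_modulate c j).
Local Notation nu := (nu_F c j).
Implicit Types (phi psi chi : Cfun R d) (x y xi : V) (v w : F) (u : Cfun R d)
  (h : Cfun R d -> R[i]) (f : F -> R[i]).

Lemma gauss_L1space (s : 'I_d -> R) a : (forall i, 0 < s i) ->
  L1space nu (translate a (cgauss s (fun=> 0%N))).
Proof.
move=> s0; set G := translate a _.
have mG : cmeasurable G.
  by apply: smooth_cmeasurable; apply: smooth_translate; exact: smooth_cgauss.
split=> //; have [C [L [L0 _ gM]]] := tmib_exp_growth adm FT.
have [k ik hk] := translated_gauss_weight a s0 L0.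
have C0 : 0 <= C.
  by have := le_trans (opnorm_ge0 _) (gM 0); rewrite lee_fin pmulr_lge0 ?expR_gt0.
have iC := integrableZl measurableT C ik.
move/integrableP : (iC) => [mC iCoo].
apply: le_lt_trans iCoo; apply: ge0_le_integral => //.
- by move=> t _; rewrite mule_ge0 ?lee_fin ?nrm_ge0 ?opnorm_ge0.
- apply: emeasurable_funM; last exact: (measurable_nu_F adm FT).
  by apply/measurable_EFinP; exact: measurable_nrm.
- exact: measurableT_comp.
- move=> t _; rewrite (nu_F_fine adm FT) -!EFinM/= lee_fin (le_trans _ (ler_norm _))//.
  apply: le_trans (ler_wpM2l C0 (hk _)).
  rewrite mulrCA ler_wpM2l ?nrm_ge0// -lee_fin -(nu_F_fine adm FT).
  exact: gM.
Qed.

Lemma gs_fourier_gauss (s : 'I_d -> R) a : (forall i, 0 < s i) ->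
  gs_space c (fourier (translate a (cgauss s (fun=> 0%N)))).
Proof.
move=> s0; rewrite fourier_translate; last by apply: (gs_cintegrable adm); exact: gs_cgauss.
apply: (gs_modulate adm); set k := fourier (cgauss s (fun=> 0%N)) 0.
have Sg : gs_space c (cgauss (fun i => pi ^+ 2 / s i) (fun=> 0%N) : Cfun R d).
  by apply: gs_cgauss => // i; rewrite divr_gt0 ?exprn_gt0 ?pi_gt0.
(* Linear combinations are available in the form a f + g, and (k - 1) g + g = k g supplies the
   scalar multiple. *)
have := gs_lin adm (k - 1) Sg Sg.
congr (gs_space c _); apply/funext => xi; rewrite (fourier_cgauss s0) -/k.
by move: (cgauss _ _ xi) => z; ring.
Qed.

(** On the space, the dual Fourier transform of G is the distribution of the function [fourier G],
    itself a test function; so the product is an ordinary one, and the duality of the Fourier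
    transform writes its pairing with chi as an integral over xi. *)
Lemma gauss_multiplication (s : 'I_d -> R) a psi f :
  (forall i, 0 < s i) -> gs_space c psi -> bounded_linear f ->
  f (mult (dual_fourier (translate a (cgauss s (fun=> 0%N)))) (emb psi)) =
  cintegral setT (fun xi => translate a (cgauss s (fun=> 0%N)) xi * f (md (- xi) (emb psi))).
Proof.
move=> s0 Spsi bf; set G := translate a _.
have [C [L [L0 _ gM]]] := tmib_exp_growth adm FT.
have lU := modulate_action_linear adm FT.
have cU := modulate_action_continuous adm FT (imageP emb Spsi).
have [I hI] := gauss_weak_integral a lU L0 gM cU s0.
have SG : gs_space c G by apply: (gs_translate adm); exact: gs_cgauss.
have iG := gs_cintegrable adm SG.
have LG : L1space nu G by exact: gauss_L1space.
have SfG : gs_space c (fourier G) by exact: gs_fourier_gauss.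
have hG : is_fourier_of c (dist_of_fun (fourier G)) G.
  by move=> chi Schi; exact: fourier_duality (gs_cintegrable adm Schi).
rewrite (@mult_eq _ _ _ _ _ _ mt _ (dist_of_fun (fourier G))).
- rewrite (mult_extends mt)// (_ : emb _ = I) ?hI//.
  apply: (tmib_embed_unique FT) => chi Schi.
  have ipc := gs_mulf_cintegrable adm Spsi Schi.
  rewrite (hI _ (tmib_eval FT Schi)) -/G.
  rewrite /dist_of_fun (_ : Defs.mulf _ chi = (fun x => fourier G x * Defs.mulf psi chi x)); last first.
    by apply/funext => x; rewrite /Defs.mulf mulrA.
  rewrite fourier_duality//; apply: eq_cintegral => xi; congr (_ * _).
  rewrite (tmib_modulateP FT)// /dist_modulate (tmib_embedP FT)//; last exact: (gs_modulate adm).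
  apply: eq_cintegral => x; rewrite /Defs.mulf /modulate mulrCA; congr (cis _ * _).
  rewrite dotvC (_ : dotv x (- xi) = - dotv x xi) ?mulrN//.
  by rewrite /dotv -sumrN; apply: eq_bigr => i _; rewrite mxE mulrN.
- exact: Aspace_dual_fourier.
- by exists G.
- by move=> chi Schi; rewrite hG.
Qed.

(** The general action applies to [mult] composed with [dual_fourier]; [h] may be replaced by the
    dual Fourier transform of [u], as the product depends only on the values of [h] on the space. *)
Lemma multiplication_module h u f : L1space nu u -> is_fourier_of c h u -> bounded_linear f ->
  (dual_norm (dual_multiplication mult h f) <= L1norm nu u * dual_norm (f : F -> R[i]^o))%E /\
  weakstar_pettis_integral (fun xi v => (u xi * dual_modulate c j (- xi) f v : R[i]^o))
    (dual_multiplication mult h f).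
Proof.
have [C [L [L0 _ gM]]] := tmib_exp_growth adm FT.
have lU := modulate_action_linear adm FT.
have cU := modulate_action_continuous adm FT.
have Adf := @Aspace_dual_fourier _ _ c F j.
have a1 (a : R[i]) g1 g2 v : L1space nu g1 -> L1space nu g2 ->
    mult (dual_fourier (fun x => a * g1 x + g2 x)) v =
    a *: mult (dual_fourier g1) v + mult (dual_fourier g2) v.
  move=> L1 L2; have [Fn0|/trivial_tmib F0] := pselect (exists v : F, v != 0); last exact: F0.
  rewrite -(mult_linearl mt); [|exact: Adf..].
  have e : gs_eq c (fun phi => a * dual_fourier g1 phi + dual_fourier g2 phi)
      (dual_fourier (fun x => a * g1 x + g2 x)).
    move=> chi Schi; rewrite /dual_fourier /dist_of_fun -cintegral_lin//.
    + by apply: eq_cintegral => x; rewrite /Defs.mulf; ring.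
    + exact: (fourier_pairing_cintegrable adm FT).
    + exact: (fourier_pairing_cintegrable adm FT).
  have L12 : L1space nu (fun x => a * g1 x + g2 x).
    by apply: L1space_lin => //; [move=> y; exact: opnorm_ge0|exact: (measurable_nu_F adm FT)].
  by apply: (mult_eq mt); [exact: Adf|exists (fun x => a * g1 x + g2 x)|move=> chi /e].
have a2 g : L1space nu g -> linear_map (mult (dual_fourier g)).
  by move=> /Adf; exact: (mult_linearr mt).
have a3 : exists K : R, forall g v, L1space nu g ->
    ((nrm (mult (dual_fourier g) v))%:E <= K%:E * L1norm nu g * (nrm v)%:E)%E.
  by have [K _ hK] := mult_bound mt; exists K => g v Lg; exact: hK.
have a4 (s : 'I_d -> R) a w f0 : (forall i, 0 < s i) -> (emb @` gs_space c) w ->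
    bounded_linear f0 ->
    f0 (mult (dual_fourier (translate a (cgauss s (fun=> 0%N)))) w) =
    cintegral setT (fun xi => translate a (cgauss s (fun=> 0%N)) xi * f0 (md (- xi) w)).
  by move=> s0 [psi Spsi <-]; exact: gauss_multiplication.
move=> Lu hu bf.
have -> : dual_multiplication mult h f = (fun v => f (mult (dual_fourier u) v)).
  apply/funext => v; rewrite /dual_multiplication.
  by rewrite (mult_eq mt v _ (Adf _ Lu) hu)//; exists u.
split.
- exact: (dual_norm_action (act := fun g => mult (dual_fourier g)) lU L0 gM (tmib_dense FT) cU a1 a2 a3 a4).
- exact: (action_pettis (act := fun g => mult (dual_fourier g)) lU L0 gM (tmib_dense FT) cU a1 a2 a3 a4).
Qed.

End multiplication_module.

Theorem corollary3p5 (R : realType) (d : nat) (c : gs_class R)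
    (F : completeNormedModType R[i]) (j : F -> Cfun R d -> R[i])
    (conv : Cfun R d -> F -> F) (mult : (Cfun R d -> R[i]) -> F -> F)
    (c_adm : gs_admissible c) (F_TMIB : is_TMIB c j)
    (conv_ext : is_convolution_on c j conv)
    (mult_ext : is_multiplication_on c j mult) :
  [/\ forall g f, L1space (omega_E c j) g -> dual_space f ->
        (dual_norm (dual_convolution conv g f)
           <= L1norm (omega_E c j) g * dual_norm f)%E,
      forall h f, Aspace c (nu_E c j) h -> dual_space f ->
        (dual_norm (dual_multiplication mult h f)
           <= Anorm c (nu_E c j) h * dual_norm f)%E,
      forall g f, L1space (omega_E c j) g -> dual_space f ->
        weakstar_pettis_integral
          (fun y v => g y * dual_translate c j y f v)
          (dual_convolution conv g f) &
      forall h u f, L1space (nu_E c j) u -> is_fourier_of c h u ->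
        dual_space f ->
        weakstar_pettis_integral
          (fun xi v => u xi * dual_modulate c j (- xi) f v)
          (dual_multiplication mult h f)].
Proof.
split=> [g f Lg /dual_spaceP bf|h f [u0 Lu0 hu0] /dual_spaceP bf|g f Lg /dual_spaceP bf
        |h u f].
- exact: (convolution_module c_adm F_TMIB conv_ext Lg bf).1.
- rewrite (nu_EE c_adm F_TMIB) in Lu0 *.
  have bound u : L1space (nu_F c j) u -> is_fourier_of c h u ->
      (dual_norm (dual_multiplication mult h f) <= L1norm (nu_F c j) u * dual_norm f)%E.
    by move=> Lu hu; exact: (multiplication_module c_adm F_TMIB mult_ext Lu hu bf).1.
  (* The estimate holds for each representative and passes to the infimum after division by the dual
     norm, whose vanishing is treated separately. *)
  have ff := dual_norm_fin_num bf; have := dual_norm_ge0 f.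
  rewrite -(fineK ff) lee_fin le_eqVlt => /orP[/eqP f0|f0].
    by have := bound u0 Lu0 hu0; rewrite -(fineK ff) -f0 !mule0.
  rewrite -lee_pdivrMr//; apply: le_ereal_inf_tmp => _ [u [Lu hu] <-].
  by rewrite lee_pdivrMr// fineK//; exact: bound.
- exact: (convolution_module c_adm F_TMIB conv_ext Lg bf).2.
- rewrite (nu_EE c_adm F_TMIB) => Lu hu /dual_spaceP bf.
  exact: (multiplication_module c_adm F_TMIB mult_ext Lu hu bf).2.
Qed.
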